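(* Let $n\ge2$, let $q\in\mathbb C$ be a root of unity of odd order $d>2$, and let $T(L)$ be a $q$-generic Gelfand-Tsetlin tableau of height $n$. Let $p=(p_{ij})_{1\le j\le i<n}$ be a family of nonzero complex numbers. For $T(R)\in\mathcal B(T(L))$ and $1\le j\le i<n$ let $W_{ij}(R)$ be the $U_q$-submodule of $V(T(L))$ generated by $T(R+d\delta^{ij})-p_{ij}T(R)$, let $$N=\sum_{\substack{T(R)\in\mathcal B(T(L))\\ 1\le j\le i<n}}W_{ij}(R),\qquad M=V(T(L))/N.$$ Then $M$ is an irreducible $U_q$-module of dimension $d^{\frac{n(n-1)}2}$. Moreover, $M$ has a basis consisting of (the images of) the tableaux $T\bigl(L+\sum_{1\le j\le i<n}m_{ij}\delta^{ij}\bigr)$ with integers $0\le m_{ij}<d$, $1\le j\le i<n$.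
   Context: The ground field is $\mathbb C$. Fix a determination of $q^x$ for complex $x$ (i.e. fix $h$ with $e^h=q$ and put $q^x=e^{hx}$). Put $[x]_q=\frac{q^x-q^{-x}}{q-q^{-1}}$ and $1(q)=\{x\in\mathbb C: q^x=1\}$; $\frac{1(q)}2=\{x/2: x\in 1(q)\}$. Let $P=\bigoplus_{i=1}^n\mathbb Z\epsilon_i$ with $\langle\epsilon_i,\epsilon_j\rangle=\delta_{ij}$ and $\alpha_i=\epsilon_i-\epsilon_{i+1}$. $U_q=U_q(\mathfrak{gl}_n)$ is the unital associative algebra generated by $e_i,f_i$ ($1\le i\le n-1$) and $q^h$ ($h\in P$) with relations $q^0=1$, $q^hq^{h'}=q^{h+h'}$, $q^he_iq^{-h}=q^{\langle h,\alpha_i\rangle}e_i$, $q^hf_iq^{-h}=q^{-\langle h,\alpha_i\rangle}f_i$, $e_if_j-f_je_i=\delta_{ij}\frac{q^{\alpha_i}-q^{-\alpha_i}}{q-q^{-1}}$, $e_i^2e_j-(q+q^{-1})e_ie_je_i+e_je_i^2=0$ and $f_i^2f_j-(q+q^{-1})f_if_jf_i+f_jf_i^2=0$ for $|i-j|=1$, $e_ie_j=e_je_i$ and $f_if_j=f_jf_i$ for $|i-j|>1$. A Gelfand-Tsetlin tableau $T(L)$ of height $n$ is a triangular array of complex numbers $L=(l_{ij})_{1\le j\le i\le n}$ ($i$ is the row index). $\delta^{ij}$ is the array with $1$ in position $(i,j)$ and $0$ elsewhere. $T(L)$ is $q$-generic if $l_{ij}-l_{ik}\notin\frac{1(q)}2+\mathbb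 Z$ for all $1\le i\le n$ and $j\ne k$. $\mathcal B(T(L))$ is the set of tableaux $T(R)$ with $r_{nj}=l_{nj}$ for all $j$ and $r_{ij}-l_{ij}\in\mathbb Z$ for $1\le j\le i\le n-1$. $V(T(L))$ is the vector space with basis $\mathcal B(T(L))$; for $q$-generic $T(L)$ it is a $U_q$-module (also when $q$ is a root of unity) via the Gelfand-Tsetlin formulas, for $T(R)\in\mathcal B(T(L))$: $$q^{\epsilon_k}T(R)=q^{a_k}T(R),\quad a_k=\sum_{i=1}^kr_{ki}-\sum_{i=1}^{k-1}r_{k-1,i}+k\quad(1\le k\le n),$$ $$e_kT(R)=-\sum_{j=1}^k\frac{\prod_{i=1}^{k+1}[r_{k+1,i}-r_{kj}]_q}{\prod_{i\ne j}[r_{ki}-r_{kj}]_q}T(R+\delta^{kj}),\quad f_kT(R)=\sum_{j=1}^k\frac{\prod_{i=1}^{k-1}[r_{k-1,i}-r_{kj}]_q}{\prod_{i\ne j}[r_{ki}-r_{kj}]_q}T(R-\delta^{kj})\quad(1\le k\le n-1).$$ *)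

(* Defs.v *)
From HB Require Import structures.
From mathcomp Require Import all_boot all_order all_algebra.
From mathcomp Require Import generic_quotient ring_quotient.
From mathcomp Require Import boolp classical_sets reals topology normedtype.
From mathcomp Require Import sequences exp trigo complex freeg.

Set Implicit Arguments.
Unset Strict Implicit.
Unset Printing Implicit Defensive.

Import Order.TTheory GRing.Theory Num.Theory.

Local Open Scope ring_scope.
Local Open Scope classical_set_scope.
Local Open Scope quotient_scope.
Local Open Scope complex_scope.

(* All indices are 1-based: [idx n] is {1, ..., n}. *)
Notation idx n := {k : 'I_n.+1 | (0 < k)%N}.

Definition idx_nat (n : nat) (k : idx n) : nat := val (val k).

(* The weight lattice P of gl_n, in the basis eps_1, ..., eps_n. *)
Notation weight n := {ffun idx n -> int}.

Definition eps (n k : nat) : weight n := [ffun c => (idx_nat c == k)%:R].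

Definition alpha (n i : nat) : weight n := eps n i - eps n i.+1.

Definition pairing (n : nat) (h h' : weight n) : int := \sum_c h c * h' c.

Inductive Uq_gen (n : nat) : Type :=
| GenE of idx n.-1
| GenF of idx n.-1
| GenK of weight n.

(* Noncommutative polynomial expressions; U_q is their quotient by the
   smallest congruence containing the algebra axioms and the relations. *)
Inductive Uq_term (F : fieldType) (n : nat) : Type :=
| TGen of Uq_gen n
| TScal of F
| TAdd of Uq_term F n & Uq_term F n
| TMul of Uq_term F n & Uq_term F n.

Arguments TGen {F n}.
Arguments TScal {F n}.

Declare Scope uq_scope.
Delimit Scope uq_scope with uq.
Bind Scope uq_scope with Uq_term.
Notation "c %:T" := (TScal c%R) : uq_scope.
Notation "x + y" := (TAdd x y) : uq_scope.
Notation "x * y" := (TMul x y) : uq_scope.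
Notation "x - y" := (TAdd x (TMul (TScal (-1)%R) y)) : uq_scope.

Definition adjacent (i j : nat) : bool := (i == j.+1) || (j == i.+1).

Definition far (i j : nat) : bool := (i.+1 < j)%N || (j.+1 < i)%N.

Section Uq.
Variables (F : fieldType) (n : nat) (q : F).
Local Notation term := (Uq_term F n).
Local Notation Eg i := (TGen (GenE i)).
Local Notation Fg i := (TGen (GenF i)).
Local Notation Kg h := (TGen (GenK h)).
Local Notation al i := (alpha n (idx_nat i)).

Inductive Uq_rel : term -> term -> Prop :=
| Rel_K0 : Uq_rel (Kg 0%R) (1%:T)
| Rel_KK h h' : Uq_rel (Kg h * Kg h') (Kg (h + h')%R)
| Rel_KE h i :
    Uq_rel (Kg h * Eg i * Kg (- h)%R) ((q ^ pairing h (al i))%:T * Eg i)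
| Rel_KF h i :
    Uq_rel (Kg h * Fg i * Kg (- h)%R) ((q ^ (- pairing h (al i)))%:T * Fg i)
| Rel_EF i j :
    Uq_rel (Eg i * Fg j - Fg j * Eg i)
      (((i == j)%:R / (q - q^-1))%:T * (Kg (al i) - Kg (- al i)%R))
| Rel_EEE i j : adjacent (idx_nat i) (idx_nat j) ->
    Uq_rel (Eg i * Eg i * Eg j - (q + q^-1)%:T * (Eg i * Eg j * Eg i)
            + Eg j * Eg i * Eg i) (0%:T)
| Rel_FFF i j : adjacent (idx_nat i) (idx_nat j) ->
    Uq_rel (Fg i * Fg i * Fg j - (q + q^-1)%:T * (Fg i * Fg j * Fg i)
            + Fg j * Fg i * Fg i) (0%:T)
| Rel_EE i j : far (idx_nat i) (idx_nat j) -> Uq_rel (Eg i * Eg j) (Eg j * Eg i)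
| Rel_FF i j : far (idx_nat i) (idx_nat j) -> Uq_rel (Fg i * Fg j) (Fg j * Fg i).

Inductive Uq_cong : term -> term -> Prop :=
| Cong_rel x y : Uq_rel x y -> Uq_cong x y
| Cong_refl x : Uq_cong x x
| Cong_sym x y : Uq_cong x y -> Uq_cong y x
| Cong_trans y x z : Uq_cong x y -> Uq_cong y z -> Uq_cong x z
| Cong_add x x' y y' : Uq_cong x x' -> Uq_cong y y' -> Uq_cong (x + y) (x' + y')
| Cong_mul x x' y y' : Uq_cong x x' -> Uq_cong y y' -> Uq_cong (x * y) (x' * y')
| Cong_addA x y z : Uq_cong (x + (y + z)) (x + y + z)
| Cong_addC x y : Uq_cong (x + y) (y + x)
| Cong_mulA x y z : Uq_cong (x * (y * z)) (x * y * z)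
| Cong_mulDl x y z : Uq_cong ((x + y) * z) (x * z + y * z)
| Cong_mulDr x y z : Uq_cong (x * (y + z)) (x * y + x * z)
| Cong_mul0 x : Uq_cong (0%:T * x) (0%:T)
| Cong_mul1 x : Uq_cong (1%:T * x) x
| Cong_scalD a b : Uq_cong ((a + b)%:T) (a%:T + b%:T)
| Cong_scalM a b : Uq_cong ((a * b)%:T) (a%:T * b%:T)
| Cong_scalC a x : Uq_cong (a%:T * x) (x * a%:T).

HB.instance Definition _ := gen_eqMixin term.
HB.instance Definition _ := gen_choiceMixin term.

Definition Uq_eqv (x y : term) : bool := `[< Uq_cong x y >].

Lemma Uq_eqv_class : equiv_class_of Uq_eqv.
Proof.
split=> [x|x y|y x z]; rewrite /Uq_eqv.
- by apply/asboolP; exact: Cong_refl.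
- by apply/asboolP/asboolP; exact: Cong_sym.
- by move=> /asboolP xy /asboolP yz; apply/asboolP; exact: Cong_trans xy yz.
Qed.

Canonical Uq_equiv := EquivRelPack Uq_eqv_class.
Canonical Uq_encModRel := defaultEncModRel Uq_eqv.

Definition Uq : Type := {eq_quot Uq_eqv}.
HB.instance Definition _ : EqQuotient term Uq_eqv Uq := EqQuotient.on Uq.
HB.instance Definition _ := Choice.on Uq.

Definition Uq_of (x : term) : Uq := \pi_Uq x.

Lemma Uq_ofP x y : Uq_of x = Uq_of y <-> Uq_cong x y.
Proof.
by split=> [/eqmodP/asboolP|xy]; [|apply/eqmodP/asboolP].
Qed.

Lemma Uq_of_repr (x : Uq) : Uq_of (repr x) = x.
Proof. exact: reprK. Qed.

Definition Uq_add (x y : Uq) : Uq := Uq_of (repr x + repr y).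
Definition Uq_mul (x y : Uq) : Uq := Uq_of (repr x * repr y).
Definition Uq_opp (x : Uq) : Uq := Uq_of ((-1)%:T * repr x).
Definition Uq_scale (c : F) (x : Uq) : Uq := Uq_of (c%:T * repr x).

Lemma Uq_reprP x : Uq_cong (repr (Uq_of x)) x.
Proof. by apply/Uq_ofP; rewrite Uq_of_repr. Qed.

Lemma Uq_ofD x y : Uq_of (x + y) = Uq_add (Uq_of x) (Uq_of y).
Proof. by apply/Uq_ofP/Cong_sym/Cong_add; exact: Uq_reprP. Qed.

Lemma Uq_ofM x y : Uq_of (x * y) = Uq_mul (Uq_of x) (Uq_of y).
Proof. by apply/Uq_ofP/Cong_sym/Cong_mul; exact: Uq_reprP. Qed.

Lemma Uq_ofZ c x : Uq_of (c%:T * x) = Uq_scale c (Uq_of x).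
Proof. by apply/Uq_ofP/Cong_mul; [exact: Cong_refl|exact/Cong_sym/Uq_reprP]. Qed.

Lemma Uq_ofN x : Uq_of ((-1)%:T * x) = Uq_opp (Uq_of x).
Proof. exact: Uq_ofZ. Qed.

Lemma Uq_ind (P : Uq -> Prop) : (forall x, P (Uq_of x)) -> forall x, P x.
Proof. by move=> Px x; rewrite -[x]Uq_of_repr. Qed.

Lemma Uq_addA : associative Uq_add.
Proof.
elim/Uq_ind=> x; elim/Uq_ind=> y; elim/Uq_ind=> z.
by rewrite -!Uq_ofD; apply/Uq_ofP/Cong_addA.
Qed.

Lemma Uq_addC : commutative Uq_add.
Proof.
by elim/Uq_ind=> x; elim/Uq_ind=> y; rewrite -!Uq_ofD; apply/Uq_ofP/Cong_addC.
Qed.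

Lemma Uq_scaleDl (a b : F) x : Uq_scale (a + b) x = Uq_add (Uq_scale a x) (Uq_scale b x).
Proof.
elim/Uq_ind: x => x; rewrite -!Uq_ofZ -Uq_ofD; apply/Uq_ofP.
apply: Cong_trans (Cong_mulDl _ _ _).
by apply: Cong_mul; [exact: Cong_scalD|exact: Cong_refl].
Qed.

Lemma Uq_scale1 x : Uq_scale 1 x = x.
Proof. by elim/Uq_ind: x => x; rewrite -Uq_ofZ; apply/Uq_ofP/Cong_mul1. Qed.

Lemma Uq_scale0 x : Uq_scale 0 x = Uq_of (0%:T).
Proof. by elim/Uq_ind: x => x; rewrite -Uq_ofZ; apply/Uq_ofP/Cong_mul0. Qed.

Lemma Uq_add0 : left_id (Uq_of (0%:T)) Uq_add.
Proof.
by move=> x; rewrite -(Uq_scale0 x) -{2}[x]Uq_scale1 -Uq_scaleDl add0r Uq_scale1.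
Qed.

Lemma Uq_addN : left_inverse (Uq_of (0%:T)) Uq_opp Uq_add.
Proof.
elim/Uq_ind=> x; rewrite -Uq_ofN Uq_ofZ -{2}[Uq_of x]Uq_scale1 -Uq_scaleDl.
by rewrite addNr Uq_scale0.
Qed.

HB.instance Definition _ := GRing.isZmodule.Build Uq Uq_addA Uq_addC Uq_add0 Uq_addN.

Lemma Uq_mulA : associative Uq_mul.
Proof.
elim/Uq_ind=> x; elim/Uq_ind=> y; elim/Uq_ind=> z.
by rewrite -!Uq_ofM; apply/Uq_ofP/Cong_mulA.
Qed.

Lemma Uq_mul1l : left_id (Uq_of (1%:T)) Uq_mul.
Proof. by elim/Uq_ind=> x; rewrite -Uq_ofM; apply/Uq_ofP/Cong_mul1. Qed.

Lemma Uq_mul1r : right_id (Uq_of (1%:T)) Uq_mul.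
Proof.
elim/Uq_ind=> x; rewrite -Uq_ofM; apply/Uq_ofP.
exact: Cong_trans (Cong_sym (Cong_scalC _ _)) (Cong_mul1 _).
Qed.

Lemma Uq_mulDl : left_distributive Uq_mul Uq_add.
Proof.
elim/Uq_ind=> x; elim/Uq_ind=> y; elim/Uq_ind=> z.
by rewrite -Uq_ofD -!Uq_ofM -Uq_ofD; apply/Uq_ofP/Cong_mulDl.
Qed.

Lemma Uq_mulDr : right_distributive Uq_mul Uq_add.
Proof.
elim/Uq_ind=> x; elim/Uq_ind=> y; elim/Uq_ind=> z.
by rewrite -Uq_ofD -!Uq_ofM -Uq_ofD; apply/Uq_ofP/Cong_mulDr.
Qed.

(* The counit of U_q, used only to see that U_q is nonzero. *)
Fixpoint counit (x : term) : F :=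
  match x with
  | TGen (GenK _) => 1
  | TGen _ => 0
  | TScal c => c
  | TAdd x y => counit x + counit y
  | TMul x y => counit x * counit y
  end.

Lemma counit_cong x y : Uq_cong x y -> counit x = counit y.
Proof.
elim=> {x y} /=.
- by move=> x y []; move=> * /=;
    rewrite ?(mulr0, mul0r, mulr1, mul1r, addr0, add0r, subrr) //= ?mulr0.
- by [].
- by [].
- by move=> y x z _ -> _ ->.
- by move=> x x' y y' _ -> _ ->.
- by move=> x x' y y' _ -> _ ->.
- by move=> *; rewrite addrA.
- by move=> *; rewrite addrC.
- by move=> *; rewrite mulrA.
- by move=> *; rewrite mulrDl.
- by move=> *; rewrite mulrDr.
- by move=> *; rewrite mul0r.
- by move=> *; rewrite mul1r.
- by [].
- by [].
- by move=> *; rewrite mulrC.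
Qed.

Lemma Uq_neq0 : Uq_of (1%:T) != 0.
Proof.
apply/eqP => /Uq_ofP /counit_cong /= /eqP; by rewrite oner_eq0.
Qed.

HB.instance Definition _ := GRing.Zmodule_isNzRing.Build Uq
  Uq_mulA Uq_mul1l Uq_mul1r Uq_mulDl Uq_mulDr Uq_neq0.

Lemma Uq_scaleE c x : Uq_scale c x = Uq_of (c%:T) * x.
Proof. by elim/Uq_ind: x => x; rewrite -Uq_ofZ Uq_ofM. Qed.

Lemma Uq_scaleA a b x : Uq_scale a (Uq_scale b x) = Uq_scale (a * b) x.
Proof.
rewrite !Uq_scaleE mulrA; congr (_ * _); rewrite -[LHS]Uq_ofM.
exact/Uq_ofP/Cong_sym/Cong_scalM.
Qed.

Lemma Uq_scaleDr : right_distributive Uq_scale +%R.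
Proof. by move=> a x y; rewrite !Uq_scaleE mulrDr. Qed.

Lemma Uq_scaleDl' x : {morph Uq_scale^~ x : a b / a + b}.
Proof. by move=> a b; exact: Uq_scaleDl. Qed.

HB.instance Definition _ := GRing.Zmodule_isLmodule.Build F Uq
  Uq_scaleA Uq_scale1 Uq_scaleDr Uq_scaleDl'.

Lemma Uq_scalerAl (a : F) (x y : Uq) : a *: (x * y) = a *: x * y.
Proof. by rewrite [LHS]Uq_scaleE [a *: x]Uq_scaleE mulrA. Qed.

HB.instance Definition _ := GRing.Lmodule_isLalgebra.Build F Uq Uq_scalerAl.

Lemma Uq_scalerAr (a : F) (x y : Uq) : a *: (x * y) = x * (a *: y).
Proof.
rewrite [LHS]Uq_scaleE [a *: y]Uq_scaleE !mulrA; congr (_ * _).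
elim/Uq_ind: x => x; rewrite -[LHS]Uq_ofM -[RHS]Uq_ofM.
exact/Uq_ofP/Cong_scalC.
Qed.

HB.instance Definition _ := GRing.Lalgebra_isAlgebra.Build F Uq Uq_scalerAr.

Definition Uq_e (i : idx n.-1) : Uq := Uq_of (Eg i).
Definition Uq_f (i : idx n.-1) : Uq := Uq_of (Fg i).
Definition Uq_k (h : weight n) : Uq := Uq_of (Kg h).

End Uq.

(* Modules over an algebra, submodules and quotients.  An action of [A] on the
   vector space [V] restricts to the given scalar multiplication on [V]. *)
Section Modules.
Variables (F : fieldType) (A : algType F).

Record amodule (V : lmodType F) := AModule {
  act :> A -> V -> V;
  actDl : forall a b v, act (a + b) v = act a v + act b v;
  actDr : forall a v w, act a (v + w) = act a v + act a w;
  actZ : forall c a v, act (c *: a) v = c *: act a v;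
  act1 : forall v, act 1 v = v;
  actM : forall a b v, act (a * b) v = act a (act b v)
}.

Variables (V : lmodType F) (M : amodule V).

Record submodule := Submodule {
  sm_set :> V -> Prop;
  sm0 : sm_set 0;
  smD : forall v w, sm_set v -> sm_set w -> sm_set (v + w);
  smA : forall a v, sm_set v -> sm_set (M a v)
}.

Lemma actr0 a : M a 0 = 0.
Proof. by apply: (@addrI _ (M a 0)); rewrite -actDr !addr0. Qed.

Lemma actZ1 c v : M (c *: 1) v = c *: v.
Proof. by rewrite actZ act1. Qed.

Lemma actrZ a c v : M a (c *: v) = c *: M a v.
Proof. by rewrite -actZ1 -actM -scalerAr mulr1 actZ. Qed.

Lemma smZ (N : submodule) c v : N v -> N (c *: v).
Proof. by rewrite -actZ1; exact: smA. Qed.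

Definition gen_set (v : V) : set V := [set w | forall N : submodule, N v -> N w].

Lemma gen_set0 v : gen_set v 0.
Proof. by move=> N _; exact: sm0. Qed.

Lemma gen_setD v x y : gen_set v x -> gen_set v y -> gen_set v (x + y).
Proof. by move=> vx vy N Nv; apply: smD; [exact: vx|exact: vy]. Qed.

Lemma gen_setA v a x : gen_set v x -> gen_set v (M a x).
Proof. by move=> vx N Nv; apply: smA; exact: vx. Qed.

Definition gen_submod (v : V) : submodule :=
  Submodule (@gen_set0 v) (@gen_setD v) (@gen_setA v).

(* Finite sums of elements of the members of an arbitrary family. *)
Definition sum_set (I : Type) (W : I -> submodule) : set V :=
  [set w | exists s : seq V,
     (forall x, x \in s -> exists i, W i x) /\ w = \sum_(x <- s) x].

Section SumSubmodule.
Variables (I : Type) (W : I -> submodule).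

Lemma sum_set0 : sum_set W 0.
Proof. by exists [::]; rewrite big_nil. Qed.

Lemma sum_setD x y : sum_set W x -> sum_set W y -> sum_set W (x + y).
Proof.
move=> [s [sW ->]] [t [tW ->]]; exists (s ++ t); split; last by rewrite big_cat.
by move=> z; rewrite mem_cat => /orP[/sW|/tW].
Qed.

Lemma sum_setA a x : sum_set W x -> sum_set W (M a x).
Proof.
move=> [s [sW ->]]; exists (map (M a) s); split.
  by move=> z /mapP[y /sW[i Wy] ->]; exists i; exact: smA.
rewrite big_map; elim: s {sW} => [|y s IHs]; first by rewrite !big_nil actr0.
by rewrite !big_cons actDr IHs.
Qed.

Definition sum_submod : submodule := Submodule sum_set0 sum_setD sum_setA.
End SumSubmodule.

Definition irreducible_module : Prop :=
  (exists v : V, v <> 0) /\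
  forall N : submodule, (forall v, N v -> v = 0) \/ (forall v, N v).

Section QuotientModule.
Variable N : submodule.

Definition sm_pred : {pred V} := fun v => `[< N v >].

Lemma sm_pred_closed : zmod_closed sm_pred.
Proof.
split; first by apply/asboolP; exact: sm0.
move=> x y /asboolP Nx /asboolP Ny; apply/asboolP.
by apply: smD => //; rewrite -scaleN1r; exact: smZ.
Qed.

HB.instance Definition _ := GRing.isZmodClosed.Build V sm_pred sm_pred_closed.

Definition quot : Type := Quotient.quot sm_pred.
HB.instance Definition _ := GRing.Zmodule.copy quot (Quotient.quot sm_pred).

Definition to_quot (v : V) : quot := \pi_(Quotient.quot sm_pred) v.

Definition quot_repr (x : quot) : V := repr (x : Quotient.quot sm_pred).

Lemma quot_reprK x : to_quot (quot_repr x) = x.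
Proof. exact: reprK. Qed.

Lemma to_quotP v w : to_quot v = to_quot w <-> N (v - w).
Proof.
split=> [/eqP|Nvw]; first by rewrite -Quotient.idealrBE => /asboolP.
by apply/eqP; rewrite -Quotient.idealrBE; apply/asboolP.
Qed.

Lemma to_quotD v w : to_quot (v + w) = to_quot v + to_quot w.
Proof. exact: (raddfD (\pi_(Quotient.quot sm_pred))). Qed.

Lemma quot_ind (P : quot -> Prop) : (forall v, P (to_quot v)) -> forall x, P x.
Proof. by move=> Pv x; rewrite -[x]quot_reprK. Qed.

Definition quot_scale (c : F) (x : quot) : quot := to_quot (c *: quot_repr x).

Definition quot_act_fun (a : A) (x : quot) : quot := to_quot (M a (quot_repr x)).

Lemma quot_actE a v : quot_act_fun a (to_quot v) = to_quot (M a v).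
Proof.
apply/to_quotP; rewrite -scaleN1r -actrZ -actDr scaleN1r; apply: smA.
by apply/to_quotP; rewrite quot_reprK.
Qed.

Lemma quot_scaleE c v : quot_scale c (to_quot v) = to_quot (c *: v).
Proof. by rewrite -actZ1 -quot_actE /quot_act_fun actZ1. Qed.

Lemma quot_scaleA a b x : quot_scale a (quot_scale b x) = quot_scale (a * b) x.
Proof. by elim/quot_ind: x => x; rewrite !quot_scaleE scalerA. Qed.

Lemma quot_scale1 x : quot_scale 1 x = x.
Proof. by elim/quot_ind: x => x; rewrite !quot_scaleE scale1r. Qed.

Lemma quot_scaleDr : right_distributive quot_scale +%R.
Proof.
move=> a; elim/quot_ind=> x; elim/quot_ind=> y.
by rewrite -to_quotD !quot_scaleE -to_quotD scalerDr.
Qed.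

Lemma quot_scaleDl x : {morph quot_scale^~ x : a b / a + b}.
Proof.
by move=> a b; elim/quot_ind: x => x; rewrite !quot_scaleE -to_quotD scalerDl.
Qed.

HB.instance Definition _ := GRing.Zmodule_isLmodule.Build F quot
  quot_scaleA quot_scale1 quot_scaleDr quot_scaleDl.

Lemma quot_actDl a b x :
  quot_act_fun (a + b) x = quot_act_fun a x + quot_act_fun b x.
Proof. by elim/quot_ind: x => x; rewrite !quot_actE actDl to_quotD. Qed.

Lemma quot_actDr a x y :
  quot_act_fun a (x + y) = quot_act_fun a x + quot_act_fun a y.
Proof.
elim/quot_ind: x => x; elim/quot_ind: y => y.
by rewrite -to_quotD !quot_actE actDr to_quotD.
Qed.

Lemma quot_actZ c a x : quot_act_fun (c *: a) x = c *: quot_act_fun a x.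
Proof. by elim/quot_ind: x => x; rewrite !quot_actE actZ [RHS]quot_scaleE. Qed.

Lemma quot_act1 x : quot_act_fun 1 x = x.
Proof. by elim/quot_ind: x => x; rewrite quot_actE act1. Qed.

Lemma quot_actM a b x :
  quot_act_fun (a * b) x = quot_act_fun a (quot_act_fun b x).
Proof. by elim/quot_ind: x => x; rewrite !quot_actE actM. Qed.

Definition quot_module : amodule quot :=
  AModule quot_actDl quot_actDr quot_actZ quot_act1 quot_actM.
End QuotientModule.
End Modules.

Section Bases.
Variables (F : fieldType) (V : lmodType F).

Definition is_basis (I : finType) (b : I -> V) : Prop :=
  (forall c : I -> F, \sum_i c i *: b i = 0 -> forall i, c i = 0) /\
  (forall v, exists c : I -> F, v = \sum_i c i *: b i).

Definition has_dim (k : nat) : Prop := exists b : 'I_k -> V, is_basis b.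
End Bases.

(* Positions (i, j) with 1 <= j <= i <= n. *)
Notation pos n := {c : 'I_n.+1 * 'I_n.+1 | (0 < c.2 <= c.1)%N}.

Definition row_ (n : nat) (c : pos n) : nat := (val c).1.
Definition col_ (n : nat) (c : pos n) : nat := (val c).2.

Notation tableau F n := {ffun pos n -> F}.

Section Tableaux.
Variables (F : fieldType) (n : nat).

(* Only meaningful for 1 <= j <= i <= n; the value is 0 elsewhere. *)
Definition entry (L : tableau F n) (i j : nat) : F :=
  if [pick c : pos n | (row_ c == i) && (col_ c == j)] is Some c then L c else 0.

Definition delta_tab (i j : nat) : tableau F n :=
  [ffun c => ((row_ c == i) && (col_ c == j))%:R].

Definition tab_set (L : tableau F n) : set (tableau F n) :=
  [set R | (forall c, row_ c = n -> R c = L c) /\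
           (forall c, (row_ c < n)%N -> exists m : int, R c - L c = m%:~R)].

(* V(T(L)), the vector space with basis [tab_set L]. *)
Definition tab_space (L : tableau F n) : Type := {freeg (set_type (tab_set L)) / F}.
HB.instance Definition _ L := GRing.Lmodule.copy (tab_space L)
  {freeg (set_type (tab_set L)) / F}.

(* The basis vector T(R), for R in [tab_set L] (and 0 for other R). *)
Definition tab_vec (L R : tableau F n) : tab_space L :=
  if insub R is Some b then << b : set_type (tab_set L) >> else 0.
End Tableaux.

Arguments delta_tab {F} n i j.

Definition cexp (R : realType) (z : R[i]) : R[i] :=
  let: a +i* b := z in (expR a * cos b) +i* (expR a * sin b).

(* The branch of q^x is fixed by h, which is meant to satisfy e^h = q. *)
Section QuantumNumbers.
Variables (R : realType) (q h : R[i]).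
Local Notation C := R[i].

Definition qpow (x : C) : C := cexp (h * x).

Definition qnum (x : C) : C := (qpow x - qpow (- x)) / (q - q^-1).

Definition one_q : set C := [set x | qpow x = 1].

Definition q_generic (n : nat) (L : tableau C n) : Prop :=
  forall i j k : nat, (1 <= i <= n)%N -> (1 <= j <= i)%N -> (1 <= k <= i)%N ->
    j != k ->
    ~ exists x (m : int), one_q x /\ entry L i j - entry L i k = x / 2 + m%:~R.

Definition gt_weight (n : nat) (T : tableau C n) (k : nat) : C :=
  \sum_(1 <= i < k.+1) entry T k i - \sum_(1 <= i < k) entry T k.-1 i + k%:R.

Definition gt_e_coef (n : nat) (T : tableau C n) (k j : nat) : C :=
  (\prod_(1 <= i < k.+2) qnum (entry T k.+1 i - entry T k j)) /
  (\prod_(1 <= i < k.+1 | i != j) qnum (entry T k i - entry T k j)).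

Definition gt_f_coef (n : nat) (T : tableau C n) (k j : nat) : C :=
  (\prod_(1 <= i < k) qnum (entry T k.-1 i - entry T k j)) /
  (\prod_(1 <= i < k.+1 | i != j) qnum (entry T k i - entry T k j)).

Definition gt_formulas (n : nat) (L : tableau C n)
    (M : amodule (Uq n q) (tab_space L)) : Prop :=
  forall T : tableau C n, tab_set L T ->
  [/\ forall k : idx n,
        let k := idx_nat k in
        M (Uq_k _ (eps n k)) (tab_vec L T) =
          qpow (gt_weight T k) *: tab_vec L T,
      forall k : idx n.-1,
        M (Uq_e _ k) (tab_vec L T) =
          let k := idx_nat k in
          - \sum_(1 <= j < k.+1)
              gt_e_coef T k j *: tab_vec L (T + delta_tab n k j) &
      forall k : idx n.-1,
        M (Uq_f _ k) (tab_vec L T) =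
          let k := idx_nat k in
          \sum_(1 <= j < k.+1)
            gt_f_coef T k j *: tab_vec L (T - delta_tab n k j)].

(* Families over 1 <= j <= i < n are indexed by [pos n.-1]. *)
Definition gt_relators (n d : nat) (p : pos n.-1 -> C) (L : tableau C n)
    (M : amodule (Uq n q) (tab_space L)) : submodule M :=
  sum_submod (fun Tc : set_type (tab_set L) * pos n.-1 =>
    let: (T, c) := Tc in
    gen_submod M (tab_vec L (val T + delta_tab n (row_ c) (col_ c) *+ d)
                  - p c *: tab_vec L (val T))).

Definition shift_tab (n d : nat) (L : tableau C n)
    (m : {ffun pos n.-1 -> 'I_d}) : tableau C n :=
  L + \sum_(c : pos n.-1) delta_tab n (row_ c) (col_ c) *+ m c.
End QuantumNumbers.

(* Main.v *)
(* The Gelfand-Tsetlin formulas satisfy the relations of U_q because of rational identities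
   in the variables q^(l_ij): the Serre relations after symmetrization over the two moves in
   the same row, and the diagonal part of [e_k, f_k] by Lagrange interpolation.

   Shifting an entry by d does not change any coefficient, so it is a module automorphism.
   Hence N is spanned by the vectors T(R + d delta^ij) - p_ij T(R), and the functionals
   sending T(L + m) to prod p_ij^(m_ij div d), on one class of m modulo d, are zero on N.

   For irreducibility, one shows by induction on k that U_q realizes on the quotient every
   diagonal operator and every shift that only involve the rows up to k.  Isolating one term
   of e_k by conjugation with a diagonal operator and shifting back gives the diagonal
   operators prod_i [l_(k+1,i) - l_kj]; with the weight they determine the monic polynomial
   with roots q^(2 l_(k+1,i)), hence row k+1 modulo d, and a separating algebra of functions
   on a finite set contains all functions.  Isolating one term of f_(k+1) gives the shifts
   in row k+1, because the zeros of its coefficient can be moved away by shifts in row k.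
   The shifts by +1 are p_ij times the (d-1)-fold shifts by -1. *)
From HB Require Import structures.
From mathcomp Require Import all_boot all_order all_algebra.
From mathcomp Require Import boolp classical_sets reals exp trigo complex freeg.
From mathcomp Require Import ring zify.
Require Import Defs.

Set Implicit Arguments.
Unset Strict Implicit.
Unset Printing Implicit Defensive.

Import Order.TTheory GRing.Theory Num.Theory.

Local Open Scope ring_scope.
Local Open Scope complex_scope.

(** * Identities for the Gelfand-Tsetlin coefficients *)

(** Whether a quantum number vanishes depends only on squares of powers of [q], so what [e_k]
    reveals about a row concerns [q ^ (2 l)]. The half in the definition of genericity keeps these
    squares distinct within a row under all integer shifts, and the odd order [d] recovers [q ^ l]
    from its square among integral translates. The two kinds of generators play different roles
    because they look in opposite directions. [e_k] sees row k+1, hence gives access to a row not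
    yet controlled. Apart from its own row, [f_(k+1)] sees only row k, so its coefficient can be
    divided out by diagonal operators already available. Shifts cannot be extracted from [e_(k+1)]
    in the same way: in the last step its coefficient involves the top row, which no shift moves.
    Raising an entry is therefore obtained from lowering through the relation with [p], and this is
    why operators are realized only modulo [N]. Nothing in that argument shows that [N] is proper;
    this, and linear independence, rest on the functionals. *)

Section ScalarIdentities.
Variable F : fieldType.
Implicit Types c s u v w x y z : F.

(* [br (q - q^-1) (q ^ a) (q ^ b)] is the quantum number of [a - b]. *)
Definition br c y x := (y / x - x / y) / c.

(** The reason for stating the genericity conditions on squares: [y / x - x / y] is
    [y ^+ 2 - x ^+ 2] up to a nonzero factor. *)
Lemma br_neq0 c y x : c != 0 -> x != 0 -> y != 0 ->
  (br c y x != 0) = (y ^+ 2 != x ^+ 2).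
Proof.
move=> c0 x0 y0.
rewrite /br mulf_eq0 invr_eq0 (negPf c0) orbF.
have -> : y / x - x / y = (y ^+ 2 - x ^+ 2) / (x * y).
  by field; rewrite y0.
by rewrite mulf_eq0 invr_eq0 mulf_eq0 (negPf x0) (negPf y0) !orbF subr_eq0.
Qed.

Lemma br_mul c y x : c != 0 -> x != 0 -> y != 0 ->
  br c y x * (- c * x * y) = x ^+ 2 - y ^+ 2.
Proof. by move=> c0 x0 y0; rewrite /br; field; rewrite c0 x0 y0. Qed.

(** [u] and [v] are the entries moved in one row; [y] is an entry that their coefficients see and
    that the third operator multiplies by [s]. The three products have that third move first, in
    between and last. In the denominators, the second of the two moves finds the first entry already
    scaled. *)
Lemma serre_upper_id c s y u v : c != 0 -> s != 0 -> y != 0 -> u != 0 -> v != 0 ->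
  u ^+ 2 != v ^+ 2 -> (s * u) ^+ 2 != v ^+ 2 -> (s * v) ^+ 2 != u ^+ 2 ->
  (br c (s * y) u * br c (s * y) v - (s + s^-1) * (br c y u * br c (s * y) v)
    + br c y u * br c y v) / (br c v u * br c (s * u) v) +
  (br c (s * y) v * br c (s * y) u - (s + s^-1) * (br c y v * br c (s * y) u)
    + br c y v * br c y u) / (br c u v * br c (s * v) u) = 0.
Proof.
move=> c0 s0 y0 u0 v0; rewrite -!(subr_eq0 (_ ^+ 2)) !expr2 => uv suv svu.
rewrite /br; field; rewrite c0 s0 y0 u0 v0 /= !mulNr uv suv svu /=.
by rewrite -opprB oppr_eq0.
Qed.

(** The mirror situation: [w] is the entry moved by the third operator, and it is its coefficient
    that sees [u] and [v], scaled or not yet scaled. *)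
Lemma serre_lower_id c s w u v : c != 0 -> s != 0 -> w != 0 -> u != 0 -> v != 0 ->
  u ^+ 2 != v ^+ 2 -> (s * u) ^+ 2 != v ^+ 2 -> (s * v) ^+ 2 != u ^+ 2 ->
  (br c u w * br c v w - (s + s^-1) * (br c (s * u) w * br c v w)
    + br c (s * u) w * br c (s * v) w) / (br c v u * br c (s * u) v) +
  (br c v w * br c u w - (s + s^-1) * (br c (s * v) w * br c u w)
    + br c (s * v) w * br c (s * u) w) / (br c u v * br c (s * v) u) = 0.
Proof.
move=> c0 s0 y0 u0 v0; rewrite -!(subr_eq0 (_ ^+ 2)) !expr2 => uv suv svu.
rewrite /br; field; rewrite c0 s0 y0 u0 v0 /= !mulNr uv suv svu /=.
by rewrite -opprB oppr_eq0.
Qed.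

Lemma serre_upper_diag_id c s y u : c != 0 -> s != 0 -> y != 0 -> u != 0 ->
  br c (s * y) u * br c (s * y) (s * u)
    - (s + s^-1) * (br c y u * br c (s * y) (s * u))
    + br c y u * br c y (s * u) = 0.
Proof. by move=> c0 s0 y0 u0; rewrite /br; field; rewrite c0 s0 y0 u0. Qed.

(** The three-term recurrence of quantum numbers at consecutive arguments; it occurs when one entry
    is moved twice. *)
Lemma serre_lower_diag_id c s w u : c != 0 -> s != 0 -> w != 0 -> u != 0 ->
  br c u w - (s + s^-1) * br c (s * u) w + br c (s * (s * u)) w = 0.
Proof. by move=> c0 s0 w0 u0; rewrite /br; field; rewrite c0 s0 w0 u0. Qed.

Lemma br_opp c x y : br c x y = - br c y x.
Proof. by rewrite /br -[RHS]mulNr opprB. Qed.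

Lemma br_scale c s x y : s != 0 -> br c (s * x) (s * y) = br c x y.
Proof.
by move=> s0; rewrite /br -!mulf_div !divff // !mul1r.
Qed.
End ScalarIdentities.

(** * Coefficients of the Gelfand-Tsetlin formulas and the effect of moves on them *)

Section Coefficients.
Variables (F : fieldType) (c : F).
Implicit Types (Y : nat -> nat -> F) (s : F).
Local Notation br := (br c).

(* With [Y r l = q ^ entry (r, l)], the coefficients of e_k and f_k are those of
   [gcoef Y k k.+1] and [gcoef Y k k.-1]. *)
Definition gcoef Y r r' i :=
  (\prod_(1 <= l < r'.+1) br (Y r' l) (Y r i)) /
  (\prod_(1 <= l < r.+1 | l != i) br (Y r l) (Y r i)).

Definition mv s r i Y : nat -> nat -> F :=
  fun r1 i1 => if (r1 == r) && (i1 == i) then s * Y r i else Y r1 i1.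

Lemma mv_row s r i Y r1 l : r1 != r -> mv s r i Y r1 l = Y r1 l.
Proof. by rewrite /mv => /negPf->. Qed.

Lemma mv_col s r i Y r1 l : l != i -> mv s r i Y r1 l = Y r1 l.
Proof. by rewrite /mv => /negPf->; rewrite andbF. Qed.

Lemma mv_same s r i Y : mv s r i Y r i = s * Y r i.
Proof. by rewrite /mv !eqxx. Qed.

Lemma mvC s s' r i r1 i1 Y : r1 != r ->
  mv s r i (mv s' r1 i1 Y) = mv s' r1 i1 (mv s r i Y).
Proof.
move=> r1r; apply/funext=> a; apply/funext=> b; rewrite /mv.
by have [->|_] := eqVneq a r; rewrite ?(eq_sym r r1) ?(negPf r1r) ?andbF ?if_same //.
Qed.

Lemma gcoef_far s r1 i1 Y r r' i : r != r1 -> r' != r1 ->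
  gcoef (mv s r1 i1 Y) r r' i = gcoef Y r r' i.
Proof.
move=> rr1 r'r1; rewrite /gcoef.
by congr (_ / _); apply: eq_bigr => l _; rewrite !mv_row.
Qed.

Lemma prod_split (f : nat -> F) (P : pred nat) m r : (0 < m < r.+1)%N -> P m ->
  \prod_(1 <= l < r.+1 | P l) f l =
  f m * \prod_(1 <= l < r.+1 | P l && (l != m)) f l.
Proof.
move=> mr Pm; rewrite -big_filter (bigD1_seq m) ?big_filter_cond //=.
  by rewrite mem_filter Pm mem_index_iota.
by rewrite filter_uniq // iota_uniq.
Qed.

(** In [gnum] and [gden2] the factors touched by a move are taken out of the numerator or
    denominator, so that what remains is invariant under that move. *)
Definition gnum Y r' x m := \prod_(1 <= l < r'.+1 | l != m) br (Y r' l) x.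
Definition gden Y r i := \prod_(1 <= l < r.+1 | l != i) br (Y r l) (Y r i).
Definition gden2 Y r i j :=
  \prod_(1 <= l < r.+1 | (l != i) && (l != j)) br (Y r l) (Y r i).

Lemma gcoefE Y r r' i m : (0 < m < r'.+1)%N ->
  gcoef Y r r' i = br (Y r' m) (Y r i) * gnum Y r' (Y r i) m / gden Y r i.
Proof.
by move=> mr'; rewrite /gcoef (prod_split _ mr') // /gnum.
Qed.

Lemma gdenE Y r i j : (0 < j < r.+1)%N -> j != i ->
  gden Y r i = br (Y r j) (Y r i) * gden2 Y r i j.
Proof. by move=> jr ji; rewrite /gden (prod_split _ jr). Qed.

Lemma gnum_mv s Y r' x m : gnum (mv s r' m Y) r' x m = gnum Y r' x m.
Proof. by apply: eq_bigr => l lm; rewrite mv_col. Qed.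

Lemma gnum_far s r1 i1 Y r' x m : r' != r1 ->
  gnum (mv s r1 i1 Y) r' x m = gnum Y r' x m.
Proof. by move=> r'r1; apply: eq_bigr => l _; rewrite mv_row. Qed.

Lemma gden_far s r1 i1 Y r i : r != r1 ->
  gden (mv s r1 i1 Y) r i = gden Y r i.
Proof. by move=> r'r1; apply: eq_bigr => l _; rewrite !mv_row. Qed.

Lemma gden2_mv s Y r i j : i != j -> gden2 (mv s r j Y) r i j = gden2 Y r i j.
Proof. by move=> ij; apply: eq_bigr => l /andP[_ lj]; rewrite !mv_col. Qed.

(* Moving the entries i and j of row r commutes, so in a Serre relation only the sum of
   the coefficients for (i,j) and (j,i) has to vanish. *)
Definition serre_coef s Y r r' t t' i j m :=
  gcoef Y t t' m * gcoef (mv s t m Y) r r' i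
    * gcoef (mv s r i (mv s t m Y)) r r' j
  - (s + s^-1) * (gcoef Y r r' i * gcoef (mv s r i Y) t t' m
    * gcoef (mv s t m (mv s r i Y)) r r' j)
  + gcoef Y r r' i * gcoef (mv s r i Y) r r' j
    * gcoef (mv s r j (mv s r i Y)) t t' m.

(** By [br_neq0], this keeps the denominators of row [r] nonzero both before and after one move by
    [s]. *)
Definition row_generic s Y r := forall i j, (0 < i < r.+1)%N -> (0 < j < r.+1)%N ->
  i != j -> (Y r i) ^+ 2 != (Y r j) ^+ 2 /\ (s * Y r i) ^+ 2 != (Y r j) ^+ 2.

(** The coefficients of row [r] see the move in row [r'], whose own coefficient looks at [r2] and
    does not see row [r]. All factors but those of [serre_upper_id] are common and pull out. *)
Lemma serre_upper s Y r r' r2 i j m : c != 0 -> s != 0 ->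
  (forall a b, Y a b != 0) -> row_generic s Y r ->
  (0 < i < r.+1)%N -> (0 < j < r.+1)%N -> (0 < m < r'.+1)%N ->
  r != r' -> r2 != r ->
  serre_coef s Y r r' r' r2 i j m + serre_coef s Y r r' r' r2 j i m = 0.
Proof.
move=> c0 s0 Y0 gen ir jr mr' rr' r2r; rewrite /serre_coef.
have r'r : r' != r by rewrite eq_sym.
rewrite !(mvC _ _ _ _ _ r'r) !(gcoef_far _ _ _ _ r'r r2r).
rewrite !(gcoefE _ _ _ mr') !mv_same !(mv_row _ _ _ _ rr') !(mv_row _ _ _ _ r'r).
rewrite !gnum_mv !(gnum_far _ _ _ _ _ r'r) !(gden_far _ _ _ _ rr').
have [<-|ij] := eqVneq i j.
  have E := serre_upper_diag_id c0 s0 (Y0 r' m) (Y0 r i).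
  rewrite !mv_same; set K := gcoef Y r' r2 m * gnum Y r' (Y r i) m / gden Y r i
    * gnum Y r' (s * Y r i) m / gden (mv s r i Y) r i.
  apply: (etrans (y := K * 0 + K * 0)); last by rewrite !mulr0 addr0.
  by rewrite -E /K; ring.
have ji : j != i by rewrite eq_sym.
have [g1 g2] := gen _ _ ir jr ij; have [_ g3] := gen _ _ jr ir ji.
have E := serre_upper_id c0 s0 (Y0 r' m) (Y0 r i) (Y0 r j) g1 g2 g3.
rewrite !(mv_col _ _ _ _ ji) !(mv_col _ _ _ _ ij) !(gdenE _ jr ji) !(gdenE _ ir ij).
rewrite !gden2_mv // !mv_same !(mv_col _ _ _ _ ji) !(mv_col _ _ _ _ ij) !invfM.
rewrite !invfM in E.
apply: (etrans (y := gcoef Y r' r2 m * gnum Y r' (Y r i) m * gnum Y r' (Y r j) m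
  / gden2 Y r i j / gden2 Y r j i * 0)); last by rewrite mulr0.
by rewrite -E; ring.
Qed.

Definition gtop Y r' x := \prod_(1 <= l < r'.+1) br (Y r' l) x.

Lemma gtop_far s r1 i1 Y r' x : r' != r1 -> gtop (mv s r1 i1 Y) r' x = gtop Y r' x.
Proof. by move=> r'r1; apply: eq_bigr => l _; rewrite mv_row. Qed.

Definition gnum2 Y r' x i j :=
  \prod_(1 <= l < r'.+1 | (l != i) && (l != j)) br (Y r' l) x.

Lemma gcoefE2 Y r r' m i j : (0 < i < r'.+1)%N -> (0 < j < r'.+1)%N -> i != j ->
  gcoef Y r r' m = br (Y r' i) (Y r m) * br (Y r' j) (Y r m)
    * gnum2 Y r' (Y r m) i j / gden Y r m.
Proof.
move=> ir jr ij; rewrite (gcoefE _ _ _ ir) /gnum (prod_split _ jr) 1?eq_sym //.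
by rewrite !mulrA.
Qed.

Lemma gnum2_mv s Y r' x i j k : (k == i) || (k == j) ->
  gnum2 (mv s r' k Y) r' x i j = gnum2 Y r' x i j.
Proof.
move=> kij; apply: eq_bigr => l /andP[li lj]; rewrite mv_col //.
by case/orP: kij => /eqP->.
Qed.

(** Everything but the last divisor is symmetric in [i] and [j], so only that divisor has to be
    followed in the symmetrized sum. *)
Lemma gcoef_pair s Y r r' i j : (0 < i < r.+1)%N -> (0 < j < r.+1)%N -> i != j ->
    r' != r ->
  gcoef Y r r' i * gcoef (mv s r i Y) r r' j =
  gtop Y r' (Y r i) * gtop Y r' (Y r j) / gden2 Y r i j / gden2 Y r j i
    / (br (Y r j) (Y r i) * br (s * Y r i) (Y r j)).
Proof.
move=> ir jr ij r'r; have ji : j != i by rewrite eq_sym.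
rewrite /gcoef -!/(gtop _ _ _) -!/(gden _ _ _) !(gdenE _ jr ji) !(gdenE _ ir ij).
by rewrite !mv_same !(mv_col _ _ _ _ ji) gden2_mv // gtop_far // !invfM; ring.
Qed.

(** Here the coefficient of the third move, in row [r1], sees the two moves of row [r], while these
    do not see row [r1]; what remains is [serre_lower_id]. *)
Lemma serre_lower s Y r r' r1 i j m : c != 0 -> s != 0 ->
  (forall a b, Y a b != 0) -> row_generic s Y r ->
  (0 < i < r.+1)%N -> (0 < j < r.+1)%N ->
  r != r1 -> r' != r1 -> r' != r ->
  serre_coef s Y r r' r1 r i j m + serre_coef s Y r r' r1 r j i m = 0.
Proof.
move=> c0 s0 Y0 gen ir jr rr1 r'r1 r'r; rewrite /serre_coef.
have r1r : r1 != r by rewrite eq_sym.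
rewrite !(mvC _ _ _ _ _ r1r) !(gcoef_far _ _ _ _ rr1 r'r1).
have [<-|ij] := eqVneq i j.
  have E := serre_lower_diag_id c0 s0 (Y0 r1 m) (Y0 r i).
  rewrite !(gcoefE _ _ _ ir) !mv_same !(mv_row _ _ _ _ r1r) !gnum_mv.
  rewrite !(gden_far _ _ _ _ r1r).
  set K := gnum Y r (Y r1 m) i / gden Y r1 m * gcoef Y r r' i
    * gcoef (mv s r i Y) r r' i.
  apply: (etrans (y := K * 0 + K * 0)); last by rewrite !mulr0 addr0.
  by rewrite -E /K; ring.
have ji : j != i by rewrite eq_sym.
have [g1 g2] := gen _ _ ir jr ij; have [_ g3] := gen _ _ jr ir ji.
have E := serre_lower_id c0 s0 (Y0 r1 m) (Y0 r i) (Y0 r j) g1 g2 g3.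
have P := gcoef_pair s Y ir jr ij r'r; have Q := gcoef_pair s Y jr ir ji r'r.
rewrite !(gcoefE2 _ r1 m ir jr ij) !(mv_row _ _ _ _ r1r).
rewrite !gnum2_mv ?eqxx ?orbT // !(gden_far _ _ _ _ r1r) !mv_same.
rewrite !(mv_col _ _ _ _ ji) !(mv_col _ _ _ _ ij) !mv_same.
set N := gnum2 _ _ _ _ _; set D := gden _ _ _.
set u := gcoef _ _ _ _ in P *; set u' := gcoef _ _ _ _ in P *.
set v := gcoef _ _ _ _ in Q *; set v' := gcoef _ _ _ _ in Q *.
apply: (etrans (y := N / D * ((br (Y r i) (Y r1 m) * br (Y r j) (Y r1 m) -
  (s + s^-1) * (br (s * Y r i) (Y r1 m) * br (Y r j) (Y r1 m)) +
  br (s * Y r i) (Y r1 m) * br (s * Y r j) (Y r1 m)) * (u * u') +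
  (br (Y r j) (Y r1 m) * br (Y r i) (Y r1 m) -
  (s + s^-1) * (br (s * Y r j) (Y r1 m) * br (Y r i) (Y r1 m)) +
  br (s * Y r j) (Y r1 m) * br (s * Y r i) (Y r1 m)) * (v * v')))); first by ring.
apply: (etrans (y := N / D * (gtop Y r' (Y r i) * gtop Y r' (Y r j) / gden2 Y r i j
   / gden2 Y r j i * 0))); last by rewrite !mulr0.
by rewrite P Q -E; ring.
Qed.

(* [gcoef] for [e_k] (row [r1], looking at row [r]) against [f_(k+1)] (row [r],
   looking at row [r1]): each coefficient sees the move of the other. *)
Lemma ef_mutual s Y r r1 i m : s != 0 -> (forall a b, Y a b != 0) ->
  (0 < i < r.+1)%N -> (0 < m < r1.+1)%N -> r != r1 ->
  gcoef Y r r1 i * gcoef (mv s r i Y) r1 r m =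
  gcoef Y r1 r m * gcoef (mv s^-1 r1 m Y) r r1 i.
Proof.
move=> s0 Y0 ir mr1 rr1; have r1r : r1 != r by rewrite eq_sym.
rewrite !(gcoefE _ _ _ ir) !(gcoefE _ _ _ mr1) !mv_same !(mv_row _ _ _ _ rr1).
rewrite !(mv_row _ _ _ _ r1r) !gnum_mv !(gden_far _ _ _ _ rr1) !(gden_far _ _ _ _ r1r).
have E : br (s * Y r i) (Y r1 m) = br (Y r i) (s^-1 * Y r1 m).
  by rewrite -[RHS](br_scale _ _ _ s0) mulVKf.
have E' : br (s^-1 * Y r1 m) (Y r i) = - br (Y r i) (s^-1 * Y r1 m) by rewrite br_opp.
by rewrite E E' (br_opp _ (Y r i) (Y r1 m)); ring.
Qed.

(** Opposite moves in one row meet only in the denominator factors between the entries [i] and [j].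
    These match because [br] is antisymmetric and invariant under a common scaling. *)
Lemma ef_offdiag s Y r r1 r2 i j : s != 0 -> (forall a b, Y a b != 0) ->
  (0 < i < r.+1)%N -> (0 < j < r.+1)%N -> i != j -> r1 != r -> r2 != r ->
  gcoef Y r r1 i * gcoef (mv s r i Y) r r2 j =
  gcoef Y r r2 j * gcoef (mv s^-1 r j Y) r r1 i.
Proof.
move=> s0 Y0 ir jr ij r1r r2r; have ji : j != i by rewrite eq_sym.
rewrite /gcoef -!/(gtop _ _ _) -!/(gden _ _ _) !(gdenE _ jr ji) !(gdenE _ ir ij).
rewrite !mv_same !(mv_col _ _ _ _ ji) !(mv_col _ _ _ _ ij) !gden2_mv //.
rewrite !gtop_far //.
have E : br (s * Y r i) (Y r j) = br (Y r i) (s^-1 * Y r j).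
  by rewrite -[RHS](br_scale _ _ _ s0) mulVKf.
have E' : br (s^-1 * Y r j) (Y r i) = - br (Y r i) (s^-1 * Y r j) by rewrite br_opp.
by rewrite E E' (br_opp _ (Y r i) (Y r j)) !mulNr !invrN !(invfM (br _ _)); ring.
Qed.
End Coefficients.

(** * Lagrange interpolation *)

Section Lagrange.
Variable F : fieldType.

(* Compare the leading coefficients of [P] and of its Lagrange interpolant. *)
Lemma lagrange_lead (s : seq F) (P : {poly F}) : uniq s -> (size P <= size s)%N ->
  \sum_(t <- s) P.[t] / (\prod_(u <- s | u != t) (t - u)) = P`_(size s).-1.
Proof.
move=> us sP; pose B t : {poly F} := \prod_(u <- s | u != t) ('X - u%:P).
pose den t := \prod_(u <- s | u != t) (t - u).
pose Q := \sum_(t <- s) (P.[t] / den t) *: B t.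
have Bt t v : (B t).[v] = \prod_(u <- s | u != t) (v - u).
  by rewrite horner_prod; apply: eq_bigr => u _; rewrite hornerXsubC.
have cnt t : t \in s -> size [seq u <- s | u != t] = (size s).-1.
  move=> ts; rewrite size_filter -[size s](count_predC (pred1 t)) /=.
  by rewrite count_uniq_mem // ts.
have sB t : t \in s -> size (B t) = size s.
  move=> ts; rewrite /B -big_filter size_prod_XsubC cnt // prednK //.
  by case: (s) ts.
have den0 t : den t != 0.
  rewrite /den prodf_seq_neq0; apply/allP => u _; apply/implyP => ut.
  by rewrite subr_eq0 eq_sym.
have PQ : P = Q.
  apply/eqP; rewrite -subr_eq0; apply/eqP.
  apply: (@roots_geq_poly_eq0 _ _ s) => //.
    apply/allP => v vs; rewrite /root !hornerE horner_sum (bigD1_seq v) //=.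
    rewrite big1_seq ?addr0 => [|t /andP[tv ts]].
      by rewrite hornerZ Bt divfK ?subrr.
    rewrite hornerZ Bt; apply/eqP; rewrite mulf_eq0 prodf_seq_eq0; apply/orP; right.
    by apply/hasP; exists v => //=; rewrite subrr eqxx eq_sym tv.
  rewrite (leq_trans (size_polyD _ _)) // geq_max sP size_polyN /Q.
  apply: (leq_trans (size_sum _ _ _)); apply/bigmax_leqP_seq => t ts _.
  by rewrite (leq_trans (size_scale_leq _ _)) // sB.
rewrite [in RHS]PQ /Q coef_sum big_seq [RHS]big_seq.
apply: eq_bigr => t ts; rewrite coefZ -[(size s).-1](congr1 predn (sB t ts)).
have /monicP : B t \is monic by rewrite /B -big_filter monic_prod_XsubC.
by rewrite lead_coefE => ->; rewrite mulr1.
Qed.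
End Lagrange.

(** * The diagonal part of the commutator of [e_k] and [f_k] *)

Section Diagonal.
Variables (F : fieldType) (q : F).
Let c := q - q^-1.
Implicit Types (Y : nat -> nat -> F).
Local Notation br := (br c).

Lemma prod_const_neq (a : F) k j : (0 < j < k.+1)%N ->
  \prod_(1 <= l < k.+1 | l != j) a = a ^+ k.-1.
Proof.
move=> jk; rewrite -big_filter big_const_seq count_predT size_filter iter_mulr_1.
congr (_ ^+ _); have := count_predC (pred1 j) (index_iota 1 k.+1).
rewrite count_uniq_mem ?iota_uniq // mem_index_iota jk size_iota subn1 add1n /= => E.
by rewrite -[k in RHS]E.
Qed.

(** One rational function for both orders of [e_k] and [f_k]: the two diagonal coefficients are its
    values at [Y k j] and at [q^-1 * Y k j]. *)
Definition theta Y k j x :=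
  ((\prod_(1 <= l < k.+2) br (Y k.+1 l) x) * \prod_(1 <= l < k) br (Y k.-1 l) (q * x))
  / \prod_(1 <= l < k.+1 | l != j) (br (Y k l) x * br (Y k l) (q * x)).

Lemma gcoef_ef Y k j : (0 < j < k.+1)%N ->
  gcoef c Y k k.+1 j * gcoef c (mv q k j Y) k k.-1 j = theta Y k j (Y k j).
Proof.
case: k => [|k] jk; first by case/andP: jk; case: j.
rewrite /gcoef /theta mv_same [X in _ = _ / X]big_split /= (invfM (bigop _ _ _)).
have -> : \prod_(1 <= l < k.+1) br (mv q k.+1 j Y k l) (q * Y k.+1 j) =
    \prod_(1 <= l < k.+1) br (Y k l) (q * Y k.+1 j).
  by apply: eq_bigr => l _; rewrite mv_row // neq_ltn ltnSn.
have -> : \prod_(1 <= l < k.+2 | l != j) br (mv q k.+1 j Y k.+1 l) (q * Y k.+1 j) =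
    \prod_(1 <= l < k.+2 | l != j) br (Y k.+1 l) (q * Y k.+1 j).
  by apply: eq_bigr => l lj; rewrite mv_col.
by rewrite /=; ring.
Qed.

Lemma gcoef_fe Y k j : q != 0 -> (0 < j < k.+1)%N ->
  gcoef c Y k k.-1 j * gcoef c (mv q^-1 k j Y) k k.+1 j = theta Y k j (q^-1 * Y k j).
Proof.
case: k => [|k] q0 jk; first by case/andP: jk; case: j.
rewrite /gcoef /theta mv_same [X in _ = _ / X]big_split /= (invfM (bigop _ _ _)) mulVKf //.
have -> : \prod_(1 <= l < k.+3) br (mv q^-1 k.+1 j Y k.+2 l) (q^-1 * Y k.+1 j) =
    \prod_(1 <= l < k.+3) br (Y k.+2 l) (q^-1 * Y k.+1 j).
  by apply: eq_bigr => l _; rewrite mv_row // neq_ltn ltnSn orbT.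
have -> : \prod_(1 <= l < k.+2 | l != j) br (mv q^-1 k.+1 j Y k.+1 l) (q^-1 * Y k.+1 j) =
    \prod_(1 <= l < k.+2 | l != j) br (Y k.+1 l) (q^-1 * Y k.+1 j).
  by apply: eq_bigr => l lj; rewrite mv_col.
by rewrite /=; ring.
Qed.

Definition row_prod Y r := \prod_(1 <= l < r.+1) Y r l.

(** The numerator of [theta] as a polynomial in [x ^+ 2], made monic. The factor [q ^- 2] appears
    because row [k.-1] is evaluated at [q * x]. *)
Definition ef_poly Y k : {poly F} :=
  (\prod_(1 <= l < k.+2) ('X - (Y k.+1 l ^+ 2)%:P)) *
  (\prod_(1 <= l < k) ('X - (q ^- 2 * Y k.-1 l ^+ 2)%:P)).

Lemma thetaE Y k j x : q != 0 -> c != 0 -> x != 0 -> (forall a b, Y a b != 0) ->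
  (0 < j < k.+1)%N ->
  theta Y k j x = (row_prod Y k) ^+ 2 / (row_prod Y k.+1 * row_prod Y k.-1) / c ^+ 2 *
    ((ef_poly Y k).[x ^+ 2] / (x ^+ 2 * Y k j ^+ 2 *
     \prod_(1 <= l < k.+1 | l != j)
       ((x ^+ 2 - Y k l ^+ 2) * (x ^+ 2 - q ^- 2 * Y k l ^+ 2)))).
Proof.
move=> q0 c0 x0 Y0 jk.
have k0 : (0 < k)%N by case/andP: jk; case: (k) => // ; case: (j).
rewrite /theta /row_prod (prednK k0).
have num1 l : br (Y k.+1 l) x =
    (- (c * x)^-1 / Y k.+1 l) * (x ^+ 2 - Y k.+1 l ^+ 2).
  by rewrite /br; field; rewrite c0 x0 Y0.
have num2 l : br (Y k.-1 l) (q * x) =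
    (- (q / (c * x)) / Y k.-1 l) * (x ^+ 2 - q ^- 2 * Y k.-1 l ^+ 2).
  by rewrite /br; field; rewrite c0 x0 q0 Y0.
have den l : br (Y k l) x * br (Y k l) (q * x) =
    (q / (c * x) ^+ 2 / Y k l ^+ 2) *
    ((x ^+ 2 - Y k l ^+ 2) * (x ^+ 2 - q ^- 2 * Y k l ^+ 2)).
  by rewrite /br; field; rewrite c0 x0 q0 Y0.
rewrite (eq_bigr _ (fun l _ => num1 l)) (eq_bigr _ (fun l _ => num2 l)).
rewrite (eq_bigr _ (fun l _ => den l)) !big_split /= !prodfV.
rewrite !prod_const_neq // !prodr_const_nat !subn1 /=.
rewrite /ef_poly hornerM !horner_prod.
under [X in _ = _ * (X * _ / _)]eq_bigr do rewrite hornerXsubC.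
under [X in _ = _ * (_ * X / _)]eq_bigr do rewrite hornerXsubC.
have -> : (\prod_(1 <= l < k.+1) Y k l) ^+ 2 =
    Y k j ^+ 2 * \prod_(1 <= i < k.+1 | i != j) Y k i ^+ 2.
  by rewrite -prodrXl [LHS](prod_split _ jk).
have A0 : \prod_(1 <= i < k.+1 | i != j) Y k i ^+ 2 != 0.
  by rewrite prodf_seq_neq0; apply/allP => l _; rewrite expf_neq0 ?implybT.
have B0 : \prod_(1 <= i < k.+2) Y k.+1 i != 0.
  by rewrite prodf_seq_neq0; apply/allP => l _; rewrite Y0.
have C0 : \prod_(1 <= i < k) Y k.-1 i != 0.
  by rewrite prodf_seq_neq0; apply/allP => l _; rewrite Y0.
move: A0 B0 C0; set A := (\prod_(1 <= i < k.+1 | i != j) Y k i ^+ 2).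
set B := \prod_(1 <= i < k.+2) Y k.+1 i; set C := \prod_(1 <= i < k) Y k.-1 i.
set D := (X in _ / (_ / A * X)); move=> A0 B0 C0.
rewrite (invfM (_ / A) D) (invfM (x ^+ 2 * _) D).
set N1 := \prod_(1 <= i < k.+2) _; set N2 := \prod_(1 <= i < k) _.
set D' := D^-1; have Yj := Y0 k j.
(* Row [k.+1] has two factors more than row [k.-1]; the excess is the [c ^+ 2] and the [x ^+ 2] in
   the statement, and the other powers cancel against the [k.-1] pairs in the denominator. *)
have -> : (- (c * x)^-1) ^+ k.+1 = (- (c * x)^-1) ^+ k.-1 * (c * x) ^- 2.
  by rewrite -[in LHS](prednK k0) 2!exprSr -mulrA mulrNN -invfM -expr2.
have E : (- (c * x)^-1) ^+ k.-1 * (- (q / (c * x))) ^+ k.-1 =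
    q ^+ k.-1 / (c * x) ^+ 2 ^+ k.-1.
  by rewrite -!exprVn -!exprMn mulrNN; congr (_ ^+ _); field; rewrite c0 x0.
apply: (etrans (y := (- (c * x)^-1) ^+ k.-1 * (- (q / (c * x))) ^+ k.-1 * (c * x) ^- 2
   * N1 * N2 * D' / B / C / (q ^+ k.-1 / (c * x) ^+ 2 ^+ k.-1 / A))).
  by ring.
rewrite E; field.
by rewrite Yj x0 c0 C0 B0 A0 !expf_neq0 // mulf_neq0.
Qed.

Lemma ef_poly_monic Y k : ef_poly Y k \is monic.
Proof.
rewrite /ef_poly rpredM // big_seq monic_prod // => l _; exact: monicXsubC.
Qed.

Lemma size_ef_poly Y k : (0 < k)%N -> size (ef_poly Y k) = (k + k).+1.
Proof.
move=> k0; rewrite /ef_poly size_monicM; last 2 first.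
- by rewrite big_seq monic_prod // => l _; exact: monicXsubC.
- by rewrite monic_neq0 // big_seq monic_prod // => l _; exact: monicXsubC.
by rewrite !size_prod_XsubC !size_iota; lia.
Qed.

(* Interpolate [ef_poly] at the nodes 0, [Y k j ^+ 2] and [(q^-1 * Y k j) ^+ 2]. *)
Lemma ef_diag Y k : q != 0 -> c != 0 -> (forall a b, Y a b != 0) -> (0 < k)%N ->
  row_generic q Y k ->
  let A := row_prod Y k ^+ 2 / (row_prod Y k.+1 * row_prod Y k.-1) in
  \sum_(1 <= j < k.+1) (gcoef c Y k k.+1 j * gcoef c (mv q k j Y) k k.-1 j -
     gcoef c Y k k.-1 j * gcoef c (mv q^-1 k j Y) k k.+1 j) = (q^-1 * A - q / A) / c.
Proof.
move=> q0 c0 Y0 k0 gen A.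
have q21 : q ^+ 2 != 1.
  by apply: contraNneq c0; rewrite /c expr2 => /mulr1_eq ->; rewrite subrr.
pose X j := Y k j ^+ 2; pose X' j := q ^- 2 * X j; pose r := index_iota 1 k.+1.
pose s := 0 :: [seq X j | j <- r] ++ [seq X' j | j <- r].
have X0 j : X j != 0 by rewrite expf_neq0.
have X'0 j : X' j != 0 by rewrite mulf_neq0 // invr_eq0 expf_neq0.
have rP j : (j \in r) = (0 < j < k.+1)%N by rewrite mem_index_iota.
have Xinj : {in r &, injective X}.
  move=> i j; rewrite !rP => ir jr Xij; apply/eqP; apply: contraT => ij.
  by have [+ _] := gen _ _ ir jr ij; rewrite -/(X i) Xij eqxx.
have X'inj : {in r &, injective X'}.
  by move=> i j ir jr /mulfI; rewrite invr_eq0 expf_neq0 // => /(_ isT); apply: Xinj.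
have XX' i j : i \in r -> j \in r -> X i != X' j.
  rewrite !rP => ir jr; have [->|ij] := eqVneq i j.
    rewrite /X' -[X in X != _]mul1r (inj_eq (mulIf _)) // eq_sym.
    by rewrite invr_eq1.
  have [_] := gen _ _ ir jr ij; rewrite exprMn => /eqP ne; apply/eqP => e.
  by apply: ne; rewrite -/(X i) e /X' mulVKf // expf_neq0.
have us : uniq s.
  rewrite /= mem_cat negb_or cat_uniq !map_inj_in_uniq ?iota_uniq //= andbT.
  apply/andP; split.
  - by apply/andP; split; apply/mapP => -[j _ /esym/eqP]; rewrite ?(negPf (X0 j)) ?(negPf (X'0 j)).
  - apply/hasPn => _ /mapP[j jr ->]; apply/mapP => -[i ir /esym/eqP].
    by rewrite (negPf (XX' _ _ ir jr)).
have sz : size s = (k + k).+1 by rewrite /= size_cat !size_map size_iota subn1.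
(* There are [2 k + 1] nodes and the monic polynomial has degree [2 k], so the Lagrange sum is 1. *)
have /(_ _) := @lagrange_lead _ s (ef_poly Y k) us.
rewrite size_ef_poly // sz => /(_ (leqnn _)) /=.
have /monicP := ef_poly_monic Y k; rewrite lead_coefE size_ef_poly // => /= ->.
rewrite big_cons big_cat !big_map /=.
have prodE t : \prod_(u <- s | u != t) (t - u) = (if 0 != t then t else 1) *
    (\prod_(l <- r | X l != t) (t - X l) * \prod_(l <- r | X' l != t) (t - X' l)).
  rewrite big_cons big_cat !big_map /= subr0.
  by case: ifP => // _; rewrite mul1r.
have rp0 m : row_prod Y m != 0.
  by rewrite prodf_seq_neq0; apply/allP => l _; rewrite Y0.
(* The node 0 contributes the term in [q / A] of the result; the leading coefficient 1 contributes
   the term in [A]. *)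
have L0 : (ef_poly Y k).[0] / \prod_(u <- s | u != 0) (0 - u) = q ^+ 2 / A ^+ 2.
  rewrite prodE eqxx mul1r (eq_bigl xpredT) => [|l]; last by rewrite X0.
  rewrite [X in _ / (_ * X)](eq_bigl xpredT) => [|l]; last by rewrite X'0.
  rewrite /ef_poly hornerM !horner_prod.
  rewrite [X in X * _ / _](eq_bigr (fun l => (-1) * Y k.+1 l ^+ 2)) => [|l _]; last first.
    by rewrite hornerXsubC sub0r mulN1r.
  rewrite [X in _ * X / _](eq_bigr (fun l => (- (q ^- 2)) * Y k.-1 l ^+ 2)) => [|l _]; last first.
    by rewrite hornerXsubC sub0r mulNr.
  rewrite [X in _ / (X * _)](eq_bigr (fun l => (-1) * Y k l ^+ 2)) => [|l _]; last first.
    by rewrite sub0r mulN1r.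
  rewrite [X in _ / (_ * X)](eq_bigr (fun l => (- (q ^- 2)) * Y k l ^+ 2)) => [|l _]; last first.
    by rewrite sub0r mulNr.
  rewrite !big_split /r /= !prodr_const_nat !subn1 /=.
  have -> : \prod_(1 <= i < k.+2) Y k.+1 i = row_prod Y k.+1 by [].
  have -> : \prod_(1 <= i < k) Y k.-1 i = row_prod Y k.-1.
    by rewrite /row_prod prednK.
  have -> : \prod_(1 <= i < k.+1) Y k i = row_prod Y k by [].
  rewrite /A; move: (rp0 k) (rp0 k.+1) (rp0 k.-1).
  set a := row_prod Y k; set b := row_prod Y k.+1; set e := row_prod Y k.-1.
  move=> a0 b0 e0.
  have k11 : (- 1) ^+ k.+1 = (- 1) ^+ k.-1 :> F.
    by rewrite -[in LHS](prednK k0) 2!exprS mulrA mulrNN !mul1r.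
  have kq : (- q ^- 2) ^+ k = - q ^- 2 * (- q ^- 2) ^+ k.-1.
    by rewrite -[in LHS](prednK k0) exprS.
  have kq1 : (- 1) ^+ k = - (- 1) ^+ k.-1 :> F.
    by rewrite -[in LHS](prednK k0) exprS mulN1r.
  have kz : (- q ^- 2) ^+ k.-1 != 0 by rewrite expf_neq0 // oppr_eq0 invr_eq0 expf_neq0.
  rewrite k11 kq kq1; field.
  by rewrite kz e0 b0 a0 q0 /= oppr_eq0 oner_eq0 /= oppr_eq0 expf_neq0 // oppr_eq0 oner_eq0.
have injE (f : nat -> F) (g : nat -> F) j : {in r &, injective f} -> j \in r ->
    \prod_(l <- r | f l != f j) g l = \prod_(l <- r | l != j) g l.
  move=> finj jr; rewrite big_seq_cond [RHS]big_seq_cond; apply: eq_bigl => l.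
  by case lr : (l \in r) => //=; rewrite (inj_in_eq finj).
have allE (f : nat -> F) (g : nat -> F) t : (forall l, l \in r -> f l != t) ->
    \prod_(l <- r | f l != t) g l = \prod_(l <- r) g l.
  move=> ft; rewrite big_seq_cond [RHS]big_seq_cond; apply: eq_bigl => l.
  by case lr : (l \in r) => //=; rewrite ft.
rewrite {}L0 => E.
have {}E : \sum_(j <- r) ((ef_poly Y k).[X j] / \prod_(u <- s | u != X j) (X j - u) +
    (ef_poly Y k).[X' j] / \prod_(u <- s | u != X' j) (X' j - u)) = 1 - q ^+ 2 / A ^+ 2.
  by rewrite big_split /= -[X in X - _]E addrAC subrr add0r.
have A0 : A != 0 by rewrite /A mulf_neq0 ?expf_neq0 // invr_eq0 mulf_neq0.
transitivity (A / c ^+ 2 * (c / q) * (1 - q ^+ 2 / A ^+ 2)); last first.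
  by field; rewrite c0 q0 A0.
rewrite -E mulr_sumr [LHS]big_seq [RHS]big_seq; apply: eq_bigr => j jr.
have jk := jr; rewrite rP in jk.
have x'0 : q^-1 * Y k j != 0 by rewrite mulf_neq0 ?invr_eq0.
have x'2 : (q^-1 * Y k j) ^+ 2 = X' j by rewrite exprMn exprVn.
rewrite (gcoef_ef _ jk) (gcoef_fe _ q0 jk) (thetaE q0 c0 (Y0 k j) Y0 jk).
rewrite (thetaE q0 c0 x'0 Y0 jk) x'2 -/A -/(X j).
rewrite !prodE (eq_sym 0) X0 (eq_sym 0) X'0.
rewrite (injE X _ _ Xinj jr) (injE X' _ _ X'inj jr).
rewrite (allE X') => [|l lr]; last by rewrite eq_sym XX'.
rewrite (allE X) => [|l lr]; last by rewrite XX'.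
rewrite [\prod_(l <- r) (X j - _)](prod_split _ jk) //=.
rewrite [\prod_(l <- r) (X' j - _)](prod_split _ jk) //=.
rewrite -/r !big_split /=.
(* [thetaE] has [x ^+ 2 * Y k j ^+ 2] where the Lagrange denominator has a node times its difference
   from its partner. That difference is, up to sign, [X j * (c / q)], which explains the constant
   and the minus sign between the two orders. *)
have key a a' x D1 D2 D3 D4 : x != 0 ->
    A / c ^+ 2 * (a / (x * x * (D1 * D2)))
      - A / c ^+ 2 * (a' / (q ^- 2 * x * x * (D3 * D4))) =
    A / c ^+ 2 * (c / q) * (a / (x * (D1 * ((x - q ^- 2 * x) * D2)))
      + a' / (q ^- 2 * x * ((q ^- 2 * x - x) * D3 * D4))).
  move=> x0; have -> : q ^- 2 * x - x = - (x * (c / q)) by rewrite /c; field.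
  have -> : x - q ^- 2 * x = x * (c / q) by rewrite /c; field.
  rewrite !invfM; move: D1^-1 D2^-1 D3^-1 D4^-1 => i1 i2 i3 i4.
  by field; rewrite q0 x0 c0 oppr_eq0 mulf_neq0 ?oner_eq0.
exact: key.
Qed.
End Diagonal.

(** * The module of tableaux *)

Section QuantumPower.
Variables (R : realType) (q h : R[i]).
Hypothesis hh : cexp h = q.
Local Notation qp := (qpow h).

Lemma cexpD (x y : R[i]) : cexp (x + y) = cexp x * cexp y.
Proof.
case: x y => [a b] [a' b']; apply/eqP; rewrite eq_complex /= expRD cosD sinD.
by apply/andP; split; apply/eqP; ring.
Qed.

Lemma cexp0 : cexp (0 : R[i]) = 1.
Proof. by apply/eqP; rewrite eq_complex /= expR0 cos0 sin0 mulr1 mulr0 !eqxx. Qed.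

Lemma qpowD x y : qp (x + y) = qp x * qp y.
Proof. by rewrite /qpow mulrDr cexpD. Qed.

Lemma qpow0 : qp 0 = 1.
Proof. by rewrite /qpow mulr0 cexp0. Qed.

Lemma qpow_neq0 x : qp x != 0.
Proof.
apply/eqP => q0; have /eqP := qpow0; rewrite -(subrr x) qpowD q0 mul0r.
by rewrite eq_sym oner_eq0.
Qed.

Lemma qpowN x : qp (- x) = (qp x)^-1.
Proof.
by apply: (mulfI (qpow_neq0 x)); rewrite -qpowD subrr qpow0 divff // qpow_neq0.
Qed.

Lemma qpowB x y : qp (x - y) = qp x / qp y.
Proof. by rewrite qpowD qpowN. Qed.

Lemma qpow1 : qp 1 = q.
Proof. by rewrite /qpow mulr1. Qed.

Lemma q_neq0 : q != 0.
Proof. by rewrite -qpow1 qpow_neq0. Qed.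

Lemma qpowMn x m : qp (x *+ m) = qp x ^+ m.
Proof. by elim: m => [|m IH]; rewrite ?mulr0n ?qpow0 ?expr0 // mulrS qpowD IH exprS. Qed.

Lemma qpow_int (m : int) : qp m%:~R = q ^ m.
Proof.
by case: m => m; rewrite ?NegzE -?pmulrn ?mulrNz ?qpowN qpowMn qpow1 // exprnN.
Qed.

Lemma qpow_sum (I : Type) (r : seq I) (P : pred I) (E : I -> R[i]) :
  qp (\sum_(i <- r | P i) E i) = \prod_(i <- r | P i) qp (E i).
Proof. by apply: (big_morph qp) => [x y|]; rewrite ?qpowD ?qpow0. Qed.

Lemma qnumB x y : qnum q h (x - y) = br (q - q^-1) (qp x) (qp y).
Proof. by rewrite /qnum opprB /br !qpowD !qpowN. Qed.

End QuantumPower.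

(** * Entries of tableaux and the lattice of integral shifts *)

Section Entries.
Variables (F : fieldType) (n : nat).
Implicit Types T : tableau F n.

Lemma pos_of i j : (0 < j <= i)%N -> (i <= n)%N ->
  exists c : pos n, row_ c = i /\ col_ c = j.
Proof.
move=> ji iN; have jN : (j < n.+1)%N by case/andP: ji => _ /leq_trans; apply.
by exists (exist _ (Ordinal (iN : (i < n.+1)%N), Ordinal jN) ji).
Qed.

Lemma pos_eqP (c c' : pos n) : row_ c = row_ c' -> col_ c = col_ c' -> c = c'.
Proof.
by case: c c' => [[[a ?] [b ?]] ?] [[[a' ?] [b' ?]] ?] /= e e'; apply/val_inj;
  congr (_, _); apply/val_inj.
Qed.

Lemma entry_pos T (c : pos n) : entry T (row_ c) (col_ c) = T c.
Proof.
rewrite /entry; case: pickP => [c' /andP[/eqP e /eqP e']|/(_ c)].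
  by rewrite (pos_eqP e e').
by rewrite !eqxx.
Qed.

Lemma entryD T T' i j : entry (T + T') i j = entry T i j + entry T' i j.
Proof. by rewrite /entry; case: pickP => [c _|_]; rewrite ?ffunE ?addr0. Qed.

Lemma entryN T i j : entry (- T) i j = - entry T i j.
Proof. by rewrite /entry; case: pickP => [c _|_]; rewrite ?ffunE ?oppr0. Qed.

Lemma entry_delta k l i j : (0 < l <= k)%N -> (k <= n)%N ->
  entry (delta_tab n k l : tableau F n) i j = ((i == k) && (j == l))%:R.
Proof.
move=> lk kn; rewrite /entry; case: pickP => [c /andP[/eqP <- /eqP <-]|nc].
  by rewrite ffunE.
case: andP => // -[/eqP ik /eqP jl]; have [c [ck cl]] := pos_of lk kn.
by have := nc c; rewrite ck cl ik jl !eqxx.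
Qed.

Lemma tab0E c : (0 : tableau F n) c = 0.
Proof. by rewrite ffunE. Qed.

(** [tab_set 0] serves throughout as the group of admissible shifts: integral below the top row,
    zero on it. *)
Lemma tab_setD L T D : tab_set L T -> tab_set (0 : tableau F n) D -> tab_set L (T + D).
Proof.
move=> [top low] [top0 low0]; split=> c cn.
  by rewrite ffunE top // top0 // ffunE addr0.
have [m e] := low c cn; have [m0 e0] := low0 c cn; exists (m + m0).
by rewrite intrD -e -e0 !ffunE subr0 addrAC.
Qed.

Lemma lat_delta k l : (k < n)%N -> tab_set (0 : tableau F n) (delta_tab n k l : tableau F n).
Proof.
move=> kn; split=> c cn; first by rewrite tab0E ffunE cn gtn_eqF.
exists ((row_ c == k) && (col_ c == l))%:R.
by rewrite tab0E subr0 ffunE; case: (_ && _).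
Qed.

Lemma latN D : tab_set (0 : tableau F n) D -> tab_set (0 : tableau F n) (- D).
Proof.
move=> [top low]; split=> c cn; first by rewrite ffunE top // tab0E oppr0.
by have [m e] := low c cn; exists (- m); rewrite intrN -e ffunE !tab0E !subr0.
Qed.

Lemma lat0 : tab_set (0 : tableau F n) (0 : tableau F n).
Proof. by split=> // c _; exists 0; rewrite subrr. Qed.

Lemma latMn D m : tab_set (0 : tableau F n) D -> tab_set (0 : tableau F n) (D *+ m).
Proof.
by move=> D0; elim: m => [|m IH]; rewrite ?mulr0n ?mulrS; [exact: lat0|exact: tab_setD].
Qed.

Lemma lat_sum (I : Type) (r : seq I) (P : pred I) (D : I -> tableau F n) :
  (forall i, tab_set (0 : tableau F n) (D i)) -> tab_set (0 : tableau F n) (\sum_(i <- r | P i) D i).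
Proof. by move=> D0; elim/big_rec: _ => [|i x _]; [exact: lat0|exact: tab_setD]. Qed.

Lemma tab_set_refl L : tab_set (L : tableau F n) L.
Proof. by split=> // c _; exists 0; rewrite subrr. Qed.
End Entries.

(** * Linear extension from the basis of tableaux *)

Section Lift.
Variables (F : fieldType) (n : nat) (L : tableau F n) (W : lmodType F).
Local Notation V := (tab_space L).

Lemma tab_vecE (b : set_type (tab_set L)) : tab_vec L (val b) = << b >>.
Proof. by rewrite /tab_vec valK. Qed.

Lemma tab_spanE (v : V) :
  v = \sum_(b <- dom v) coeff b v *: tab_vec L (val b).
Proof.
rewrite -[LHS]freeg_sumE; apply: eq_bigr => b _; rewrite tab_vecE.
apply/eqP/freeg_eqP => b'; rewrite coeffU coeffZ coeffU mul1r //.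
Qed.

Definition tab_lift (f : tableau F n -> W) (v : V) : W :=
  fglift (fun b : set_type (tab_set L) => f (val b)) v.

Lemma tab_lift_vec f T : tab_set L T -> tab_lift f (tab_vec L T) = f T.
Proof.
move=> LT; have LT' : T \in tab_set L by rewrite inE.
by rewrite -[T]/(val (exist _ T LT' : set_type _)) tab_vecE /tab_lift liftU scale1r.
Qed.

Lemma tab_liftD f v w : tab_lift f (v + w) = tab_lift f v + tab_lift f w.
Proof.
set g := fun b : set_type (tab_set L) => f (val b).
have g0 : fglift g 0 = 0 by rewrite -[X in fglift _ X](subrr 0) lift_is_additive subrr.
have -> : v + w = v - (0 - w) by rewrite sub0r opprK.
by rewrite /tab_lift !lift_is_additive g0 sub0r opprK.
Qed.

Lemma tab_liftZ f a v : tab_lift f (a *: v) = a *: tab_lift f v.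
Proof.
have lift_sum c : tab_lift f (\sum_(b <- dom v) << c b *g b >>) =
    \sum_(b <- dom v) c b *: f (val b).
  elim/big_rec2: _ => [|b x y _ IH].
    by apply: (addrI (tab_lift f 0)); rewrite -tab_liftD !addr0.
  by rewrite tab_liftD IH /tab_lift liftU.
have E := lift_sum (fun b => coeff b v); rewrite freeg_sumE in E.
rewrite E scaler_sumr; apply: etrans (lift_sum (fun b => a * coeff b v)) _.
by apply: eq_bigr => b _; rewrite scalerA.
Qed.

End Lift.

(** * Operators for the generators, and the defining relations *)

Section GelfandTsetlin.
Variables (R : realType) (n : nat) (q h : R[i]) (L : tableau R[i] n).
Hypotheses (hh : cexp h = q) (q2 : q - q^-1 != 0) (hL : q_generic h L).
Local Notation C := R[i].
Local Notation c := (q - q^-1).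
Local Notation qp := (qpow h).
Implicit Types (T : tableau C n) (b : bool).

(* [V], [vec] and [lift] stand for [tab_space L], [tab_vec L] and [tab_lift], whose
   algebraic instances are too expensive to unfold. *)
Variables (V : lmodType C) (vec : tableau C n -> V).
Variable lift : (tableau C n -> V) -> V -> V.
Hypothesis liftD : forall f v w, lift f (v + w) = lift f v + lift f w.
Hypothesis liftZ : forall f a v, lift f (a *: v) = a *: lift f v.
Hypothesis lift_vec : forall f T, tab_set L T -> lift f (vec T) = f T.

Let q0 : q != 0 := q_neq0 hh.

(** All coefficients, and [q] to the weights, depend on a tableau only through these multiplicative
    coordinates. *)
Definition tab_point T : nat -> nat -> C := fun i j => qp (entry T i j).
Local Notation Y := tab_point.

Lemma tab_point_neq0 T i j : Y T i j != 0.
Proof. exact: qpow_neq0. Qed.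

Lemma gt_e_coefE T k j : gt_e_coef q h T k j = gcoef c (Y T) k k.+1 j.
Proof. by congr (_ / _); apply: eq_bigr => i _; rewrite qnumB. Qed.

Lemma gt_f_coefE T k j : (0 < k)%N -> gt_f_coef q h T k j = gcoef c (Y T) k k.-1 j.
Proof.
by move=> k0; rewrite /gcoef prednK //; congr (_ / _); apply: eq_bigr => i _; rewrite qnumB.
Qed.

(* [b = true] is for e_k and [b = false] for f_k. *)
Definition tab_step b k j : tableau C n := if b then delta_tab n k j else - delta_tab n k j.
#[local] Arguments tab_step : simpl never.
Definition qstep b : C := if b then q else q^-1.
Definition other_row b k := if b then k.+1 else k.-1.
Definition op_sign b : C := if b then -1 else 1.
Local Notation g b T k j := (gcoef c (Y T) k (other_row b k) j).

Lemma qstep_neq0 b : qstep b != 0.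
Proof. by case: b; rewrite /= ?invr_eq0. Qed.

Lemma tab_point_step b T k j : (0 < j <= k)%N -> (k <= n)%N ->
  Y (T + tab_step b k j) = mv (qstep b) k j (Y T).
Proof.
move=> jk kn; apply/funext=> r; apply/funext=> i; rewrite /Y /mv entryD qpowD.
have -> : entry (tab_step b k j) r i =
    (if b then 1 else -1) * ((r == k) && (i == j))%:R.
  by case: b; rewrite /= ?entryN entry_delta // ?mul1r ?mulN1r.
case E: ((r == k) && (i == j)); last by rewrite mulr0 qpow0 mulr1.
case/andP: E => /eqP -> /eqP ->; rewrite mulr1 mulrC.
by case: b; rewrite /= ?qpowN (qpow1 hh).
Qed.

Lemma lat_step b k j : (k < n)%N -> tab_set (0 : tableau C n) (tab_step b k j).
Proof. by move=> kn; case: b; [|apply: latN]; exact: lat_delta. Qed.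

Lemma tab_set_step b T k j : (k < n)%N -> tab_set L T -> tab_set L (T + tab_step b k j).
Proof. by move=> kn LT; apply: tab_setD => //; exact: lat_step. Qed.

Lemma entry_int T i j : tab_set L T ->
  exists m : int, entry T i j = entry L i j + m%:~R.
Proof.
move=> [top low]; rewrite /entry; case: pickP => [p _|_]; last first.
  by exists 0; rewrite addr0.
have [pn|np] := ltnP (row_ p) n.
  by have [m e] := low p pn; exists m; rewrite -e addrC subrK.
exists 0; rewrite addr0 top //; apply/eqP; rewrite eqn_leq np andbT.
by rewrite -ltnS ltn_ord.
Qed.

(** If the squares agreed, twice the shifted difference [z] of the entries would lie in [one_q], and
    the entries of [L] would differ by half of it plus an integer. *)
Lemma tab_point_generic T k i j (m : int) : tab_set L T -> (1 <= k <= n)%N ->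
  (0 < i < k.+1)%N -> (0 < j < k.+1)%N -> i != j ->
  (q ^ m * Y T k i) ^+ 2 != (Y T k j) ^+ 2.
Proof.
move=> LT kn ik jk ij; apply/eqP => e; apply: (hL kn ik jk ij).
have [a ea] := entry_int k i LT; have [b eb] := entry_int k j LT.
pose z := m%:~R + entry T k i - entry T k j.
exists (z *+ 2), (b - a - m); split.
  rewrite /one_q /= /mkset qpowMn /z !qpowD qpowN (qpow_int hh) -/(Y T k i) -/(Y T k j).
  by rewrite expr_div_n e divff // expf_neq0 // tab_point_neq0.
rewrite -(mulr_natr z) mulfK ?pnatr_eq0 // /z ea eb !intrB.
by ring.
Qed.

Lemma row_generic_step b T k : tab_set L T -> (1 <= k <= n)%N ->
  row_generic (qstep b) (Y T) k.
Proof.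
move=> LT kn i j ik jk ij; split.
  by have := tab_point_generic 0 LT kn ik jk ij; rewrite expr0z mul1r.
case: b; first by have := tab_point_generic 1 LT kn ik jk ij; rewrite expr1z.
by have := tab_point_generic (-1) LT kn ik jk ij; rewrite exprN1.
Qed.

Definition op_fun b k T : V :=
  op_sign b *: \sum_(1 <= j < k.+1) g b T k j *: vec (T + tab_step b k j).

Definition op b k : V -> V := lift (op_fun b k).

Lemma opD b k v w : op b k (v + w) = op b k v + op b k w.
Proof. exact: liftD. Qed.

Lemma opZ b k a v : op b k (a *: v) = a *: op b k v.
Proof. exact: liftZ. Qed.

Lemma op0 b k : op b k 0 = 0.
Proof. by rewrite -[X in op b k X](scale0r (0 : V)) opZ scale0r. Qed.

Lemma op_sum b k (I : Type) (r : seq I) (v : I -> V) :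
  op b k (\sum_(i <- r) v i) = \sum_(i <- r) op b k (v i).
Proof. exact: (big_morph (op b k) (opD b k) (op0 b k)). Qed.

Lemma op_vec b k T : tab_set L T -> op b k (vec T) = op_fun b k T.
Proof. exact: lift_vec. Qed.

Lemma op2_vec b1 k1 b2 k2 T : (k1 < n)%N -> tab_set L T ->
  op b2 k2 (op b1 k1 (vec T)) = (op_sign b2 * op_sign b1) *:
    \sum_(1 <= i < k1.+1) \sum_(1 <= j < k2.+1)
    (g b1 T k1 i * g b2 (T + tab_step b1 k1 i) k2 j) *:
      vec (T + tab_step b1 k1 i + tab_step b2 k2 j).
Proof.
move=> k1n LT; rewrite op_vec // /op_fun opZ op_sum [in RHS]mulrC -[RHS]scalerA; congr (_ *: _).
rewrite scaler_sumr; apply: eq_bigr => i _.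
rewrite opZ op_vec; last exact: tab_set_step.
rewrite /op_fun scalerA mulrC -scalerA; congr (_ *: _); rewrite scaler_sumr.
by apply: eq_bigr => j _; rewrite scalerA.
Qed.

Lemma op3_vec b1 k1 b2 k2 b3 k3 T : (k1 < n)%N -> (k2 < n)%N -> tab_set L T ->
  op b3 k3 (op b2 k2 (op b1 k1 (vec T))) = (op_sign b3 * op_sign b2 * op_sign b1) *:
    \sum_(1 <= i < k1.+1) \sum_(1 <= j < k2.+1) \sum_(1 <= m < k3.+1)
    (g b1 T k1 i * g b2 (T + tab_step b1 k1 i) k2 j *
       g b3 (T + tab_step b1 k1 i + tab_step b2 k2 j) k3 m) *:
      vec (T + tab_step b1 k1 i + tab_step b2 k2 j + tab_step b3 k3 m).
Proof.
move=> k1n k2n LT; rewrite op2_vec // opZ -[op_sign b3 * _ * _]mulrA [in RHS]mulrC -[RHS]scalerA; congr (_ *: _).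
rewrite op_sum scaler_sumr; apply: eq_bigr => i _.
rewrite op_sum scaler_sumr; apply: eq_bigr => j _.
rewrite opZ op_vec; last by do 2 apply: tab_set_step => //.
rewrite /op_fun scalerA mulrC -scalerA; congr (_ *: _); rewrite scaler_sumr.
by apply: eq_bigr => m _; rewrite scalerA.
Qed.

Lemma op2_comm b1 k1 b2 k2 T : (k1 < n)%N -> (k2 < n)%N -> tab_set L T ->
  (forall i j, (0 < i < k1.+1)%N -> (0 < j < k2.+1)%N ->
    g b1 T k1 i * g b2 (T + tab_step b1 k1 i) k2 j =
    g b2 T k2 j * g b1 (T + tab_step b2 k2 j) k1 i) ->
  op b2 k2 (op b1 k1 (vec T)) = op b1 k1 (op b2 k2 (vec T)).
Proof.
move=> k1n k2n LT E; rewrite (op2_vec b1 b2 k2 k1n LT) (op2_vec b2 b1 k1 k2n LT).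
rewrite [in RHS]exchange_big /= [in LHS]mulrC; congr (_ *: _); rewrite big_nat_cond [RHS]big_nat_cond.
apply: eq_bigr => i; rewrite andbT => ik.
rewrite big_nat_cond [RHS]big_nat_cond; apply: eq_bigr => j; rewrite andbT => jk.
by rewrite (E _ _ ik jk) addrAC.
Qed.

Lemma op_far b1 k1 b2 k2 T : (k1 < n)%N -> (k2 < n)%N -> tab_set L T ->
  k1 != k2 -> other_row b1 k1 != k2 -> other_row b2 k2 != k1 ->
  op b2 k2 (op b1 k1 (vec T)) = op b1 k1 (op b2 k2 (vec T)).
Proof.
move=> k1n k2n LT k12 o12 o21; apply: op2_comm => // i j ik jk.
rewrite (tab_point_step _ _ ik (ltnW k1n)) (tab_point_step _ _ jk (ltnW k2n)).
by rewrite !gcoef_far 1?mulrC // eq_sym.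
Qed.

Lemma op_mutual k T : (k.+1 < n)%N -> tab_set L T ->
  op true k (op false k.+1 (vec T)) = op false k.+1 (op true k (vec T)).
Proof.
move=> kn LT; apply/esym/op2_comm => // [|i j ik jk]; first exact: ltnW.
have kn' : (k <= n)%N by rewrite ltnW // ltnW.
rewrite (tab_point_step _ _ ik kn') (tab_point_step _ _ jk (ltnW kn)) /=.
apply: ef_mutual => // [a a'|]; first exact: tab_point_neq0.
by rewrite neq_ltn ltnSn.
Qed.

(** Twice the sum vanishes term by term after exchanging the indices, and 2 is invertible. *)
Lemma sum_antisym (W : lmodType C) (r : seq nat) (f : nat -> nat -> W) :
  (forall i j, i \in r -> j \in r -> f i j + f j i = 0) ->
  \sum_(i <- r) \sum_(j <- r) f i j = 0.
Proof.
move=> anti; set X := LHS.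
have : X + X = 0.
  rewrite {1}/X exchange_big -big_split /= big_seq big1 // => i ir.
  by rewrite -big_split /= big_seq big1 // => j jr; apply: anti.
rewrite -mulr2n -scaler_nat => /eqP.
by rewrite scaler_eq0 pnatr_eq0 => /eqP.
Qed.

Lemma scaler_lin3 (W : lmodType C) (s a : C) (x y z : W) :
  s *: x - a *: (s *: y) + s *: z = s *: (x - a *: y + z).
Proof. by rewrite scalerA mulrC -scalerA -scalerBr -scalerDr. Qed.

Lemma op_serre b k l T : (0 < k < n)%N -> (0 < l < n)%N -> adjacent k l ->
  tab_set L T ->
  op b k (op b k (op b l (vec T))) - (q + q^-1) *: op b k (op b l (op b k (vec T)))
    + op b l (op b k (op b k (vec T))) = 0.
Proof.
move=> /andP[k0 kn] /andP[l0 ln] kl LT.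
rewrite (op3_vec b b b k ln kn LT) (op3_vec b b b k kn ln LT) (op3_vec b b b l kn kn LT).
rewrite scaler_lin3.
set S1 := (X in X - _ + _); set S2 := (X in _ - _ *: X + _); set S3 := (X in _ - _ + X).
suff -> : S1 - (q + q^-1) *: S2 + S3 = 0 by rewrite scaler0.
(* All three sums are brought to the same order, the two moves of row [k] outermost, so that they
   combine into one [serre_coef] on one common tableau. *)
have -> : S1 = \sum_(1 <= i < k.+1) \sum_(1 <= j < k.+1) \sum_(1 <= m < l.+1)
  (g b T l m * g b (T + tab_step b l m) k i * g b (T + tab_step b l m + tab_step b k i) k j) *:
      vec (T + tab_step b l m + tab_step b k i + tab_step b k j).
  rewrite /S1 exchange_big /=; apply: eq_bigr => i _.
  by rewrite exchange_big.
have -> : S2 = \sum_(1 <= i < k.+1) \sum_(1 <= j < k.+1) \sum_(1 <= m < l.+1)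
  (g b T k i * g b (T + tab_step b k i) l m * g b (T + tab_step b k i + tab_step b l m) k j) *:
      vec (T + tab_step b k i + tab_step b l m + tab_step b k j).
  by rewrite /S2; apply: eq_bigr => i _; rewrite exchange_big.
rewrite /S3 scaler_sumr -sumrB -big_split /=.
set G := serre_coef c (qstep b) (Y T) k (other_row b k) l (other_row b l).
transitivity (\sum_(1 <= i < k.+1) \sum_(1 <= j < k.+1) \sum_(1 <= m < l.+1)
   G i j m *: vec (T + tab_step b k i + tab_step b k j + tab_step b l m)).
  rewrite big_nat_cond [RHS]big_nat_cond; apply: eq_bigr => i; rewrite andbT => ik.
  rewrite scaler_sumr -sumrB -big_split /=.
  rewrite big_nat_cond [RHS]big_nat_cond; apply: eq_bigr => j; rewrite andbT => jk.
  rewrite scaler_sumr -sumrB -big_split /=.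
  rewrite big_nat_cond [RHS]big_nat_cond; apply: eq_bigr => m; rewrite andbT => ml.
  rewrite !(tab_point_step _ _ ik (ltnW kn)) !(tab_point_step _ _ jk (ltnW kn)).
  rewrite !(tab_point_step _ _ ml (ltnW ln)) !(tab_point_step _ _ ik (ltnW kn)).
  have e1 : T + tab_step b l m + tab_step b k i + tab_step b k j =
      T + tab_step b k i + tab_step b k j + tab_step b l m.
    by rewrite (addrAC T (tab_step b l m)) (addrAC (T + _) (tab_step b l m)).
  have e2 : T + tab_step b k i + tab_step b l m + tab_step b k j =
      T + tab_step b k i + tab_step b k j + tab_step b l m by rewrite addrAC.
  have qs : qstep b + (qstep b)^-1 = q + q^-1.
    by rewrite /qstep; case: (b); rewrite // invrK addrC.
  by rewrite /G /serre_coef qs e1 e2 scalerA -scalerBl -scalerDl.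
apply: sum_antisym => i j; rewrite !mem_index_iota => ik jk.
rewrite -big_split /= big_nat_cond big1 // => m; rewrite andbT => ml.
rewrite (addrAC T (tab_step b k j)) -scalerDl.
suff -> : G i j m + G j i m = 0 by rewrite scale0r.
have gen : row_generic (qstep b) (Y T) k by apply: row_generic_step; rewrite // k0 ltnW.
have P := tab_point_neq0 T; have sn := qstep_neq0 b.
(* For adjacent rows exactly one coefficient sees the other row; which one decides between
   [serre_upper] and [serre_lower]. *)
have [ek|el] : l = other_row b k \/ k = other_row b l.
  by rewrite /other_row; case: (b); move: kl; rewrite /adjacent => kl; lia.
- rewrite /G ek; rewrite ek in ml; apply: serre_upper => //; rewrite -ek; move: kl;
    rewrite /adjacent /other_row in ek *; case: (b) ek => ek kl; lia.
- rewrite /G -el; apply: serre_lower => //; move: kl;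
    rewrite /adjacent /other_row in el *; case: (b) el => el kl; lia.
Qed.

Lemma row_prod_neq0 T k : row_prod (Y T) k != 0.
Proof. by rewrite prodf_seq_neq0; apply/allP => l _; rewrite tab_point_neq0. Qed.

Lemma qpow_gt_weight T k : (0 < k)%N ->
  qp (gt_weight T k) = row_prod (Y T) k / row_prod (Y T) k.-1 * q ^+ k.
Proof.
move=> k0; rewrite /gt_weight /row_prod prednK // !qpowD qpowN !qpow_sum.
by rewrite -[k%:R]/(1 *+ k) qpowMn (qpow1 hh).
Qed.

Lemma op_ef_diag k T : (0 < k < n)%N -> tab_set L T ->
  op true k (op false k (vec T)) - op false k (op true k (vec T)) =
  (qp (gt_weight T k - gt_weight T k.+1) - qp (gt_weight T k.+1 - gt_weight T k)) / c
    *: vec T.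
Proof.
move=> /andP[k0 kn] LT.
rewrite (op2_vec _ _ _ kn LT) (op2_vec _ _ _ kn LT) mulr1 mul1r !scaleN1r opprK addrC.
rewrite [X in _ - X]exchange_big /= -sumrB.
have eqv i j : T + tab_step true k i + tab_step false k j = T + tab_step false k j + tab_step true k i.
  by rewrite addrAC.
transitivity (\sum_(1 <= i < k.+1)
  (g true T k i * g false (T + tab_step true k i) k i -
   g false T k i * g true (T + tab_step false k i) k i) *: vec T).
  rewrite big_nat_cond [RHS]big_nat_cond; apply: eq_bigr => i; rewrite andbT => ik.
  (* Only [j = i] returns to [T]; the terms with [j != i] cancel by [ef_offdiag]. *)
  rewrite -sumrB (bigD1_seq i) ?mem_index_iota ?iota_uniq //= big_nat_cond big1 ?addr0.
    by rewrite {2 4}/tab_step addrK subrK -scalerBl.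
  move=> j /andP[jk ji]; rewrite eqv -scalerBl.
  rewrite !(tab_point_step _ _ ik (ltnW kn)) !(tab_point_step _ _ jk (ltnW kn)) /=.
  rewrite (@ef_offdiag _ c q) ?subrr ?scale0r //.
  - exact: tab_point_neq0.
  - by rewrite eq_sym.
  - by rewrite neq_ltn ltnSn orbT.
  - by case: (k) k0 => // k' _; rewrite neq_ltn ltnSn.
rewrite -scaler_suml; congr (_ *: _).
have gen : row_generic q (Y T) k.
  by apply: (@row_generic_step true); rewrite // k0 ltnW.
apply: etrans (etrans (ef_diag q0 q2 (tab_point_neq0 T) k0 gen) _).
  rewrite big_nat_cond [RHS]big_nat_cond; apply: eq_bigr => i; rewrite andbT => ik.
  by rewrite !(tab_point_step _ _ ik (ltnW kn)).
(* The factors [q^-1] and [q] of [ef_diag] are the quotients of [q ^+ k] and [q ^+ k.+1], coming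
   from the summand [k] in the definition of the weight. *)
congr (_ / _); rewrite !qpowB !qpow_gt_weight //=.
move: (row_prod_neq0 T k) (row_prod_neq0 T k.+1) (row_prod_neq0 T k.-1).
move: (row_prod _ _) (row_prod _ _) (row_prod _ _) => x y z x0 y0 z0.
have qk : q ^+ k != 0 by rewrite expf_neq0.
by rewrite !exprS; field; rewrite x0 y0 z0 q0 qk.
Qed.

Definition opK_fun (hw : weight n) T : V :=
  qp (\sum_c (hw c)%:~R * gt_weight T (idx_nat c)) *: vec T.

Definition opK hw := lift (opK_fun hw).

Lemma gt_weight_step b T k j m : (0 < j <= k)%N -> (k < n)%N -> (0 < m)%N ->
  gt_weight (T + tab_step b k j) m =
  gt_weight T m + (if b then 1 else -1) * ((m == k)%:R - (m == k.+1)%:R).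
Proof.
move=> jk kn m0; rewrite /gt_weight.
have ent r i : entry (T + tab_step b k j) r i =
    entry T r i + (if b then 1 else -1) * ((r == k) && (i == j))%:R.
  rewrite entryD; case: b; rewrite /= ?entryN (entry_delta _ _ _ jk (ltnW kn)).
    by rewrite mul1r.
  by rewrite mulN1r.
have sumE r N : (k = r -> N = r.+1)%N -> \sum_(1 <= i < N) entry (T + tab_step b k j) r i =
    \sum_(1 <= i < N) entry T r i + (if b then 1 else -1) * (r == k)%:R.
  move=> rN; rewrite (eq_bigr _ (fun i _ => ent r i)) big_split /=; congr (_ + _).
  rewrite -mulr_sumr; congr (_ * _); have [rk|_] := eqVneq r k; last first.
    by rewrite big1 // => i _.
  rewrite (bigD1_seq j) ?iota_uniq //=; last by rewrite mem_index_iota (rN (esym rk)) rk.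
  by rewrite eqxx big1 ?addr0 // => i /negPf->.
rewrite !sumE //; last by rewrite prednK.
have -> : (m.-1 == k) = (m == k.+1) by case: (m) m0.
by rewrite opprD addrACA -mulrBr [LHS]addrAC.
Qed.

Lemma idx_gt0 N (a : idx N) : (0 < idx_nat a)%N.
Proof. exact: (valP a). Qed.

Lemma alphaE k (a : idx n) : (alpha n k a)%:~R = (idx_nat a == k)%:R - (idx_nat a == k.+1)%:R :> C.
Proof. by rewrite /alpha /eps !ffunE intrB; do 2 case: (_ == _). Qed.

Lemma opK_weight_step b (hw : weight n) T k j : (0 < j <= k)%N -> (k < n)%N ->
  qp (\sum_c (hw c)%:~R * gt_weight (T + tab_step b k j) (idx_nat c)) =
  qp (\sum_c (hw c)%:~R * gt_weight T (idx_nat c)) *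
    q ^ ((if b then 1 else -1) * pairing hw (alpha n k)).
Proof.
move=> jk kn; rewrite -(qpow_int hh) -qpowD; congr (qp _).
rewrite /pairing rmorphM /= [(\sum_c _)%:~R]rmorph_sum /= mulr_sumr -big_split /=.
apply: eq_bigr => a _; rewrite gt_weight_step ?idx_gt0 // mulrDr; congr (_ + _).
by rewrite rmorphM /= alphaE mulrCA; case: (b).
Qed.

Lemma opKD hw v w : opK hw (v + w) = opK hw v + opK hw w.
Proof. exact: liftD. Qed.

Lemma opKZ hw a v : opK hw (a *: v) = a *: opK hw v.
Proof. exact: liftZ. Qed.

Lemma opK0 hw : opK hw 0 = 0.
Proof. by rewrite -[X in opK hw X](scale0r (0 : V)) opKZ scale0r. Qed.

Lemma opK_sum hw (I : Type) (r : seq I) (v : I -> V) :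
  opK hw (\sum_(i <- r) v i) = \sum_(i <- r) opK hw (v i).
Proof. exact: (big_morph (opK hw) (opKD hw) (opK0 hw)). Qed.

Lemma opK_vec hw T : tab_set L T -> opK hw (vec T) =
  qp (\sum_c (hw c)%:~R * gt_weight T (idx_nat c)) *: vec T.
Proof. exact: lift_vec. Qed.

Lemma opKD_vec hw hw' T : tab_set L T ->
  opK hw (opK hw' (vec T)) = opK (hw + hw') (vec T).
Proof.
move=> LT; rewrite (opK_vec hw' LT) opKZ !opK_vec // scalerA -qpowD; congr (qp _ *: _).
by rewrite -big_split /=; apply: eq_bigr => a _; rewrite ffunE intrD -mulrDl addrC.
Qed.

Lemma opK0_vec T : tab_set L T -> opK 0 (vec T) = vec T.
Proof.
move=> LT; rewrite opK_vec // big1 ?qpow0 ?scale1r // => a _.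
by rewrite ffunE mul0r.
Qed.

Lemma opK_op hw b k T : (k < n)%N -> tab_set L T ->
  opK hw (op b k (opK (- hw) (vec T))) =
  q ^ ((if b then 1 else -1) * pairing hw (alpha n k)) *: op b k (vec T).
Proof.
move=> kn LT; rewrite (opK_vec (- hw) LT) opZ opKZ op_vec // /op_fun opKZ opK_sum.
rewrite !(scalerA _ (op_sign b)) ![_ * op_sign b]mulrC -!(scalerA (op_sign b)).
congr (_ *: _); rewrite !scaler_sumr big_nat_cond [RHS]big_nat_cond.
apply: eq_bigr => j; rewrite andbT => jk.
rewrite opKZ opK_vec; last exact: tab_set_step.
rewrite !scalerA; congr (_ *: _); rewrite (opK_weight_step _ _ _ jk kn).
have -> : \sum_c ((- hw) c)%:~R * gt_weight T (idx_nat c) =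
    - \sum_c (hw c)%:~R * gt_weight T (idx_nat c).
  by rewrite -sumrN; apply: eq_bigr => a _; rewrite ffunE intrN mulNr.
rewrite qpowN; have := qpow_neq0 h (\sum_c (hw c)%:~R * gt_weight T (idx_nat c)).
by set x := qp _ => x0; rewrite mulrACA mulVf // mul1r mulrC.
Qed.

Lemma idx_of N m : (0 < m <= N)%N -> exists a : idx N, idx_nat a = m.
Proof. by case/andP=> m0 mN; exists (exist _ (Ordinal (mN : (m < N.+1)%N)) m0). Qed.

Lemma sum_eps (w : nat -> C) m : (0 < m <= n)%N ->
  \sum_(c : idx n) (idx_nat c == m)%:R * w (idx_nat c) = w m.
Proof.
move=> /idx_of[k <-]; rewrite (bigD1 k) //= eqxx mul1r big1 ?addr0 // => a ak.
have -> : (idx_nat a == idx_nat k) = false; last by rewrite mul0r.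
by apply: contraNF ak => /eqP e; apply/eqP/val_inj/val_inj.
Qed.

Lemma opK_eps (k : idx n) T : tab_set L T ->
  opK (eps n (idx_nat k)) (vec T) = qp (gt_weight T (idx_nat k)) *: vec T.
Proof.
move=> LT; rewrite opK_vec //; congr (qp _ *: _).
have kn : (0 < idx_nat k <= n)%N by rewrite idx_gt0 -ltnS ltn_ord.
rewrite -(sum_eps (gt_weight T) kn).
by apply: eq_bigr => a _; rewrite ffunE; case: (_ == _).
Qed.

Lemma opK_alpha (k : nat) T : (0 < k < n)%N -> tab_set L T ->
  opK (alpha n k) (vec T) - opK (- alpha n k) (vec T) =
  (qp (gt_weight T k - gt_weight T k.+1) - qp (gt_weight T k.+1 - gt_weight T k))
    *: vec T.
Proof.
move=> /andP[k0 kn] LT; rewrite !opK_vec // -scalerBl.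
have E : \sum_(c : idx n) (alpha n k c)%:~R * gt_weight T (idx_nat c) =
    gt_weight T k - gt_weight T k.+1.
  have kn' : (0 < k <= n)%N by rewrite k0 ltnW.
  rewrite -(sum_eps (gt_weight T) kn') -(sum_eps (gt_weight T) (kn : (0 < k.+1 <= n)%N)).
  by rewrite -sumrB; apply: eq_bigr => a _; rewrite alphaE mulrBl.
have E' : \sum_(c : idx n) ((- alpha n k) c)%:~R * gt_weight T (idx_nat c) =
    gt_weight T k.+1 - gt_weight T k.
  rewrite -opprB -E -sumrN; apply: eq_bigr => a _.
  by rewrite ffunE intrN mulNr.
by rewrite E E'.
Qed.

Lemma idx_lt (k : idx n.-1) : (0 < idx_nat k < n)%N.
Proof.
have := valP k; rewrite /idx_nat => -> /=.
by have := ltn_ord (val k); case: (n) k => [|n'] k //=; move: (valP k); case: (val k) => -[].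
Qed.

(** * The action of [U_q] *)

Fixpoint teval (x : Uq_term C n) : V -> V :=
  match x with
  | TGen (GenE i) => op true (idx_nat i)
  | TGen (GenF i) => op false (idx_nat i)
  | TGen (GenK hw) => opK hw
  | TScal a => fun v => a *: v
  | TAdd x y => fun v => teval x v + teval y v
  | TMul x y => fun v => teval x (teval y v)
  end.

Lemma tevalD x v w : teval x (v + w) = teval x v + teval x w.
Proof.
elim: x v w => [[i|i|hw]|a|x IHx y IHy|x IHx y IHy] v w /=.
- exact: opD.
- exact: opD.
- exact: opKD.
- exact: scalerDr.
- by rewrite IHx IHy addrACA.
- by rewrite IHy IHx.
Qed.

Lemma tevalZ x a v : teval x (a *: v) = a *: teval x v.
Proof.
elim: x v => [[i|i|hw]|a'|x IHx y IHy|x IHx y IHy] v /=.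
- exact: opZ.
- exact: opZ.
- exact: opKZ.
- by rewrite !scalerA mulrC.
- by rewrite IHx IHy scalerDr.
- by rewrite IHy IHx.
Qed.

Lemma teval_rel x y T : Uq_rel q x y -> tab_set L T -> teval x (vec T) = teval y (vec T).
Proof.
case=> {x y} /=.
- by move=> LT; rewrite opK0_vec // scale1r.
- by move=> hw hw' LT; rewrite opKD_vec.
- by move=> hw i LT; have /andP[_ kn] := idx_lt i; rewrite opK_op // mul1r.
- by move=> hw i LT; have /andP[_ kn] := idx_lt i; rewrite opK_op // mulN1r.
- move=> i j LT; rewrite !scaleN1r.
  have kn := idx_lt i; have ln := idx_lt j.
  have /andP[k0 kn'] := kn; have /andP[l0 ln'] := ln.
  have [<-|ij] := eqVneq i j.
    by rewrite op_ef_diag // opK_alpha // scalerA mulrC mul1r.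
  rewrite mul0r scale0r; apply/eqP; rewrite subr_eq0; apply/eqP.
  have kl : idx_nat i != idx_nat j.
    by apply: contraNneq ij => e; apply/eqP/val_inj/val_inj.
  (* Among distinct indices only [e_i] and [f_(i+1)] see each other's row: [e_i] looks up and [f_j]
     looks down. All other pairs are independent. *)
  have [e|e] := eqVneq (idx_nat j) (idx_nat i).+1.
    by rewrite e op_mutual // -e.
  apply: op_far => //=; first by rewrite eq_sym.
    by apply: contraNneq e => <-; rewrite prednK.
  by rewrite eq_sym.
- move=> i j ij LT; rewrite !scaleN1r scale0r op_serre ?idx_lt //.
- move=> i j ij LT; rewrite !scaleN1r scale0r op_serre ?idx_lt //.
- move=> i j; rewrite /far => ij LT; have /andP[_ kn] := idx_lt i; have /andP[_ ln] := idx_lt j.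
  by apply: op_far => //=; move: ij => /orP[]; lia.
- move=> i j; rewrite /far => ij LT; have /andP[k0 kn] := idx_lt i; have /andP[l0 ln] := idx_lt j.
  by apply: op_far => //=; move: ij => /orP[]; lia.
Qed.

Hypothesis vec_span : forall (P : V -> Prop), P 0 ->
  (forall a T v, tab_set L T -> P v -> P (a *: vec T + v)) -> forall v, P v.

(** The relations were checked on basis vectors only; linearity of [teval x] carries them to all of
    [V], and the algebra axioms hold for operators. *)
Lemma teval_cong x y v : Uq_cong q x y -> teval x v = teval y v.
Proof.
move=> xy; elim: xy v => {x y} /=.
- move=> x y xy; elim/vec_span => [|a T v LT IH].
    by rewrite -(scale0r (0 : V)) !tevalZ !scale0r.
  by rewrite !tevalD !tevalZ IH (teval_rel xy LT).
- by [].
- by move=> x y _ IH v; rewrite IH.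
- by move=> y x z _ IH _ IH' v; rewrite IH IH'.
- by move=> x x' y y' _ IH _ IH' v; rewrite IH IH'.
- by move=> x x' y y' _ IH _ IH' v; rewrite IH IH'.
- by move=> *; rewrite addrA.
- by move=> *; rewrite addrC.
- by [].
- by [].
- by move=> *; rewrite tevalD.
- by move=> *; rewrite !scale0r.
- by move=> *; rewrite scale1r.
- by move=> *; rewrite scalerDl.
- by move=> *; rewrite scalerA.
- by move=> *; rewrite tevalZ.
Qed.

Definition Uq_act (x : Uq n q) (v : V) : V := teval (repr x) v.

Lemma Uq_actE x v : Uq_act (Uq_of q x) v = teval x v.
Proof. exact/teval_cong/Uq_reprP. Qed.

Lemma Uq_actDl (x y : Uq n q) v : Uq_act (x + y) v = Uq_act x v + Uq_act y v.
Proof.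
by elim/Uq_ind: x => x; elim/Uq_ind: y => y; rewrite -[_ + _]Uq_ofD !Uq_actE.
Qed.

Lemma Uq_actDr (x : Uq n q) v w : Uq_act x (v + w) = Uq_act x v + Uq_act x w.
Proof. exact: tevalD. Qed.

Lemma Uq_actZ a (x : Uq n q) v : Uq_act (a *: x) v = a *: Uq_act x v.
Proof. by elim/Uq_ind: x => x; rewrite -[_ *: _]Uq_ofZ !Uq_actE. Qed.

Lemma Uq_act1 v : Uq_act 1 v = v.
Proof. by rewrite Uq_actE /= scale1r. Qed.

Lemma Uq_actM (x y : Uq n q) v : Uq_act (x * y) v = Uq_act x (Uq_act y v).
Proof.
by elim/Uq_ind: x => x; elim/Uq_ind: y => y; rewrite -[_ * _]Uq_ofM !Uq_actE.
Qed.

Lemma teval_translate D x v : tab_set (0 : tableau C n) D ->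
  (forall T, Y (T + D) = Y T) ->
  teval x (lift (fun T => vec (T + D)) v) = lift (fun T => vec (T + D)) (teval x v).
Proof.
move=> D0 YD; set tau := lift _.
have tauD v1 v2 : tau (v1 + v2) = tau v1 + tau v2 by exact: liftD.
have tauZ a v1 : tau (a *: v1) = a *: tau v1 by exact: liftZ.
have tau0 : tau 0 = 0 by rewrite -(scale0r (0 : V)) tauZ !scale0r.
have tau_vec T : tab_set L T -> tau (vec T) = vec (T + D) by exact: lift_vec.
have opC b k v1 : (k < n)%N -> op b k (tau v1) = tau (op b k v1).
  move=> kn; elim/vec_span: v1 => [|a T v1 LT IH]; first by rewrite tau0 !op0 tau0.
  rewrite tauD tauZ !opD !opZ tauD tauZ IH tau_vec //; congr (_ *: _ + _).
  rewrite !op_vec //; last exact: tab_setD.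
  rewrite /op_fun tauZ (big_morph tau tauD tau0); congr (_ *: _).
  apply: eq_bigr => j _; rewrite tauZ tau_vec; last exact: tab_set_step.
  by rewrite YD addrAC.
have opKC hw v1 : opK hw (tau v1) = tau (opK hw v1).
  elim/vec_span: v1 => [|a T v1 LT IH]; first by rewrite tau0 !opK0 tau0.
  rewrite tauD tauZ !opKD !opKZ tauD tauZ IH tau_vec //; congr (_ *: _ + _).
  rewrite !opK_vec //; last exact: tab_setD.
  rewrite tauZ tau_vec //; congr (_ *: _); rewrite !qpow_sum; apply: eq_bigr => k _.
  (* The weights themselves may change under [D]; only [q] to the weight is preserved, so the
     integral coefficient is turned into an exponent. *)
  have qpE T' : qp ((hw k)%:~R * gt_weight T' (idx_nat k)) =
      qp (gt_weight T' (idx_nat k)) ^ hw k.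
    rewrite mulrC mulrzr; case: (hw k) => m; rewrite ?NegzE ?mulrNz -pmulrn ?qpowN qpowMn ?exprnN //.
  by rewrite !qpE !qpow_gt_weight ?idx_gt0 // YD.
elim: x v => [[i|i|hw]|a|x IHx y IHy|x IHx y IHy] v1 /=.
- by apply: opC; have /andP[] := idx_lt i.
- by apply: opC; have /andP[] := idx_lt i.
- exact: opKC.
- by rewrite tauZ.
- by rewrite tauD IHx IHy.
- by rewrite IHy IHx.
Qed.

Lemma Uq_act_translate D u v : tab_set (0 : tableau C n) D ->
  (forall T, Y (T + D) = Y T) ->
  Uq_act u (lift (fun T => vec (T + D)) v) = lift (fun T => vec (T + D)) (Uq_act u v).
Proof. exact: teval_translate. Qed.

Lemma Uq_act_op_e (k : idx n.-1) T : tab_set L T ->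
  Uq_act (Uq_e q k) (vec T) = op_fun true (idx_nat k) T.
Proof. by move=> LT; rewrite /Uq_e Uq_actE /= op_vec. Qed.

Lemma Uq_act_op_f (k : idx n.-1) T : tab_set L T ->
  Uq_act (Uq_f q k) (vec T) = op_fun false (idx_nat k) T.
Proof. by move=> LT; rewrite /Uq_f Uq_actE /= op_vec. Qed.

Lemma Uq_act_e (k : idx n.-1) T : tab_set L T ->
  Uq_act (Uq_e q k) (vec T) = - \sum_(1 <= j < (idx_nat k).+1)
    gt_e_coef q h T (idx_nat k) j *: vec (T + delta_tab n (idx_nat k) j).
Proof.
move=> LT; rewrite Uq_act_op_e // /op_fun scaleN1r; congr (- _).
by apply: eq_bigr => j _; rewrite gt_e_coefE.
Qed.

Lemma Uq_act_f (k : idx n.-1) T : tab_set L T ->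
  Uq_act (Uq_f q k) (vec T) = \sum_(1 <= j < (idx_nat k).+1)
    gt_f_coef q h T (idx_nat k) j *: vec (T - delta_tab n (idx_nat k) j).
Proof.
move=> LT; rewrite Uq_act_op_f // /op_fun scale1r.
by apply: eq_bigr => j _; rewrite gt_f_coefE ?idx_gt0.
Qed.

Lemma Uq_act_k (k : idx n) T : tab_set L T ->
  Uq_act (Uq_k q (eps n (idx_nat k))) (vec T) = qp (gt_weight T (idx_nat k)) *: vec T.
Proof. by move=> LT; rewrite /Uq_k Uq_actE /= opK_eps. Qed.

Lemma Uq_act_op b k : (0 < k < n)%N -> exists u, forall T, tab_set L T ->
  Uq_act u (vec T) = \sum_(1 <= j < k.+1) g b T k j *: vec (T + tab_step b k j).
Proof.
case/andP=> k0 kn; have [|a ak] := @idx_of n.-1 k; first by rewrite k0 -ltnS prednK ?(leq_trans _ kn).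
case: b.
  exists ((-1) *: Uq_e q a) => T LT.
  by rewrite Uq_actZ Uq_act_op_e // ak /op_fun scalerA mulrNN mulr1 scale1r.
by exists (Uq_f q a) => T LT; rewrite Uq_act_op_f // ak /op_fun scale1r.
Qed.

Lemma Uq_act_weight k : (0 < k <= n)%N -> exists u, forall T, tab_set L T ->
  Uq_act u (vec T) = qp (gt_weight T k) *: vec T.
Proof.
by case/idx_of=> a <-; exists (Uq_k q (eps n (idx_nat a))) => T LT; rewrite Uq_act_k.
Qed.

Definition gt_module : amodule (Uq n q) V :=
  AModule Uq_actDl Uq_actDr Uq_actZ Uq_act1 Uq_actM.
End GelfandTsetlin.

Arguments tab_step : simpl never.

(** * Operators realized modulo the relators *)

Section Interpolation.
Variables (F : fieldType) (X : Type) (D : X -> Prop) (e : X -> X -> Prop).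
Variable A : (X -> F) -> Prop.
Hypothesis A_ext : forall f g, (forall x, D x -> f x = g x) -> A f -> A g.
Hypothesis A_cst : forall a, A (fun _ => a).
Hypothesis A_add : forall f g, A f -> A g -> A (fun x => f x + g x).
Hypothesis A_mul : forall f g, A f -> A g -> A (fun x => f x * g x).
Hypothesis A_inv : forall f x y, A f -> D x -> D y -> e x y -> f x = f y.
Hypothesis A_sep : forall x y, D x -> D y -> ~ e x y -> exists2 f, A f & f x != f y.

Fixpoint all_in (P : X -> Prop) (s : seq X) : Prop :=
  if s is x :: s' then P x /\ all_in P s' else True.

Lemma all_in_sub (P Q : X -> Prop) s : (forall x, P x -> Q x) -> all_in P s -> all_in Q s.
Proof. by move=> PQ; elim: s => //= x s IH [/PQ ? /IH]. Qed.

Lemma all_inI (P Q : X -> Prop) s : all_in P s -> all_in Q s ->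
  all_in (fun x => P x /\ Q x) s.
Proof. by elim: s => //= x s IH [? /IH H] [? /H]. Qed.

Lemma separating_bump x s : D x -> all_in D s ->
  exists f, [/\ A f, f x = 1 & all_in (fun y => ~ e x y -> f y = 0) s].
Proof.
move=> Dx; elim: s => [_|y s IH /= [Dy /IH[f [Af fx fs]]]].
  by exists (fun _ => 1).
have [exy|nexy] := pselect (e x y).
  by exists f; split.
have [g Ag gxy] := A_sep Dx Dy nexy.
exists (fun z => f z * ((g z + - g y) * (g x - g y)^-1)); split.
- by apply: (A_mul Af); apply: (A_mul (A_add Ag (A_cst _)) (A_cst _)).
- by rewrite fx mul1r divff // subr_eq0.
- split; first by rewrite subrr mul0r mulr0.
  by apply: all_in_sub fs => z fz /fz ->; rewrite mul0r.
Qed.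

(** The last hypothesis on [s] says that it meets every class of [e], so that agreement on [s] is
    agreement on all of [D]. *)
Lemma separating_interpolation (s : seq X) (f : X -> F) :
  (forall x y, D x -> D y -> e x y -> f x = f y) ->
  (forall x y, e x y -> e y x) ->
  all_in D s -> (forall x, D x -> ~ all_in (fun y => ~ e x y) s) -> A f.
Proof.
move=> fe esym Ds cover.
have [g Ag gf] : exists2 g, A g & all_in (fun y => g y = f y) s.
  elim: s Ds {cover} => [_|x s IH /= [Dx Ds]]; first by exists (fun _ => 0).
  have [g Ag gs] := IH Ds; have [b [Ab bx bs]] := separating_bump Dx Ds.
  (* A point of a new class is corrected by a multiple of its bump, which leaves the earlier values
     alone; in an old class the value at [x] is already right. *)
  have [new|old] := pselect (all_in (fun y => ~ e x y) s).
    exists (fun y => g y + (f x - g x) * b y).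
      by apply: A_add => //; apply: A_mul.
    split; first by rewrite bx mulr1 addrC subrK.
    apply: all_in_sub (all_inI (all_inI bs new) gs) => y [[by0 nxy] <-].
    by rewrite by0 // mulr0 addr0.
  exists g => //; split=> //; apply: contra_notP old => gfx.
  apply: all_in_sub (all_inI Ds gs) => y [Dy gy] exy; apply: gfx.
  by rewrite (A_inv Ag Dx Dy exy) gy (fe _ _ Dx Dy exy).
apply: (A_ext _ Ag) => x Dx; apply: contra_notP (cover x Dx) => gfx.
apply: all_in_sub (all_inI Ds gf) => y [Dy gy] exy; apply: gfx.
by rewrite (A_inv Ag Dx Dy exy) gy (fe _ _ Dx Dy exy).
Qed.
End Interpolation.

(** * Weighted shifts realized by [U_q] modulo [N] *)

Section Realization.
Variables (R : realType) (n : nat) (q h : R[i]) (L : tableau R[i] n) (d : nat).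
Hypotheses (hh : cexp h = q) (q2 : q - q^-1 != 0) (hL : q_generic h L).
Hypotheses (hd_odd : odd d) (hq : d.-primitive_root q).
Local Notation C := R[i].
Local Notation c := (q - q^-1).
Local Notation qp := (qpow h).
Local Notation Y := (tab_point h).
Local Notation tab := (tab_set L).
Local Notation g b T k j := (gcoef c (Y T) k (other_row b k) j).
Local Notation step := (@tab_step R n).
Implicit Types (T : tableau C n) (b : bool) (D : tableau C n) (a : tableau C n -> C).

Variables (V : lmodType C) (vec : tableau C n -> V).
Variables (M : amodule (Uq n q) V) (N : submodule M) (p : pos n.-1 -> C).

Hypothesis act_op : forall b k, (0 < k < n)%N -> exists u, forall T, tab T ->
  M u (vec T) = \sum_(1 <= j < k.+1) g b T k j *: vec (T + step b k j).
Hypothesis act_weight : forall k, (0 < k <= n)%N -> exists u, forall T, tab T ->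
  M u (vec T) = qp (gt_weight T k) *: vec T.
Hypothesis relN : forall (x : pos n.-1) T, tab T ->
  N (vec (T + delta_tab n (row_ x) (col_ x) *+ d) - p x *: vec T).

Let q0 : q != 0 := q_neq0 hh.

(** One element [u] has to serve all tableaux at once; this is what lets realized operators be
    composed and applied to linear combinations. *)
Definition realized (f : tableau C n -> V) : Prop :=
  exists u, forall T, tab T -> N (M u (vec T) - f T).

Definition shift_op a D : Prop := realized (fun T => a T *: vec (T + D)).

Lemma smN v : N v -> N (- v).
Proof. by rewrite -scaleN1r; exact: smZ. Qed.

Lemma realized_mod f f' : (forall T, tab T -> N (f T - f' T)) ->
  realized f -> realized f'.
Proof.
move=> ff' [u uf]; exists u => T LT.
have -> : M u (vec T) - f' T = (M u (vec T) - f T) + (f T - f' T).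
  by rewrite addrA subrK.
by apply: smD; [exact: uf|exact: ff'].
Qed.

Lemma realized_ext f f' : (forall T, tab T -> f T = f' T) -> realized f -> realized f'.
Proof. by move=> ff'; apply: realized_mod => T /ff' ->; rewrite subrr; exact: sm0. Qed.

Lemma realizedD f f' : realized f -> realized f' -> realized (fun T => f T + f' T).
Proof.
move=> [u uf] [u' uf']; exists (u + u') => T LT.
by rewrite actDl opprD addrACA; apply: smD; [exact: uf|exact: uf'].
Qed.

Lemma realizedZ x f : realized f -> realized (fun T => x *: f T).
Proof.
by move=> [u uf]; exists (x *: u) => T LT; rewrite actZ -scalerBr; apply/smZ/uf.
Qed.

Lemma actN u v : M u (- v) = - M u v.
Proof. by rewrite -scaleN1r actrZ scaleN1r. Qed.

Lemma act_sum u (I : Type) (r : seq I) (v : I -> V) :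
  M u (\sum_(i <- r) v i) = \sum_(i <- r) M u (v i).
Proof. exact: (big_morph (M u) (actDr M u) (actr0 M u)). Qed.

Lemma smsum (I : Type) (r : seq I) (v : I -> V) : (forall i, N (v i)) ->
  N (\sum_(i <- r) v i).
Proof. by move=> Nv; elim/big_rec: _ => [|i x _ Nx]; [exact: sm0|exact: smD]. Qed.

Lemma realized_comp a D (I : Type) (r : seq I) (x : I -> tableau C n -> C)
    (E : I -> tableau C n) : shift_op a D ->
  (forall i, tab_set (0 : tableau C n) (E i)) ->
  realized (fun T => \sum_(i <- r) x i T *: vec (T + E i)) ->
  realized (fun T => \sum_(i <- r) (x i T * a (T + E i)) *: vec (T + E i + D)).
Proof.
move=> [u ua] Elat [v vx]; exists (u * v) => T LT; rewrite actM.
set S := \sum_(i <- r) x i T *: vec (T + E i).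
have -> : M u (M v (vec T)) - \sum_(i <- r) (x i T * a (T + E i)) *: vec (T + E i + D) =
    M u (M v (vec T) - S) + \sum_(i <- r) x i T *: (M u (vec (T + E i)) -
      a (T + E i) *: vec (T + E i + D)).
  have -> : \sum_(i <- r) x i T *: (M u (vec (T + E i)) - a (T + E i) *: vec (T + E i + D))
      = M u S - \sum_(i <- r) (x i T * a (T + E i)) *: vec (T + E i + D).
    rewrite act_sum -sumrB; apply: eq_bigr => i _.
    by rewrite scalerBr actrZ scalerA.
  by rewrite actDr actN addrA subrK.
apply: smD; first by apply/smA/vx.
by apply: smsum => i; apply/smZ/ua/tab_setD.
Qed.

Lemma shift_op_ext a a' D : (forall T, tab T -> a T = a' T) -> shift_op a D -> shift_op a' D.
Proof. by move=> aa'; apply: realized_ext => T /aa' ->. Qed.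

Lemma shift_opD a a' D : shift_op a D -> shift_op a' D -> shift_op (fun T => a T + a' T) D.
Proof.
move=> Ha Ha'; apply: realized_ext (realizedD Ha Ha') => T _.
by rewrite scalerDl.
Qed.

Lemma shift_op1 : shift_op (fun _ => 1) 0.
Proof. by exists 1 => T LT; rewrite act1 addr0 scale1r subrr; exact: sm0. Qed.

Lemma shift_op_cst x : shift_op (fun _ => x) 0.
Proof.
by apply: realized_ext (realizedZ x shift_op1) => T _; rewrite scalerA mulr1.
Qed.

Lemma shift_op_comp a a' D D' : tab_set (0 : tableau C n) D ->
  shift_op a D -> shift_op a' D' -> shift_op (fun T => a T * a' (T + D)) (D + D').
Proof.
move=> Dlat Ha Ha'.
have := @realized_comp a' D' _ [:: tt] (fun _ => a) (fun _ => D) Ha' (fun _ => Dlat).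
case=> [|u uP]; first by apply: realized_ext Ha => T _; rewrite big_seq1.
by exists u => T LT; have := uP T LT; rewrite big_seq1 addrA.
Qed.

Lemma shift_op_diagl a w D : shift_op w 0 -> shift_op a D ->
  shift_op (fun T => w T * a T) D.
Proof.
move=> Hw Ha; have := shift_op_comp (lat0 _ _) Hw Ha; rewrite add0r.
by apply: shift_op_ext => T _; rewrite addr0.
Qed.

(* Conjugation by the diagonal operator [w] multiplies the term of index [i0] by
   [x != 1] and fixes the other ones, so that term is isolated. *)
Lemma isolate_term (r : seq nat) (y : nat -> tableau C n -> C) (E : nat -> tableau C n)
    (w : tableau C n -> C) (x : C) i0 : uniq r -> i0 \in r -> x != 1 ->
  (forall i, tab_set (0 : tableau C n) (E i)) ->
  (forall T, tab T -> w T != 0) ->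
  (forall i T, i \in r -> tab T -> w (T + E i) = (if i == i0 then x else 1) * w T) ->
  shift_op w 0 -> shift_op (fun T => (w T)^-1) 0 ->
  realized (fun T => \sum_(i <- r) y i T *: vec (T + E i)) -> shift_op (y i0) (E i0).
Proof.
move=> ur i0r x1 Elat w0 wE Hw Hw' Hf.
have H1 := realized_comp Hw Elat Hf.
have H2 : realized (fun T => \sum_(i <- r) ((if i == i0 then x else 1) * y i T) *:
    vec (T + E i)).
  have [u uP] := H1; have [v vP] := Hw'; exists (u * v) => T LT.
  rewrite actM; set S := \sum_(i <- r) _.
  have -> : M u (M v (vec T)) - S = M u (M v (vec T) - (w T)^-1 *: vec (T + 0)) +
     (w T)^-1 *: (M u (vec T) - \sum_(i <- r) (y i T * w (T + E i)) *: vec (T + E i + 0)).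
    rewrite actDr actN actrZ addr0 -addrA; congr (_ + _).
    rewrite scalerBr addKr scaler_sumr; congr (- _).
    rewrite /S big_seq [RHS]big_seq; apply: eq_bigr => i ir.
    rewrite wE // addr0 scalerA; congr (_ *: _).
    by rewrite [RHS]mulrCA [_^-1 * _]mulrC mulfK ?w0 // mulrC.
  by apply: smD; [apply/smA/vP|apply/smZ/uP].
have H3 := realizedZ (x - 1)^-1 (realizedD H2 (realizedZ (-1) Hf)).
apply: realized_ext H3 => T LT; rewrite scaleN1r -sumrB (bigD1_seq i0) //= eqxx.
rewrite big1 ?addr0 => [|i /negPf->]; last by rewrite mul1r subrr.
rewrite -scalerBl -{2}[y i0 T]mul1r -mulrBl scalerA mulrA mulVf ?mul1r // subr_eq0.
by [].
Qed.

(** On [tab_set L] this is congruence modulo [d] of the entries in rows up to [k]. *)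
Definition same k T T' := forall i j, (i <= k)%N -> Y T i j = Y T' i j.

Definition respects k (f : tableau C n -> C) :=
  forall T T', tab T -> tab T' -> same k T T' -> f T = f T'.

Definition all_diag k := forall f, respects k f -> shift_op f 0.

Definition all_shifts k := forall b i j, (0 < j <= i)%N -> (i <= k)%N ->
  shift_op (fun _ => 1) (step b i j).

Lemma sameS k k' T T' : (k <= k')%N -> same k' T T' -> same k T T'.
Proof. by move=> kk' s i j ik; apply: s; apply: leq_trans kk'. Qed.

Lemma same_sym k T T' : same k T T' -> same k T' T.
Proof. by move=> s i j ik; rewrite s. Qed.

Lemma qstep_neq1 b : qstep q b != 1.
Proof.
have q1 : q != 1 by apply: contraNneq q2 => ->; rewrite invr1 subrr.
by case: b; rewrite //= invr_eq1.
Qed.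

(** The conjugating operator is [Y T k j] itself: among the moves in row [k], only that of entry [j]
    changes it, by [qstep q b]. *)
Lemma isolate_op b k j : (0 < k < n)%N -> (0 < j < k.+1)%N -> all_diag k ->
  shift_op (fun T => g b T k j) (step b k j).
Proof.
move=> kn jk dk; have /andP[k0 kn'] := kn.
have wk : respects k (fun T => Y T k j) by move=> T T' _ _; apply.
apply: (@isolate_term (index_iota 1 k.+1) (fun j T => g b T k j) (fun j => step b k j)
  (fun T => Y T k j) (qstep q b) j).
- exact: iota_uniq.
- by rewrite mem_index_iota.
- exact: qstep_neq1.
- by move=> i; apply: lat_step.
- by move=> T _; apply: tab_point_neq0.
- move=> i T; rewrite mem_index_iota => ik LT.
  rewrite (tab_point_step hh _ _ ik (ltnW kn')) /mv eqxx eq_sym /=.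
  by case: eqVneq => [->|]; rewrite ?mul1r.
- exact: dk.
- by apply: dk => T T' LT LT' s; rewrite (wk T T').
- have [u uP] := act_op b kn; exists u => T LT.
  by rewrite uP // subrr; exact: sm0.
Qed.

(** There are no positions in row 0, so a function respecting it is constant on [tab_set L]. *)
Lemma all_diag0 : all_diag 0.
Proof.
move=> f f0; apply: (shift_op_ext _ (shift_op_cst (f L))) => T LT.
apply: f0 => //; first exact: tab_set_refl.
move=> i j; rewrite leqn0 => /eqP ->; congr (qp _); rewrite /entry.
by case: pickP => // x /andP[/eqP x0 _]; have := valP x; rewrite -/(row_ x) x0; case: (val x).2 => -[].
Qed.

(** The parity of [d] enters here: a number whose square and whose [d]-th power are both 1 is 1 when
    [d] is odd. *)
Lemma q_odd_root (m : int) : (q ^ m) ^+ 2 = 1 -> q ^ m = 1.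
Proof.
move=> e; have : (q ^ m) ^+ d = 1.
  by rewrite exprnP exprz_exp mulrC -exprz_exp -exprnP (prim_expr_order hq) exp1rz.
rewrite -[d]odd_double_half hd_odd exprD expr1 -mul2n exprM e expr1n mulr1 //.
Qed.

Lemma gtop_eq T T' k x : (forall l, Y T k l = Y T' k l) ->
  gtop c (Y T) k x = gtop c (Y T') k x.
Proof. by move=> e; apply: eq_bigr => l _; rewrite e. Qed.

Lemma gden_eq T T' k j : (forall l, Y T k l = Y T' k l) ->
  gden c (Y T) k j = gden c (Y T') k j.
Proof. by move=> e; apply: eq_bigr => l _; rewrite !e. Qed.

Lemma row_prod_eq T T' k : (forall l, Y T k l = Y T' k l) ->
  row_prod (Y T) k = row_prod (Y T') k.
Proof. by move=> e; apply: eq_bigr => l _; rewrite e. Qed.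

Lemma gden_neq0 T k j : tab T -> (0 < k <= n)%N -> (0 < j < k.+1)%N ->
  gden c (Y T) k j != 0.
Proof.
move=> LT kn jk; rewrite /gden big_seq_cond prodf_seq_neq0; apply/allP => l lr.
apply/implyP; rewrite lr => /= lj; rewrite br_neq0 ?tab_point_neq0 //.
have := row_generic_step hh hL true LT kn (i := l) (j := j).
by rewrite -mem_index_iota lr jk => /(_ isT isT lj)[].
Qed.

(* Apply e_k, shift the entry (k,j) back, and clear the denominator, which only
   depends on row k. *)
Lemma gtop_realized k j : (0 < k < n)%N -> (0 < j < k.+1)%N ->
  all_diag k -> all_shifts k ->
  shift_op (fun T => gtop c (Y T) k.+1 (Y T k j)) 0.
Proof.
move=> kn jk dk sk; have /andP[k0 kn'] := kn.
have E := shift_op_comp (@lat_step R n true k j kn') (isolate_op true kn jk dk)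
  (sk false k j jk (leqnn k)).
rewrite /tab_step subrr in E.
have G : shift_op (fun T => gden c (Y T) k j) 0.
  by apply: dk => T T' _ _ s; apply: gden_eq => l; apply: s.
apply: shift_op_ext (shift_op_diagl G E) => T LT.
rewrite mulr1 mulrC /gcoef -/(gtop _ _ _ _) -/(gden _ _ _ _) divfK //.
by apply: gden_neq0; rewrite // k0 ltnW.
Qed.

Lemma weight_realized k : (0 < k <= n)%N -> shift_op (fun T => qp (gt_weight T k)) 0.
Proof.
by move=> /act_weight[u uP]; exists u => T LT; rewrite uP // addr0 subrr; exact: sm0.
Qed.

(* Two rows with the same entries up to integers, the same product, and the same
   values of [gtop] at the nodes of the row below, are equal: the monic polynomials
   with roots [Y T k.+1 l ^+ 2] agree at 0 and at [k] further points. *)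
Lemma row_separation T T' k : tab T -> tab T' -> (k < n)%N ->
  (forall j, Y T k j = Y T' k j) ->
  row_prod (Y T) k.+1 = row_prod (Y T') k.+1 ->
  (forall j, (0 < j < k.+1)%N ->
     gtop c (Y T) k.+1 (Y T k j) = gtop c (Y T') k.+1 (Y T k j)) ->
  forall j, Y T k.+1 j = Y T' k.+1 j.
Proof.
move=> LT LT' kn eqk eqprod eqtop.
pose P (S : tableau C n) : {poly C} :=
  \prod_(1 <= l < k.+2) ('X - (Y S k.+1 l ^+ 2)%:P).
have Pmon (S : tableau C n) : P S \is monic.
  by rewrite /P big_seq monic_prod // => l _; exact: monicXsubC.
have sP (S : tableau C n) : size (P S) = k.+2.
  by rewrite size_prod_XsubC size_iota subn1.
pose s := 0 :: [seq Y T k j ^+ 2 | j <- index_iota 1 k.+1].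
have PS (S : tableau C n) x : (P S).[x] = \prod_(1 <= l < k.+2) (x - Y S k.+1 l ^+ 2).
  by rewrite horner_prod; apply: eq_bigr => l _; rewrite hornerXsubC.
have topE (S : tableau C n) x : x != 0 ->
    gtop c (Y S) k.+1 x * ((- c * x) ^+ k.+1 * row_prod (Y S) k.+1) = (P S).[x ^+ 2].
  move=> x0; rewrite PS /gtop -[X in _ ^+ X](subn1 k.+2) -prodr_const_nat -!big_split /=.
  by apply: eq_bigr => l _; rewrite br_mul ?tab_point_neq0.
have PP : P T = P T'.
  apply/eqP; rewrite -subr_eq0; apply/eqP; apply: (@roots_geq_poly_eq0 _ _ s).
  - apply/allP => x; rewrite inE /root !hornerE => /orP[/eqP ->|/mapP[j]].
      have zero (S : tableau C n) : (P S).[0] =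
          (\prod_(1 <= l < k.+2) -1) * row_prod (Y S) k.+1 ^+ 2.
        rewrite PS expr2 -!big_split /=; apply: eq_bigr => l _.
        by rewrite sub0r mulN1r expr2.
      by rewrite !zero eqprod subrr.
    rewrite mem_index_iota => jk ->.
    by rewrite -!topE ?tab_point_neq0 // eqprod eqtop // subrr.
  - rewrite /= map_inj_in_uniq ?iota_uniq ?andbT.
      by apply/mapP => -[j _ /esym/eqP]; rewrite expf_eq0 /= (negPf (tab_point_neq0 _ _ _ _)).
    move=> i j; rewrite !mem_index_iota => ik jk eij; apply/eqP; apply: contraT => ij.
    have kn1 : (0 < k <= n)%N by rewrite (ltnW kn) andbT; case: (k) ik; case: (i).
    by have [] := row_generic_step hh hL true LT kn1 ik jk ij; rewrite eij eqxx.
  (* Both polynomials are monic of degree [k.+1], so their difference has degree at most [k], less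
     than the number of nodes. *)
  - rewrite /= size_map size_iota subn1 /=; apply/leq_sizeP => i.
    rewrite coefB leq_eqVlt => /orP[/eqP <-|ik]; last first.
      by rewrite !nth_default ?sP ?subrr.
    have lead (S : tableau C n) : (P S)`_k.+1 = 1.
      by have /monicP := Pmon S; rewrite lead_coefE sP.
    by rewrite !lead subrr.
move=> l; have [lk|lk] := boolP (0 < l < k.+2)%N; last first.
  have out (S : tableau C n) : entry S k.+1 l = 0.
    rewrite /entry; case: pickP => // x /andP[/eqP xr /eqP xc].
    by have := valP x; rewrite -/(row_ x) -/(col_ x) xr xc -ltnS (negPf lk).
  by rewrite /tab_point !out.
(* Equality of polynomials matches the rows only up to a permutation and only in squares. Genericity
   excludes [l' != l], since corresponding entries of [T] and [T'] differ by integers, and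
   [q_odd_root] removes the square. *)
have [m1 e1] := entry_int k.+1 l LT; have [m2 e2] := entry_int k.+1 l LT'.
have YE : Y T' k.+1 l = q ^ (m2 - m1) * Y T k.+1 l.
  rewrite /tab_point -(qpow_int hh) -qpowD e1 e2 intrB; congr (qp _).
  by rewrite addrC addrA addrAC subrK addrC.
have : (P T).[Y T' k.+1 l ^+ 2] == 0.
  rewrite PP PS prodf_seq_eq0; apply/hasP; exists l; rewrite ?mem_index_iota //=.
  by rewrite subrr.
rewrite PS prodf_seq_eq0 => /hasP[l']; rewrite mem_index_iota /= => lk'.
rewrite subr_eq0 YE; have [<-|ll'] := eqVneq l l'; last first.
  have kn1 : (0 < k.+1 <= n)%N by [].
  by rewrite (negPf (tab_point_generic hh hL (m2 - m1) LT kn1 lk lk' ll')).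
rewrite exprMn -[X in _ == X]mul1r (inj_eq (mulIf _)) ?expf_neq0 ?tab_point_neq0 //.
by move=> /eqP/q_odd_root ->; rewrite mul1r.
Qed.

(** Finitely many tableaux meeting all classes modulo [d], as the interpolation requires. *)
Variable reps : seq (tableau C n).
Hypothesis reps_tab : all_in tab reps.
Hypothesis reps_cover : forall T, tab T -> ~ all_in (fun S => ~ same n T S) reps.

Lemma all_diagS k : (k < n)%N -> all_diag k -> all_shifts k -> all_diag k.+1.
Proof.
move=> kn dk sk f fk.
pose A (f : tableau C n -> C) := respects k.+1 f /\ shift_op f 0.
suff [] : A f by [].
apply: (@separating_interpolation _ _ tab (same k.+1) A _ _ _ _ _ _ reps f) => //.
- move=> f1 f2 e [r1 s1]; split; last exact: shift_op_ext s1.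
  by move=> T T' LT LT' s; rewrite -!e //; apply: r1.
- by move=> a; split=> [T T' _ _ _|] //; apply: shift_op_cst.
- move=> f1 f2 [r1 s1] [r2 s2]; split; last exact: shift_opD.
  by move=> T T' LT LT' s; rewrite (r1 _ _ LT LT' s) (r2 _ _ LT LT' s).
- move=> f1 f2 [r1 s1] [r2 s2]; split; last exact: shift_op_diagl.
  by move=> T T' LT LT' s; rewrite (r1 _ _ LT LT' s) (r2 _ _ LT LT' s).
- by move=> f1 T T' [r1 _] LT LT' s; apply: r1.
(* Separation by contraposition: all functions of [A] are assumed to agree at [T] and [T']. The
   indicator of the class of [T] in rows up to [k] is among them, which settles these rows. *)
- move=> T T' LT LT'; apply: contra_notP => nsep.
  have sep f1 : A f1 -> f1 T = f1 T'.
    by move=> A1; apply/eqP; apply: contra_notT nsep => ne; exists f1.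
  have sk' : same k T T'.
    apply: contrapT => nk; pose f1 S : C := (`[< same k T S >])%:R.
    have r1 : respects k f1.
      move=> S S' _ _ ss; congr (_%:R); congr nat_of_bool; apply/asboolP/asboolP => sT i j ik.
        by rewrite sT // ss.
      by rewrite sT // ss.
    have A1 : A f1.
      split; last exact: dk.
      by move=> S S' LS LS' ss; apply: r1 => //; apply: sameS ss.
    have := sep f1 A1; rewrite /f1 (asboolF nk) asboolT ?mulr1n // => /eqP.
    by rewrite oner_eq0.
  suff rowk : forall j, Y T k.+1 j = Y T' k.+1 j.
    move=> i j; rewrite leq_eqVlt => /orP[/eqP -> //|]; exact: sk'.
  apply: (@row_separation T T' k) => //.
  + by move=> j; apply: sk'.
  (* Up to a power of [q] this is the product of row [k.+1] divided by that of row [k], and row [k]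
     already agrees. *)
  + have Aw : A (fun S => qp (gt_weight S k.+1)).
      split; last exact: weight_realized.
      move=> S S' _ _ ss; rewrite !(qpow_gt_weight hh) //=.
      by congr (_ / _ * _); apply: row_prod_eq => l; apply: ss.
    have := sep _ Aw; rewrite !(qpow_gt_weight hh) //=.
    rewrite (@row_prod_eq T T' k) => [|l]; last exact: sk'.
    by move/mulIf; rewrite expf_neq0 // => /(_ isT)/mulIf -> //;
       rewrite invr_eq0 row_prod_neq0.
  + move=> j jk.
    have kn' : (0 < k < n)%N by rewrite kn andbT; case: (k) jk; case: (j).
    have At : A (fun S => gtop c (Y S) k.+1 (Y S k j)).
      split; last exact: gtop_realized.
      move=> S S' _ _ ss; rewrite ss //; apply: gtop_eq => l; exact: ss.
    by rewrite (sep _ At) -sk'.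
- by move=> T T'; apply: same_sym.
- move=> T LT H; apply: (reps_cover LT); apply: all_in_sub H => S nS sS; apply: nS.
  exact: sameS sS.
Qed.

(** Indicator that the entry [(k, i)] does not annihilate the coefficient of [f_(k+1)] at [j]. *)
Definition chi T k j i : C := (br c (Y T k i) (Y T k.+1 j) != 0)%:R.

(** The coefficient involves only rows [k] and [k.+1], so its inverse, extended by 0 at its zeros,
    is an available diagonal operator. It normalizes the isolated term of [f_(k+1)] to 1 off these
    zeros. *)
Lemma shift_lower_gtop k j : (k.+1 < n)%N -> (0 < j < k.+2)%N -> all_diag k.+1 ->
  shift_op (fun T => \prod_(1 <= i < k.+1) chi T k j i) (step false k.+1 j).
Proof.
move=> kn jk dk; have kn1 : (0 < k.+1 < n)%N by [].
have kn2 : (0 < k.+1 <= n)%N by apply: ltnW.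
pose w T : C := if gtop c (Y T) k (Y T k.+1 j) == 0 then 0
  else gden c (Y T) k.+1 j / gtop c (Y T) k (Y T k.+1 j).
have Hw : shift_op w 0.
  apply: dk => T T' _ _ s; rewrite /w (s k.+1 j) // (@gtop_eq T T') => [|l].
    by rewrite (@gden_eq T T') // => l; apply: s.
  exact: s.
apply: shift_op_ext (shift_op_diagl Hw (isolate_op false kn1 jk dk)) => T LT.
have top0 : (gtop c (Y T) k (Y T k.+1 j) == 0) =
    has (fun i => br c (Y T k i) (Y T k.+1 j) == 0) (index_iota 1 k.+1).
  by rewrite /gtop prodf_seq_eq0.
have -> : \prod_(1 <= i < k.+1) chi T k j i = (gtop c (Y T) k (Y T k.+1 j) != 0)%:R.
  rewrite top0; elim: (index_iota 1 k.+1) => [|i s IH]; first by rewrite big_nil.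
  by rewrite big_cons IH /chi /= negb_or; case: (br _ _ _ == 0); rewrite ?mul0r ?mul1r.
rewrite /w /gcoef /= -/(gtop _ _ _ _) -/(gden _ _ _ _).
case: eqP => [_|/eqP t0]; first by rewrite mul0r.
by rewrite mulf_div [X in X / _]mulrC divff // mulf_neq0 // gden_neq0.
Qed.

(* Where a factor of the coefficient of f_(k+1) vanishes, it does not vanish after
   the entry (k,i) is raised by one. *)
Lemma shift_lower k j : (k.+1 < n)%N -> (0 < j < k.+2)%N -> all_diag k.+1 ->
  all_shifts k -> shift_op (fun _ => 1) (step false k.+1 j).
Proof.
move=> kn jk dk sk.
(* The factors [chi] are removed one at a time; [s] counts those already gone. *)
have step_i s : (s <= k)%N ->
    shift_op (fun T => \prod_(s.+1 <= i < k.+1) chi T k j i) (step false k.+1 j).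
  elim: s => [_|s IH sk1]; first exact: shift_lower_gtop.
  have {}IH := IH (ltnW sk1).
  have si : (0 < s.+1 <= k)%N by [].
  have kn' : (k < n)%N by rewrite ltnW.
  have up := sk true k s.+1 si (leqnn k); have down := sk false k s.+1 si (leqnn k).
  have H := shift_op_comp (@lat_step R n true k s.+1 kn') up
    (shift_op_comp (@lat_step R n false k.+1 j kn) IH down).
  have e : step true k s.+1 + (step false k.+1 j + step false k s.+1) = step false k.+1 j.
    by rewrite addrCA /tab_step subrr addr0.
  rewrite {}e in H.
  have Hc : shift_op (fun T => 1 - chi T k j s.+1) 0.
    by apply: dk => T T' _ _ ss; rewrite /chi !ss.
  (* Where [chi] is 1 the operator of the previous stage is kept; where it is 0 its conjugate by the
     shift of [(k, s.+1)] takes over. The remaining factors do not involve that entry. *)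
  apply: shift_op_ext (shift_opD IH (shift_op_diagl Hc H)) => T LT.
  rewrite mul1r mulr1 big_ltn // [X in _ + _ * X]big_ltn //.
  rewrite [X in _ + _ * (_ * X)](eq_big_nat _ _ (F2 := chi T k j)); last first.
    move=> i /andP[si' _]; rewrite /chi (tab_point_step hh _ _ si (ltnW kn')).
    by rewrite mv_col ?gtn_eqF // mv_row // neq_ltn ltnSn orbT.
  rewrite mulrA -mulrDl [X in X * _](_ : _ = 1) ?mul1r //.
  rewrite /chi; case: eqP => [/eqP b0|_] /=; last by rewrite subrr mul0r addr0.
  rewrite subr0 mul1r add0r (tab_point_step hh _ _ si (ltnW kn')) mv_same.
  rewrite mv_row ?neq_ltn ?ltnSn ?orbT // br_neq0 ?tab_point_neq0 //; last first.
    by rewrite mulf_neq0 ?tab_point_neq0.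
  have e : Y T k s.+1 ^+ 2 = Y T k.+1 j ^+ 2.
    by apply/eqP; apply: contraTT b0; rewrite -(@br_neq0 _ c) ?tab_point_neq0.
  rewrite exprMn -e -[X in _ != X]mul1r (inj_eq (mulIf _)) ?expf_neq0 ?tab_point_neq0 //.
  have -> : q ^+ 2 != 1; last by [].
  by apply: contraNneq q2; rewrite expr2 => /mulr1_eq ->; rewrite subrr.
by apply: shift_op_ext (step_i k (leqnn k)) => T _; rewrite big_geq.
Qed.

Lemma shift_lowerMn i j m : (i < n)%N -> shift_op (fun _ => 1) (step false i j) ->
  shift_op (fun _ => 1) (step false i j *+ m).
Proof.
move=> iN H; elim: m => [|m IH]; first by rewrite mulr0n; exact: shift_op1.
rewrite mulrS; apply: shift_op_ext (shift_op_comp (@lat_step R n false i j iN) H IH) => T _.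
by rewrite mulr1.
Qed.

Lemma shift_raise i j : (0 < j <= i)%N -> (i < n)%N ->
  shift_op (fun _ => 1) (step false i j) -> shift_op (fun _ => 1) (step true i j).
Proof.
move=> ji iN /(shift_lowerMn d.-1 iN) H.
have iN' : (i <= n.-1)%N by case: (n) iN.
have [x [xi xj]] := pos_of ji iN'.
apply: realized_mod (realizedZ (p x) H) => T LT; rewrite !scale1r.
have d0 := prim_order_gt0 hq.
have LT' : tab (T + step false i j *+ d.-1).
  by apply: tab_setD => //; apply/latMn/lat_step.
have := relN x LT'; rewrite xi xj => /smN; rewrite opprB.
rewrite -addrA (_ : step false i j *+ d.-1 + _ = step true i j) //.
by rewrite /tab_step mulNrn -[X in _ + _ *+ X](prednK d0) mulrSr addKr.
Qed.

Lemma all_shiftsS k : (k.+1 < n)%N -> all_diag k.+1 -> all_shifts k -> all_shifts k.+1.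
Proof.
move=> kn dk sk b i j ji; rewrite leq_eqVlt => /orP[/eqP e|]; last exact: sk.
rewrite e in ji *; have low := shift_lower kn ji dk sk.
by case: b => //; apply: shift_raise.
Qed.

Lemma all_realized k : (k < n)%N -> all_diag k /\ all_shifts k.
Proof.
elim: k => [_|k IH kn].
  by split=> [|b i j /andP[j0 ji] i0]; [exact: all_diag0|move: j0 ji i0; case: i => //; case: j].
have [dk sk] := IH (ltnW kn); have dk' := all_diagS (ltnW kn) dk sk.
by split=> //; apply: all_shiftsS.
Qed.

(** * Irreducibility, basis and spanning in the quotient *)

Lemma to_quot0 : to_quot N 0 = 0.
Proof. by apply: (addrI (to_quot N 0)); rewrite -to_quotD !addr0. Qed.

Lemma to_quotZ x v : to_quot N (x *: v) = x *: to_quot N v.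
Proof. by rewrite -quot_scaleE. Qed.

Lemma to_quot_eq0 v : to_quot N v = 0 <-> N v.
Proof. by rewrite -to_quot0 to_quotP subr0. Qed.

Lemma to_quot_sum (I : Type) (r : seq I) (v : I -> V) :
  to_quot N (\sum_(i <- r) v i) = \sum_(i <- r) to_quot N (v i).
Proof. exact: (big_morph (to_quot N) (@to_quotD _ _ _ M N) to_quot0). Qed.

(** A nonzero submodule contains a combination of the [S m] with a nonzero coefficient. A diagonal
    projector isolates that one tableau, and the shifts carry it to all the others, which span. *)
Lemma quot_irreducible (I : finType) (S : I -> tableau C n) : (0 < n)%N ->
  (forall m, tab (S m)) -> (forall m m', same n.-1 (S m) (S m') -> m = m') ->
  (forall v, exists x : I -> C, N (v - \sum_m x m *: vec (S m))) ->
  (forall m m', shift_op (fun _ => 1) (S m' - S m)) ->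
  (exists v, ~ N v) -> irreducible_module (quot_module N).
Proof.
move=> n0 Stab Ssame Sspan Smove [v0 Nv0]; split.
  by exists (to_quot N v0) => /to_quot_eq0.
move=> N'; have [z|nz] := pselect (forall v, N' v -> v = 0); [by left|right].
pose P v := N' (to_quot N v).
have PD v w : P v -> P w -> P (v + w) by rewrite /P to_quotD; apply: smD.
have PZ x v : P v -> P (x *: v) by rewrite /P to_quotZ; apply: smZ.
have PA u v : P v -> P (M u v) by rewrite /P -quot_actE; apply: smA.
have PN v : N v -> P v by move=> /to_quot_eq0; rewrite /P => ->; apply: sm0.
have PE v w : N (v - w) -> P v -> P w.
  move=> /smN/PN; rewrite opprB => Pwv Pv.
  by rewrite -[w](subrK v); apply: PD.
have [v Pv Nv] : exists2 v, P v & ~ N v.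
  apply: contrapT => none; apply: nz => v N'v; rewrite -[v]quot_reprK.
  apply/to_quot_eq0; apply: contrapT => Nv; apply: none; exists (quot_repr v) => //.
  by rewrite /P quot_reprK.
have [x vx] := Sspan v.
have [m0 xm0] : exists m0, x m0 != 0.
  apply: contrapT => x0; apply: Nv; move: vx; rewrite big1 ?subr0 // => m _.
  have -> : x m = 0 by apply/eqP; apply: contra_notT x0 => xm; exists m.
  by rewrite scale0r.
have n1 : (n.-1 < n)%N by rewrite prednK.
have [diag _] := all_realized n1.
have Pm0 : P (vec (S m0)).
  (* The projector onto the class of [S m0]; by [Ssame] it kills every other representative. *)
  pose f T : C := (`[< same n.-1 (S m0) T >])%:R.
  have [u uP] : shift_op f 0.
    apply: diag => T T' _ _ ss; congr (_%:R); congr nat_of_bool.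
    apply/asboolP/asboolP => sT i j ik; first by rewrite sT // ss.
    by rewrite sT // ss.
  suff : P (x m0 *: vec (S m0)).
    by move/(PZ (x m0)^-1); rewrite scalerA mulVf // scale1r.
  have : P (\sum_m x m *: M u (vec (S m))).
    have -> : \sum_m x m *: M u (vec (S m)) = M u (\sum_m x m *: vec (S m)).
      by rewrite act_sum; apply: eq_bigr => m _; rewrite actrZ.
    exact/PA/(PE _ _ vx).
  apply: PE; rewrite (bigD1 m0) //= addrAC -scalerBr.
  apply: smD.
    apply: smZ; have := uP _ (Stab m0); rewrite addr0 /f asboolT ?scale1r //.
  elim/big_rec: _ => [|m w mm0 Nw]; first exact: sm0.
  apply: smD => //; apply: smZ; have := uP _ (Stab m).
  rewrite /f asboolF ?scale0r ?subr0 // => /Ssame e.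
  by rewrite e eqxx in mm0.
have Pm m : P (vec (S m)).
  have [u /(_ _ (Stab m0))] := Smove m0 m; rewrite [S m0 + _]addrC subrK scale1r => uN.
  by apply: PE uN _; apply: PA.
move=> w; rewrite -[w]quot_reprK; have [y yP] := Sspan (quot_repr w).
suff : P (\sum_m y m *: vec (S m)).
  by apply: PE; rewrite -opprB; apply: smN.
elim/big_rec: _ => [|m v1 _]; first by apply/PN/sm0.
by apply: PD; apply: PZ.
Qed.

(** The functionals [f] are a dual family to [b] that descends to the quotient, which gives
    independence. *)
Lemma quot_basis (I : finType) (b : I -> V) (f : I -> V -> C) :
  (forall m v w, f m (v + w) = f m v + f m w) ->
  (forall m (a : C) v, f m (a *: v) = a * f m v) ->
  (forall m v, N v -> f m v = 0) ->
  (forall m m', f m (b m') = (m == m')%:R) ->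
  (forall v, exists a : I -> C, N (v - \sum_m a m *: b m)) ->
  is_basis (fun m => to_quot N (b m)).
Proof.
move=> fD fZ fN fb span.
have to_quot_comb (a : I -> C) :
    \sum_m a m *: to_quot N (b m) = to_quot N (\sum_m a m *: b m).
  by rewrite to_quot_sum; apply: eq_bigr => m _; rewrite to_quotZ.
split=> [a|v]; last first.
  have [a aN] := span (quot_repr v); exists a.
  by rewrite to_quot_comb -[v]quot_reprK; apply/to_quotP.
rewrite to_quot_comb => /to_quot_eq0 aN m; have := fN m _ aN.
have f0 : f m 0 = 0 by rewrite -(scale0r (0 : V)) fZ mul0r.
rewrite (big_morph (f m) (fD m) f0) (bigD1 m) //= fZ fb eqxx mulr1 big1 ?addr0 //.
by move=> m' /negPf ne; rewrite fZ fb eq_sym ne mulr0.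
Qed.

Definition approx T T' := exists x, N (vec T - x *: vec T').

Lemma approx_refl T : approx T T.
Proof. by exists 1; rewrite scale1r subrr; exact: sm0. Qed.

Lemma approx_trans T1 T2 T3 : approx T1 T2 -> approx T2 T3 -> approx T1 T3.
Proof.
move=> [x Nx] [y Ny]; exists (x * y); rewrite -scalerA.
have -> : vec T1 - x *: (y *: vec T3) =
    (vec T1 - x *: vec T2) + x *: (vec T2 - y *: vec T3).
  by rewrite scalerBr addrA subrK.
by apply: smD => //; apply: smZ.
Qed.

Local Notation dlt x := (delta_tab n (row_ x) (col_ x) : tableau C n).

Lemma row_lt (x : pos n.-1) : (0 < n)%N -> (row_ x < n)%N.
Proof. by case: n x => // n' x _; exact: ltn_ord. Qed.

(** For negative [t] the relation is read backwards, dividing by [p x]. *)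
Lemma approx_period T (x : pos n.-1) (t : int) : (forall x, p x != 0) -> (0 < n)%N ->
  tab T -> approx (T + dlt x *+ d *~ t) T.
Proof.
move=> p0 n0 LT; have xn := row_lt x n0.
have lt m : tab_set (0 : tableau C n) (dlt x *+ d *+ m).
  by apply/latMn/latMn/lat_delta.
case: t => m; rewrite ?NegzE ?mulrNz -pmulrn; elim: m => [|m IH].
- by rewrite mulr0n addr0; exact: approx_refl.
- apply: approx_trans IH; exists (p x); rewrite mulrSr addrA; apply: relN.
  exact: tab_setD.
- exists (p x)^-1; have LT' : tab (T - dlt x *+ d).
    by apply: tab_setD => //; apply/latN/(lt 1%N).
  have := smZ (- (p x)^-1) (relN x LT'); rewrite subrK mulr1n.
  by rewrite scalerBr scalerA mulNr mulVf // scaleNr scaleN1r opprK addrC.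
- apply: approx_trans IH; exists (p x)^-1.
  have LT' : tab (T - dlt x *+ d *+ m.+2).
    by apply: tab_setD => //; apply/latN/lt.
  have := smZ (- (p x)^-1) (relN x LT').
  rewrite scalerBr scalerA mulNr mulVf // scaleNr scaleN1r opprK addrC.
  by rewrite -(addrA T) [dlt x *+ d *+ m.+2]mulrSr opprD addrNK.
Qed.

Lemma approx_periods T (t : pos n.-1 -> int) : (forall x, p x != 0) -> (0 < n)%N ->
  tab T -> approx (T + \sum_x dlt x *+ d *~ t x) T.
Proof.
move=> p0 n0 LT.
suff [] : tab (T + \sum_x dlt x *+ d *~ t x) /\ approx (T + \sum_x dlt x *+ d *~ t x) T by [].
elim/big_rec: _ => [|x D _ [LD aD]]; first by rewrite addr0; split=> //; apply: approx_refl.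
rewrite [_ + D]addrC addrA; split; last first.
  by apply: approx_trans aD; apply: approx_period.
apply: tab_setD => //; have xn := row_lt x n0.
by case: (t x) => m; rewrite ?NegzE ?mulrNz -pmulrn ?latN //; do ?apply: latN; do 2 apply: latMn;
  apply: lat_delta.
Qed.

Lemma approx_span (I : finType) (S : I -> tableau C n) :
  (forall P : V -> Prop, P 0 ->
    (forall (b : C) T v, tab T -> P v -> P (b *: vec T + v)) -> forall v, P v) ->
  (forall T, tab T -> exists m, approx T (S m)) ->
  forall v, exists a : I -> C, N (v - \sum_m a m *: vec (S m)).
Proof.
move=> span rep; elim/span => [|b T v LT [a va]].
  exists (fun _ => 0); rewrite big1 ?subrr => [|m _]; [exact: sm0|exact: scale0r].
have [m0 [y yN]] := rep T LT.
exists (fun m => a m + b * y * (m == m0)%:R).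
have -> : \sum_m (a m + b * y * (m == m0)%:R) *: vec (S m) =
    \sum_m a m *: vec (S m) + b *: (y *: vec (S m0)).
  rewrite scalerA; under eq_bigr do rewrite scalerDl.
  rewrite big_split /=; congr (_ + _); rewrite (bigD1 m0) //= eqxx mulr1.
  by rewrite big1 ?addr0 // => m /negPf ->; rewrite mulr0 scale0r.
rewrite [b *: _ + v]addrC opprD addrACA -scalerBr.
by apply: smD => //; apply: smZ.
Qed.

Lemma shift_sum (m : pos n.-1 -> nat) b : (0 < n)%N ->
  shift_op (fun _ => 1) (\sum_x step b (row_ x) (col_ x) *+ m x) /\
  tab_set (0 : tableau C n) (\sum_x step b (row_ x) (col_ x) *+ m x).
Proof.
move=> n0; have n1 : (n.-1 < n)%N by rewrite prednK.
have [_ sk] := all_realized n1.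
pose G D := shift_op (fun _ => 1) D /\ tab_set (0 : tableau C n) D.
have G0 : G 0 by split; [exact: shift_op1|exact: lat0].
have GD D D' : G D -> G D' -> G (D + D').
  move=> [s1 l1] [s2 l2]; split; last exact: tab_setD.
  by apply: shift_op_ext (shift_op_comp l1 s1 s2) => T _; rewrite mulr1.
have Gs (x : pos n.-1) : G (step b (row_ x) (col_ x)).
  split; last exact/lat_step/row_lt.
  by apply: sk; [exact: (valP x)|rewrite -ltnS ltn_ord].
change (G (\sum_x step b (row_ x) (col_ x) *+ m x)).
elim/big_rec: _ => // x D _ GD'; apply: (GD) => //.
by elim: (m x) => [|k IH]; rewrite ?mulr0n ?mulrS //; apply: GD.
Qed.
End Realization.

(** * The quotient module *)

Section Offsets.
Variables (R : realType) (n : nat) (L : tableau R[i] n).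
Local Notation C := R[i].
Local Notation dlt x := (delta_tab n (row_ x) (col_ x) : tableau C n).
Hypothesis n0 : (0 < n)%N.
Implicit Types (T : tableau C n) (x : pos n.-1).

(** Chosen classically, with the irrelevant default 0 outside [tab_set L]; on [tab_set L] it is
    unique because integers embed in [C]. *)
Definition offset T x : int :=
  xget 0 [set m : int | entry T (row_ x) (col_ x) = entry L (row_ x) (col_ x) + m%:~R]%classic.

Lemma offsetP T x : tab_set L T ->
  entry T (row_ x) (col_ x) = entry L (row_ x) (col_ x) + (offset T x)%:~R.
Proof.
move=> LT; rewrite /offset; case: xgetP => [y _ //|no].
by have [m e] := entry_int (row_ x) (col_ x) LT; case: (no m).
Qed.

Lemma offset_unique T x (m : int) : tab_set L T ->
  entry T (row_ x) (col_ x) = entry L (row_ x) (col_ x) + m%:~R -> offset T x = m.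
Proof. by move=> LT; rewrite (offsetP x LT) => /addrI/intr_inj. Qed.

Lemma entry_dlt x x' : entry (dlt x) (row_ x') (col_ x') = (x == x')%:R.
Proof.
rewrite entry_delta; [|exact: (valP x)|exact/ltnW/row_lt].
congr (nat_of_bool _)%:R; apply/andP/eqP => [[/eqP e /eqP e']|->]; last by rewrite !eqxx.
exact: pos_eqP.
Qed.

Lemma entry_sum (I : Type) (r : seq I) (f : I -> tableau C n) i j :
  entry (\sum_(k <- r) f k) i j = \sum_(k <- r) entry (f k) i j.
Proof.
apply: (big_morph (fun T => entry T i j)) => [T T'|]; first exact: entryD.
by apply: (addrI (entry (0 : tableau C n) i j)); rewrite -entryD !addr0.
Qed.

Lemma entryMn T m i j : entry (T *+ m) i j = entry T i j *+ m.
Proof.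
elim: m => [|m IH]; last by rewrite !mulrS entryD IH.
by apply: (addrI (entry (0 : tableau C n) i j)); rewrite -entryD !addr0.
Qed.

Lemma entryMz T (m : int) i j : entry (T *~ m) i j = entry T i j *~ m.
Proof. by case: m => m; rewrite ?NegzE ?mulrNz -!pmulrn ?entryN entryMn. Qed.

Lemma lat_sumMz (t : pos n.-1 -> int) : tab_set (0 : tableau C n) (\sum_x dlt x *~ t x).
Proof.
apply: lat_sum => x; case: (t x) => m; rewrite ?NegzE ?mulrNz -!pmulrn; try apply: latN;
  by apply/latMn/lat_delta/row_lt.
Qed.

Lemma entry_sumMz (t : pos n.-1 -> int) x :
  entry (\sum_x dlt x *~ t x) (row_ x) (col_ x) = (t x)%:~R.
Proof.
rewrite entry_sum (bigD1 x) //= entryMz entry_dlt eqxx big1 ?addr0 // => x' /negPf ne.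
by rewrite entryMz entry_dlt ne mul0rz.
Qed.

Lemma pos_lift (y : pos n) : (row_ y < n)%N ->
  exists x : pos n.-1, row_ x = row_ y /\ col_ x = col_ y.
Proof. by move=> yn; apply: pos_of (valP y) _; rewrite -ltnS prednK. Qed.

Lemma tab_decomp T : tab_set L T -> T = L + \sum_x dlt x *~ offset T x.
Proof.
move=> LT; apply/ffunP => y; have LT' := tab_setD (tab_set_refl L) (lat_sumMz (offset T)).
have [yn|ny] := ltnP (row_ y) n; last first.
  have yn : row_ y = n by apply/eqP; rewrite eqn_leq ny -ltnS ltn_ord.
  by rewrite (proj1 LT _ yn) (proj1 LT' _ yn).
have [x [xr xc]] := pos_lift yn.
by rewrite -!entry_pos -xr -xc entryD entry_sumMz offsetP.
Qed.

End Offsets.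

Lemma card_pos N : #|{: pos N}| = (N.+1 * N)./2.
Proof.
rewrite card_sig -sum1_card /= -[(N.+1 * N)./2]/((N.+1 * N.+1.-1)./2) -bin2 -bin2_sum.
rewrite -(pair_big_dep xpredT (fun i j : 'I_N.+1 => 0 < j <= i)%N (fun _ _ => 1%N)) /=.
rewrite big_mkord; apply: eq_bigr => i _.
rewrite -(big_mkord (fun j => 0 < j <= i)%N (fun _ => 1%N)).
transitivity (\sum_(0 <= j < i.+1 | (0 < j)%N) 1)%N.
  by rewrite [RHS](big_nat_widen _ _ N.+1).
by rewrite big_mkcond big_nat_recl //= sum_nat_const_nat subn0 muln1.
Qed.

Lemma has_dim_basis (F : fieldType) (W : lmodType F) (I : finType) (b : I -> W) k :
  #|I| = k -> is_basis b -> has_dim W k.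
Proof.
move=> <- [indep span]; exists (fun i => b (enum_val i)); split=> [x xb i|v].
  have := indep (fun m => x (enum_rank m)) _ (enum_val i); rewrite enum_valK; apply.
  rewrite -[RHS]xb (reindex_onto (@enum_val I I) enum_rank) => [|m _]; last exact: enum_rankK.
  by rewrite (eq_bigl xpredT) => [|j]; [apply: eq_bigr => j _|]; rewrite enum_valK ?eqxx.
have [x ->] := span v; exists (fun i => x (enum_val i)).
rewrite (reindex_onto (@enum_val I I) enum_rank) => [|m _]; last exact: enum_rankK.
by apply: eq_bigl => j; rewrite enum_valK eqxx.
Qed.

(* [tab_space] packed as an [lmodType]: its scaling is then syntactically the one of the
   lemmas above about an abstract [V]. *)
Section PackedTableaux.
Variables (F : fieldType) (n : nat) (L : tableau F n).

Definition tab_mod : lmodType F := tab_space L.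

Definition tab_basis : tableau F n -> tab_mod := tab_vec L.

Definition tab_op (f : tableau F n -> tab_mod) : tab_mod -> tab_mod := tab_lift f.

Lemma tab_opD f v w : tab_op f (v + w) = tab_op f v + tab_op f w.
Proof. exact: tab_liftD. Qed.

Lemma tab_opZ f a v : tab_op f (a *: v) = a *: tab_op f v.
Proof. exact: (@tab_liftZ _ _ L tab_mod f a v). Qed.

Lemma tab_op_vec f T : tab_set L T -> tab_op f (tab_basis T) = f T.
Proof. exact: (@tab_lift_vec _ _ L tab_mod f). Qed.

Lemma tab_mod_span (P : tab_mod -> Prop) : P 0 ->
  (forall a T v, tab_set L T -> P v -> P (a *: tab_basis T + v)) -> forall v, P v.
Proof.
move=> P0 PD v; have -> := tab_spanE (v : tab_space L).
elim/big_rec: _ => // b w _ Pw; apply: PD => //.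
exact: set_valP.
Qed.

Definition tab_fun (f : tableau F n -> F) (v : tab_mod) : F :=
  @tab_lift _ _ L F^o f v.

Lemma tab_funD f v w : tab_fun f (v + w) = tab_fun f v + tab_fun f w.
Proof. exact: (@tab_liftD _ _ L F^o f). Qed.

Lemma tab_funZ f a v : tab_fun f (a *: v) = a * tab_fun f v.
Proof. exact: (@tab_liftZ _ _ L F^o f a v). Qed.

Lemma tab_fun_vec f T : tab_set L T -> tab_fun f (tab_basis T) = f T.
Proof. exact: (@tab_lift_vec _ _ L F^o f). Qed.
End PackedTableaux.

(** * The module at a root of unity and its quotient by the relators *)

Section Main.
Variables (R : realType) (n d : nat) (q h : R[i]) (L : tableau R[i] n).
Variable p : pos n.-1 -> R[i].
Hypotheses (hn : (2 <= n)%N) (hd_odd : odd d) (hd : (2 < d)%N).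
Hypotheses (hh : cexp h = q) (hq : d.-primitive_root q) (hL : q_generic h L).
Hypothesis hp : forall c, p c != 0.
Local Notation C := R[i].
Local Notation V := (tab_mod L).
Local Notation vec := (@tab_basis _ _ L).
Local Notation tab := (tab_set L).
Local Notation Y := (tab_point h).
Local Notation dlt x := (delta_tab n (row_ x) (col_ x) : tableau C n).
Local Notation index := {ffun pos n.-1 -> 'I_d}.
Implicit Types (T : tableau C n) (x : pos n.-1) (m : index).

Let n0 : (0 < n)%N := ltnW hn.
Let d0 : (0 < d)%N := ltnW (ltnW hd).

Lemma root_sub_neq0 : q - q^-1 != 0.
Proof.
have q0 := q_neq0 hh; rewrite subr_eq0; apply/eqP => e.
have : q ^+ 2 = q ^+ 0 by rewrite expr2 {2}e divff.
move/eqP; rewrite (eq_prim_root_expr hq) mod0n modn_small //.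
Qed.

Definition gt_tab_module : amodule (Uq n q) V :=
  gt_module hh root_sub_neq0 hL (@tab_opD _ _ L)
  (@tab_opZ _ _ L) (@tab_op_vec _ _ L) (@tab_mod_span _ _ L).
Local Notation M := gt_tab_module.
Local Notation N := (gt_relators d p M).

Lemma gt_tab_actE : act M = Uq_act h vec (@tab_op _ _ L).
Proof. by []. Qed.

Lemma gt_formulas_module : gt_formulas h M.
Proof.
move=> T LT; rewrite gt_tab_actE; split=> k; cbv zeta.
- by rewrite (Uq_act_k hh root_sub_neq0 hL (@tab_opD _ _ L)
  (@tab_opZ _ _ L) (@tab_op_vec _ _ L) (@tab_mod_span _ _ L) k LT).
- by rewrite (Uq_act_e hh root_sub_neq0 hL (@tab_opD _ _ L)
  (@tab_opZ _ _ L) (@tab_op_vec _ _ L) (@tab_mod_span _ _ L) k LT).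
- by rewrite (Uq_act_f hh root_sub_neq0 hL (@tab_opD _ _ L)
  (@tab_opZ _ _ L) (@tab_op_vec _ _ L) (@tab_mod_span _ _ L) k LT).
Qed.

Lemma gt_act_op b k : (0 < k < n)%N -> exists u, forall T, tab T ->
  M u (vec T) = \sum_(1 <= j < k.+1)
    gcoef (q - q^-1) (Y T) k (other_row b k) j *: vec (T + tab_step R n b k j).
Proof.
rewrite gt_tab_actE => kn.
have [u uP] := Uq_act_op hh root_sub_neq0 hL (@tab_opD _ _ L)
  (@tab_opZ _ _ L) (@tab_op_vec _ _ L) (@tab_mod_span _ _ L) b kn.
by exists u => T /uP ->.
Qed.

Lemma gt_act_weight k : (0 < k <= n)%N -> exists u, forall T, tab T ->
  M u (vec T) = qpow h (gt_weight T k) *: vec T.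
Proof.
rewrite gt_tab_actE => kn.
have [u uP] := Uq_act_weight hh root_sub_neq0 hL (@tab_opD _ _ L)
  (@tab_opZ _ _ L) (@tab_op_vec _ _ L) (@tab_mod_span _ _ L) kn.
by exists u => T /uP ->.
Qed.

Lemma relatorP x T : tab T ->
  N (vec (T + dlt x *+ d) - p x *: vec T).
Proof.
move=> LT; have LT' : T \in tab_set L by rewrite inE.
exists [:: vec (T + dlt x *+ d) - p x *: vec T]; split; last by rewrite big_seq1.
move=> v; rewrite inE => /eqP ->; exists (exist _ T LT' : set_type _, x).
by move=> N'; apply.
Qed.

Definition rep (m : index) : tableau C n := shift_tab L m.

Lemma rep_tab m : tab (rep m).
Proof.
apply: tab_setD; first exact: tab_set_refl.
by apply: lat_sum => x; apply/latMn/lat_delta/row_lt.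
Qed.

Lemma repE m : rep m = L + \sum_x dlt x *~ (m x : nat)%:Z.
Proof. by []. Qed.

Lemma offset_rep m x : offset L (rep m) x = (m x : nat)%:Z.
Proof.
by apply: offset_unique; [exact: rep_tab|rewrite repE entryD entry_sumMz].
Qed.

Definition rep_index T : index := [ffun x => Ordinal (ltn_pmod `|(offset L T x %% d)%Z|%N d0)].

Lemma rep_indexE T x : (rep_index T x : nat)%:Z = (offset L T x %% d)%Z.
Proof.
have e : 0 <= (offset L T x %% d)%Z by rewrite modz_ge0 // eqz_nat -lt0n.
rewrite ffunE /= modn_small ?gez0_abs // -ltz_nat gez0_abs //.
by rewrite ltz_pmod // ltz_nat.
Qed.

(** Euclidean division by [d], entry by entry: remainders give the representative, quotients the
    periods. *)
Lemma tab_rep T : tab T ->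
  T = rep (rep_index T) + \sum_x dlt x *+ d *~ (offset L T x %/ d)%Z.
Proof.
move=> LT; rewrite {1}(tab_decomp n0 LT) repE -addrA -big_split /=; congr (_ + _).
apply: eq_bigr => x _; rewrite rep_indexE pmulrn mulrzA_C -mulrzDr.
by rewrite addrC -divz_eq.
Qed.

Lemma tab_point_period T x : Y (T + dlt x *+ d) = Y T.
Proof.
apply/funext => i; apply/funext => j.
rewrite /tab_point entryD qpowD entryMn qpowMn entry_delta; last 2 first.
- exact: (valP x).
- exact/ltnW/row_lt.
case: (_ && _); first by rewrite (qpow1 hh) (prim_expr_order hq) mulr1.
by rewrite qpow0 expr1n mulr1.
Qed.

Lemma tab_point_periods T (t : pos n.-1 -> int) :
  Y (T + \sum_x dlt x *+ d *~ t x) = Y T.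
Proof.
have mulMz (f : tableau C n) (k : int) i j : Y f i j = 1 -> Y (f *~ k) i j = 1.
  rewrite /tab_point entryMz => f1.
  by case: k => k; rewrite ?NegzE ?mulrNz -pmulrn ?qpowN qpowMn f1 expr1n ?invr1.
apply/funext => i; apply/funext => j.
rewrite [LHS]/tab_point entryD qpowD entry_sum qpow_sum big1 ?mulr1 // => x _.
apply: mulMz; rewrite -[dlt x *+ d]add0r tab_point_period /tab_point.
by rewrite -[0]/(0 *+ 0 : tableau C n) entryMn mulr0n qpow0.
Qed.

Lemma lat_period x : tab_set (0 : tableau C n) (dlt x *+ d).
Proof. by apply/latMn/lat_delta/row_lt. Qed.

Lemma offset_period T x0 x : tab T ->
  offset L (T + dlt x0 *+ d) x = offset L T x + (if x0 == x then d%:Z else 0).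
Proof.
move=> LT; apply: offset_unique; first by apply: tab_setD => //; exact: lat_period.
rewrite entryD entryMn entry_dlt // (offsetP x LT) intrD addrA; congr (_ + _).
by case: eqP; rewrite ?mul0rn.
Qed.

(* The coordinate of [T] on the class of [rep m], once [T + d delta_x] is identified
   with [p x] times [T]. *)
Definition coord m T : C :=
  if [forall x, (offset L T x %% d)%Z == (m x : nat)%:Z]
  then \prod_x p x ^ (offset L T x %/ d)%Z else 0.

(** Raising one entry by [d] keeps all remainders and adds 1 to a single quotient. *)
Lemma coord_period m T x0 : tab T -> coord m (T + dlt x0 *+ d) = p x0 * coord m T.
Proof.
move=> LT; have dz : d%:Z != 0 by rewrite eqz_nat -lt0n.
have modE x : (offset L (T + dlt x0 *+ d) x %% d)%Z = (offset L T x %% d)%Z.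
  by rewrite offset_period //; case: eqP => _; rewrite ?addr0 // modzDr.
have divE x : (offset L (T + dlt x0 *+ d) x %/ d)%Z =
    (offset L T x %/ d)%Z + (x0 == x)%:R.
  by rewrite offset_period //; case: eqP => _; rewrite ?addr0 // divzDr ?dvdzz // divzz dz.
rewrite /coord; under eq_forallb do rewrite modE.
case: ifP => _; last by rewrite mulr0.
rewrite (bigD1 x0) //= [in RHS](bigD1 x0) //= divE eqxx exprzDr ?unitfE // expr1z.
rewrite [X in X * _ = _]mulrC -mulrA; congr (_ * (_ * _)).
by apply: eq_bigr => x /negPf ne; rewrite divE eq_sym ne addr0.
Qed.

Definition tab_coord m : V -> C := tab_fun (coord m).

Lemma tab_coordD m v w : tab_coord m (v + w) = tab_coord m v + tab_coord m w.
Proof. exact: tab_funD. Qed.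

Lemma tab_coordZ m a v : tab_coord m (a *: v) = a * tab_coord m v.
Proof. exact: tab_funZ. Qed.

Lemma tab_coord0 m : tab_coord m 0 = 0.
Proof. by apply: (addrI (tab_coord m 0)); rewrite -tab_coordD !addr0. Qed.

Lemma tab_coord_vec m T : tab T -> tab_coord m (vec T) = coord m T.
Proof. exact: tab_fun_vec. Qed.

Lemma tab_coord_sum m (I : Type) (r : seq I) (v : I -> V) :
  tab_coord m (\sum_(i <- r) v i) = \sum_(i <- r) tab_coord m (v i).
Proof. exact: (big_morph (tab_coord m) (tab_coordD m) (tab_coord0 m)). Qed.

Lemma tab_coord_rep m m' : tab_coord m (vec (rep m')) = (m == m')%:R.
Proof.
rewrite tab_coord_vec; last exact: rep_tab.
have modE x : (offset L (rep m') x %% d)%Z = (m' x : nat)%:Z.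
  by rewrite offset_rep modz_small // lez_nat ltz_nat ltn_ord.
have divE x : (offset L (rep m') x %/ d)%Z = 0.
  by rewrite offset_rep divz_small // lez_nat /= ltz_nat ltn_ord.
rewrite /coord; case: forallP => [e|ne]; last first.
  have [e|//] := eqVneq m m'; case: ne => x; by rewrite modE e.
have -> : m = m'.
  by apply/ffunP => x; apply/val_inj; have := e x; rewrite modE eqz_nat => /eqP.
by rewrite eqxx big1 // => x _; rewrite divE expr0z.
Qed.

Definition tab_period x : V -> V := tab_op (fun T => vec (T + dlt x *+ d)).

Lemma tab_periodD x v w : tab_period x (v + w) = tab_period x v + tab_period x w.
Proof. exact: tab_opD. Qed.

Lemma tab_periodZ x a v : tab_period x (a *: v) = a *: tab_period x v.
Proof. exact: tab_opZ. Qed.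

Lemma tab_period_vec x T : tab T -> tab_period x (vec T) = vec (T + dlt x *+ d).
Proof. exact: tab_op_vec. Qed.

Lemma act_period u x v : M u (tab_period x v) = tab_period x (M u v).
Proof.
rewrite gt_tab_actE; exact: (Uq_act_translate hh (@tab_opD _ _ L)
  (@tab_opZ _ _ L) (@tab_op_vec _ _ L) (@tab_mod_span _ _ L) u v (lat_period x)
  (tab_point_period^~ x)).
Qed.

Lemma tab_coord_period m x v : tab_coord m (tab_period x v) = p x * tab_coord m v.
Proof.
elim/tab_mod_span: v => [|a T v LT IH].
  have -> : tab_period x 0 = 0.
    by apply: (addrI (tab_period x 0)); rewrite -tab_periodD !addr0.
  by rewrite tab_coord0 mulr0.
rewrite tab_periodD tab_periodZ tab_period_vec // !tab_coordD !tab_coordZ IH mulrDr.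
rewrite !tab_coord_vec ?coord_period //; first by rewrite mulrCA.
by apply: tab_setD => //; exact: lat_period.
Qed.

Definition coord_kernel_set (v : V) : Prop := forall u m, tab_coord m (M u v) = 0.

Lemma coord_kernel0 : coord_kernel_set 0.
Proof. by move=> u m; rewrite actr0 tab_coord0. Qed.

Lemma coord_kernelD v w :
  coord_kernel_set v -> coord_kernel_set w -> coord_kernel_set (v + w).
Proof. by move=> kv kw u m; rewrite actDr tab_coordD kv kw addr0. Qed.

Lemma coord_kernelA a v : coord_kernel_set v -> coord_kernel_set (M a v).
Proof. by move=> kv u m; rewrite -actM. Qed.

(* The largest submodule on which all [tab_coord m] vanish. *)
Definition coord_kernel : submodule M :=
  Submodule coord_kernel0 coord_kernelD coord_kernelA.

(** A generated submodule lies in every submodule containing its generator, so it suffices that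
    [coord_kernel] contains the generators. There the action commutes with the period, which each
    [tab_coord] turns into multiplication by [p x]. *)
Lemma relators_coord v m : N v -> tab_coord m v = 0.
Proof.
move=> [s [sP ->]]; rewrite tab_coord_sum big_seq big1 // => y ys.
have [[[T LT] x] yW] := sP y ys.
have : coord_kernel y.
  apply: yW => u m'; have LT' : tab T := set_mem LT.
  rewrite -[val _]/T.
  rewrite -[tab_vec L (T + _)](tab_period_vec x LT') -[tab_vec L T]/(vec T).
  rewrite (actDr M) tab_coordD act_period tab_coord_period.
  by rewrite (actN M) -scaleN1r actrZ !tab_coordZ mulN1r subrr.
by move=> /(_ 1 m); rewrite act1.
Qed.

Lemma rep_approx T : tab T ->
  approx vec N T (rep (rep_index T)).
Proof.
move=> LT; rewrite {1}(tab_rep LT).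
exact: (approx_periods relatorP _ hp n0 (rep_tab _)).
Qed.

Lemma rep_same m m' : same h n.-1 (rep m) (rep m') -> m = m'.
Proof.
move=> s; apply/ffunP => x; apply/val_inj.
have xn : (row_ x <= n.-1)%N by rewrite -ltnS ltn_ord.
have := s (row_ x) (col_ x) xn; rewrite /tab_point !repE !entryD !entry_sumMz //.
rewrite !qpowD !(qpow_int hh) => /mulfI; rewrite qpow_neq0 => /(_ isT)/eqP.
by rewrite -!exprnP (eq_prim_root_expr hq) !modn_small // => /eqP.
Qed.

Definition reps := [seq rep m | m <- enum {: index}].

Lemma reps_cover T : tab T -> ~ all_in (fun S => ~ same h n T S) reps.
Proof.
move=> LT nS.
have nsame m : ~ same h n T (rep m).
  move: nS; rewrite /reps; have : m \in enum {: index} by rewrite mem_enum.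
  elim: (enum _) => //= m' s IH; rewrite inE => /orP[/eqP -> []//|ms [_]]; exact: IH.
apply: (nsame (rep_index T)) => i j _; rewrite {1}(tab_rep LT).
by rewrite tab_point_periods.
Qed.

Lemma reps_tab : all_in tab reps.
Proof. by rewrite /reps; elim: (enum _) => //= m s IH; split=> //; exact: rep_tab. Qed.

(** Going through [L + (rep m' - L) + T - L] rather than directly, so that only nonnegative
    multiples of raising and of lowering shifts are composed. *)
Lemma rep_shift m m' : shift_op L vec N (fun=> 1) (rep m' - rep m).
Proof.
have sums := @shift_sum _ _ _ _ _ _ hh root_sub_neq0 hL hd_odd hq _ _ M N p
  gt_act_op gt_act_weight relatorP reps reps_tab reps_cover.
have [up upl] := sums (fun x => m' x) true n0.
have [down downl] := sums (fun x => m x) false n0.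
have -> : rep m' - rep m = \sum_x tab_step R n true (row_ x) (col_ x) *+ m' x +
    \sum_x tab_step R n false (row_ x) (col_ x) *+ m x.
  rewrite /rep /shift_tab opprD addrACA subrr add0r -sumrN; congr (_ + _).
  by apply: eq_bigr => x _; rewrite /tab_step mulNrn.
by apply: shift_op_ext (shift_op_comp upl up down) => T _; rewrite mulr1.
Qed.

Lemma relators_proper : exists v : V, ~ N v.
Proof.
exists (vec (rep [ffun=> Ordinal d0])) => /(relators_coord [ffun=> Ordinal d0]).
by rewrite tab_coord_rep eqxx => /eqP; rewrite oner_eq0.
Qed.

Definition rep_span := @approx_span _ _ _ L V vec M N index rep (@tab_mod_span _ _ L)
  (fun T LT => ex_intro _ (rep_index T) (rep_approx LT)).

Lemma gt_quot_irreducible : irreducible_module (quot_module N).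
Proof.
exact: (quot_irreducible hh root_sub_neq0 hL hd_odd hq gt_act_op gt_act_weight relatorP
  reps_tab reps_cover n0 rep_tab rep_same rep_span rep_shift relators_proper).
Qed.

Lemma gt_quot_basis : is_basis (fun m => to_quot N (vec (rep m))).
Proof.
exact: (quot_basis tab_coordD tab_coordZ (fun m v Nv => relators_coord m Nv)
  tab_coord_rep rep_span).
Qed.

Lemma gt_quot_dim : has_dim (quot N) (d ^ (n * n.-1)./2).
Proof.
apply: has_dim_basis gt_quot_basis.
by rewrite card_ffun card_ord card_pos prednK.
Qed.
End Main.

Theorem theorem7p7 (R : realType) (n d : nat) (q h : R[i])
    (L : tableau R[i] n) (p : pos n.-1 -> R[i])
    (hn : (2 <= n)%N) (hd_odd : odd d) (hd : (2 < d)%N)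
    (hh : cexp h = q) (hq : d.-primitive_root q)
    (hL : q_generic h L)
    (hp : forall c, p c != 0) :
  exists V : amodule (Uq n q) (tab_space L),
    gt_formulas h V /\
    let N := gt_relators d p V in
    [/\ irreducible_module (quot_module N),
        has_dim (quot N) (d ^ (n * n.-1)./2) &
        is_basis (fun m : {ffun pos n.-1 -> 'I_d} =>
                    to_quot N (tab_vec L (shift_tab L m)))].
Proof.
exists (gt_tab_module hd hh hq hL); split; first exact: gt_formulas_module.
split.
- exact: (gt_quot_irreducible hn hd_odd hd hh hq hL hp).
- exact: (gt_quot_dim hn hd hh hq hL hp).
- exact: (gt_quot_basis hn hd hh hq hL hp).
Qed.
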